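(* Let $D=\left]-\tfrac12,\tfrac12\right[^2$, $d=4$, let $D_1,\dots,D_4$ be the four open quadrant squares of $D$, let $\theta\in\,]0,1[$ and $f\in V'$, and let $u(y)\in V=H^1_0(D)$, $y\in U=[-1,1]^4$, be the weak solution of $-\operatorname{div}\big((1-\theta\sum_{i=1}^4 y_i\chi_{D_i})\nabla u(y)\big)=f$. For each integer $k\ge 1$, with $n(k):=8k+5$, there exist $v_1,\dots,v_{n(k)}\in V$ and polynomials $\phi_1,\dots,\phi_{n(k)}$ in $y=(y_1,\dots,y_4)$, each of total degree at most $k$, such that the truncated power series $u_k(y)=\sum_{|\nu|\le k}t_\nu y^\nu$ of $u$ satisfies $$u_k(y)=\sum_{\ell=1}^{n(k)}\phi_\ell(y)\,v_\ell ,\qquad y\in U.$$ Therefore $\operatorname{rank}(u_k)\le 8k+5$.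
   Context: $D_1=\left]-\tfrac12,0\right[^2$, $D_2=\left]0,\tfrac12\right[\times\left]-\tfrac12,0\right[$, $D_3=\left]-\tfrac12,0\right[\times\left]0,\tfrac12\right[$, $D_4=\left]0,\tfrac12\right[^2$. The space $V=H^1_0(D)$ carries the norm $\|v\|_V=\|\nabla v\|_{L^2(D)}$, and $V'$ is its dual. For $y\in U=[-1,1]^4$, $u(y)\in V$ is the unique solution of $\sum_{i=1}^4(1-\theta y_i)\int_{D_i}\nabla u(y)\cdot\nabla v\,dx=\langle f,v\rangle$ for all $v\in V$. The Taylor coefficients are $t_\nu=\frac1{\nu!}\partial^\nu u(0)\in V$ for $\nu\in\mathbb{N}_0^4$, with $|\nu|=\nu_1+\dots+\nu_4$ and $y^\nu=\prod_i y_i^{\nu_i}$. For $w\in L^2(U,V,\mu)$, where $\mu$ is a given probability measure on $U$ (e.g. the uniform one), $\operatorname{rank}(w)$ is the dimension of the range of the operator $\mathcal{M}_w:L^2(U,\mu)\to V$, $\mathcal{M}_w\varphi=\int_U w(y)\varphi(y)\,d\mu(y)$. *)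

(* Defs.v *)
From HB Require Import structures.
From mathcomp Require Import all_boot all_order all_algebra.
From mathcomp Require Import all_classical all_reals all_analysis.
From mathcomp Require Import measurable_realfun ring_quotient lra ring.
(* The notations of mpoly clash with those of MathComp-Analysis: only its
   canonical structures and coercions are imported. *)
From mathcomp Require mpoly.
Import (canonicals, coercions) mpoly.
Set Implicit Arguments.
Unset Strict Implicit.
Unset Printing Implicit Defensive.
Import Order.TTheory GRing.Theory Num.Theory.
Import numFieldNormedType.Exports.
Local Open Scope quotient_scope.
Local Open Scope ring_scope.
Local Open Scope classical_set_scope.

(* L^2(mu), as the library's square-integrable functions modulo the functions of
   zero L^2-norm, with its norm.  [L2fun] picks a representative, so the value
   of an element of L^2 at a point is only meaningful almost everywhere. *)
Section L2space.
Context (d : measure_display) (T : measurableType d) (R : realType).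
Variable mu : {measure set T -> \bar R}.
Notation pre := (LfunType mu (lee1n 2)).

Definition nrm2 (f : pre) : R := fine 'N[mu]_2%:E[EFin \o f]%E.

Definition L2null : {pred pre} := [pred f | nrm2 f == 0].

Lemma nrm2_ge0 f : 0 <= nrm2 f.
Proof. by rewrite /nrm2 fine_ge0// Lnorm_ge0. Qed.

Lemma nrm2D f g : nrm2 (f + g) <= nrm2 f + nrm2 g.
Proof. exact: ler_LnormD. Qed.

Lemma nrm2N f : nrm2 (- f) = nrm2 f.
Proof. exact: LnormrN. Qed.

Lemma nrm2Z a f : nrm2 (a *: f) = `|a| * nrm2 f.
Proof.
apply/EFin_inj; rewrite EFinM !finite_norm_fine -LnormZ.
by [].
Qed.

Fact L2null_zmod_closed : zmod_closed L2null.
Proof.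
split=> [|f g]; rewrite !inE.
  by rewrite -(scale0r (0 : pre)) nrm2Z normr0 mul0r.
move=> /eqP f0 /eqP g0; rewrite eq_le nrm2_ge0 andbT.
by rewrite (le_trans (nrm2D _ _))// nrm2N f0 g0 addr0.
Qed.
HB.instance Definition _ := GRing.isZmodClosed.Build pre L2null L2null_zmod_closed.

Definition L2 : Type := Quotient.quot L2null.
HB.instance Definition _ := EqQuotient.on L2.
HB.instance Definition _ := GRing.Zmodule.on L2.

Definition L2fun (x : L2) : T -> R := repr x : pre.
Coercion L2fun : L2 >-> Funclass.

Lemma L2eqP (f g : pre) : \pi_L2 f = \pi_L2 g <-> nrm2 (f - g) = 0.
Proof.
split=> [/eqP|/eqP fg]; last by apply/eqP; rewrite -Quotient.idealrBE.
by rewrite -Quotient.idealrBE => /eqP.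
Qed.
Lemma L2piD (f g : pre) : \pi_L2 (f + g) = \pi_L2 f + \pi_L2 g.
Proof. by rewrite piE. Qed.

Lemma L2repr_sub (f : pre) : nrm2 (repr (\pi_L2 f) - f) = 0.
Proof. by apply/L2eqP; rewrite reprK. Qed.

Definition L2scale (a : R) (x : L2) : L2 := \pi_L2 (a *: (repr x : pre)).
Lemma L2piZ a (f : pre) : \pi_L2 (a *: f) = L2scale a (\pi_L2 f).
Proof.
by apply/esym/L2eqP; rewrite -scalerBr nrm2Z L2repr_sub mulr0.
Qed.
Let scaleA a b x : L2scale a (L2scale b x) = L2scale (a * b) x.
Proof. by rewrite -[x]reprK -(L2piZ b) -(L2piZ (a * b)) -L2piZ scalerA. Qed.
Let scale1 : left_id 1 L2scale.
Proof. by move=> x; rewrite -[x]reprK -L2piZ scale1r. Qed.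
Let scaleDr : right_distributive L2scale +%R.
Proof.
by move=> a x y; rewrite -[x]reprK -[y]reprK -L2piD -!L2piZ -L2piD scalerDr.
Qed.
Let scaleDl v : {morph L2scale^~ v : a b / a + b}.
Proof. by move=> a b; rewrite -[v]reprK -!L2piZ -L2piD scalerDl. Qed.
HB.instance Definition _ :=
  GRing.Zmodule_isLmodule.Build R L2 scaleA scale1 scaleDr scaleDl.

Definition L2norm (x : L2) : R := nrm2 (repr x).
Lemma L2norm_pi f : L2norm (\pi_L2 f) = nrm2 f.
Proof.
rewrite /L2norm; apply/eqP; rewrite eq_le; apply/andP; split.
  by rewrite -[repr _](subrK f) (le_trans (nrm2D _ _))// L2repr_sub add0r.
rewrite -[f in nrm2 f](subrK (repr (\pi_L2 f))) (le_trans (nrm2D _ _))//.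
by rewrite -opprB nrm2N L2repr_sub add0r.
Qed.
Let normD x y : L2norm (x + y) <= L2norm x + L2norm y.
Proof. by rewrite -[x]reprK -[y]reprK -L2piD !L2norm_pi nrm2D. Qed.
Let normZ a x : L2norm (a *: x) = `|a| * L2norm x.
Proof. by rewrite -[x]reprK /GRing.scale/= -L2piZ !L2norm_pi nrm2Z. Qed.
Let norm0 x : L2norm x = 0 -> x = 0.
Proof.
move=> x0; rewrite -[x]reprK -[0]reprK; apply/L2eqP.
have r0 : nrm2 (repr (0 : L2)) = 0.
  by rewrite -/(L2norm 0) -(scale0r 0) normZ normr0 mul0r.
apply/eqP; rewrite eq_le nrm2_ge0 andbT.
by rewrite (le_trans (nrm2D _ _))// nrm2N r0 addr0 -/(L2norm x) x0.
Qed.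
HB.instance Definition _ := Lmodule_isNormed.Build R L2 normD normZ norm0.

Lemma L2ae_pi (f : LfunType mu (lee1n 2)) :
  {ae mu, forall x, (\pi_L2 f : L2) x = f x}.
Proof.
have /fine_Lnormr_eq0 := L2repr_sub f.
by apply: filterS => x /(_ I) h; apply/eqP; rewrite -subr_eq0; apply/eqP; exact: h.
Qed.
Lemma L2ae_lin (a : R) (x y : L2) :
  {ae mu, forall t, (a *: x + y : L2) t = a * x t + y t}.
Proof.
have -> : a *: x + y = \pi_L2 (a *: repr x + repr y).
  by rewrite L2piD L2piZ !reprK.
by apply: filterS (L2ae_pi (a *: repr x + repr y)) => t ->.
Qed.
Lemma L2norm_le (x y : L2) (f g : T -> R) :
  measurable_fun setT f -> measurable_fun setT g ->
  {ae mu, forall t, x t = f t} -> {ae mu, forall t, y t = g t} ->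
  (\int[mu]_t (f t ^+ 2)%:E <= \int[mu]_t (g t ^+ 2)%:E)%E ->
  `|x| <= `|y|.
Proof.
move=> mf mg xf yg fg.
have E (z : L2) (h : T -> R) : measurable_fun setT h ->
    {ae mu, forall t, z t = h t} ->
    'N[mu]_2%:E[EFin \o z]%E = ((\int[mu]_t (h t ^+ 2)%:E) `^ 2^-1)%E.
  move=> mh zh; rewrite unlock; congr (_ `^ _)%E.
  rewrite (eq_integral (fun t => (z t ^+ 2)%:E)); last first.
    by move=> t _ /=; rewrite powR_mulrn// real_normK// num_real.
  apply: ae_eq_integral => //.
  - by apply/measurable_EFinP; apply: measurable_funX.
  - by apply/measurable_EFinP; exact: measurable_funX.
  - by apply: filterS zh => t /= -> _.
rewrite /Num.Def.normr/= /L2norm -lee_fin !finite_norm_fine.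
rewrite -/(L2fun x) -/(L2fun y) (E _ _ mf xf) (E _ _ mg yg).
by apply: gt0_ler_poweR => //; rewrite ?in_itv/= ?leey ?andbT ?integral_ge0//;
  move=> *; rewrite lee_fin sqr_ge0.
Qed.
End L2space.

Definition plane (R : realType) : Type := (measurableTypeR R * measurableTypeR R)%type.
HB.instance Definition _ (R : realType) := Measurable.on (plane R).
Definition leb2 (R : realType) : {measure set (plane R) -> \bar R} :=
  (@lebesgue_measure R \x @lebesgue_measure R)%E.

Section plane_facts.
Variable R : realType.

Lemma open_plane_measurable (O : set (R * R)) : open O -> measurable (O : set (plane R)).
Proof.
move=> oO.
pose box (q1 q2 : rat) (d : R) : set (plane R) :=
  `](ratr q1 - d), (ratr q1 + d)[%classic `*`
  `](ratr q2 - d), (ratr q2 + d)[%classic.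
pose F q1 q2 n := if `[< box q1 q2 n.+1%:R^-1 `<=` O >]
  then box q1 q2 n.+1%:R^-1 else set0.
suff -> : (O : set (plane R)) = \bigcup_q1 \bigcup_q2 \bigcup_n F q1 q2 n.
  apply: bigcupT_measurable_rat => q1; apply: bigcupT_measurable_rat => q2.
  apply: bigcupT_measurable => n; rewrite /F; case: ifPn => // _.
  by apply: measurableX; exact: measurable_itv.
apply/seteqP; split=> [[x y] Oxy|p [q1 _ [q2 _ [n _]]]]; last first.
  by rewrite /F; case: ifPn => // /asboolP; exact.
have [e/= e0 He] : exists2 e : R, 0 < e & ball (x, y) e `<=` O.
  by move: (oO); rewrite openE => /(_ _ Oxy)/nbhs_ballP[e/= e0 ?]; exists e.
have [n ne] : exists n, n.+1%:R^-1 < e / 2.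
  have := near_infty_natSinv_lt (PosNum (divr_gt0 e0 (ltr0Sn _ 1))).
  by move=> [n _ /(_ n (leqnn n))] ne; exists n.
have n0 : (0:R) < n.+1%:R^-1 by rewrite invr_gt0.
suff [q1 [q2 [qb qO]]] :
    exists q1 q2, box q1 q2 n.+1%:R^-1 (x, y) /\ box q1 q2 n.+1%:R^-1 `<=` O.
  by exists q1 => //; exists q2 => //; exists n => //; rewrite /F asboolT.
move: n0 ne; move: n.+1%:R^-1 => d {n} d0 de.
have rt (z : R) : exists q : rat, `|z - ratr q| < d.
  have [|q] := @rat_in_itvoo R (z - d) (z + d); first by lra.
  rewrite in_itv/= => /andP[q1 q2]; exists q.
  by rewrite ltr_norml; apply/andP; split; lra.
have [q1 Hq1] := rt x; have [q2 Hq2] := rt y.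
exists q1, q2; split.
  by split; rewrite /= in_itv/=; move: Hq1 Hq2; rewrite !ltr_norml;
    move=> /andP[? ?] /andP[? ?]; apply/andP; split; lra.
move=> [a b] [/=]; rewrite !in_itv/= => /andP[a1 a2] /andP[b1 b2].
move: Hq1 Hq2; rewrite !ltr_norml => /andP[? ?] /andP[? ?].
by apply: He; split; rewrite /ball/= ltr_norml; apply/andP; split; lra.
Qed.

Lemma continuous_plane_measurable (phi : R * R -> R) :
  continuous phi -> measurable_fun [set: plane R] phi.
Proof.
move=> cphi; apply: (measurability _ (measurable_realfun.RGenOInfty.measurableE R)).
move=> _ [_ [a ->] <-]; rewrite setTI.
apply: open_plane_measurable.
by move/continuousP : cphi; apply; exact: interval_open.
Qed.
Lemma poincare1 (h : R -> R) :
  (forall x, derivable h x 1) -> continuous (derive1 h) ->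
  h (- 2^-1) = 0 -> h (2^-1) = 0 ->
  (\int[lebesgue_measure]_(x in `](- 2^-1)%R, 2^-1%R[) ((h x) ^+ 2)%:E <=
   \int[lebesgue_measure]_(x in `](- 2^-1)%R, 2^-1%R[) ((derive1 h x) ^+ 2)%:E)%E.
Proof.
move=> dh ch' h1 h2.
have ch : continuous h.
  by move=> x; apply: differentiable_continuous; exact/derivable1_diffP.
have sqc (g : R -> R) : continuous g -> continuous (fun x => g x ^+ 2).
  move=> cg x; apply: (@continuous_comp _ _ _ g (fun x => x ^+ 2)); first exact: cg.
  exact: exprn_continuous.
pose F (x : R) := x * h x ^+ 2.
pose f (x : R) := h x ^+ 2 + 2 * x * h x * derive1 h x.
have cf : continuous f.
  move=> x; apply: cvgD; first by exact: (sqc _ ch).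
  apply: cvgM; last exact: ch'.
  apply: cvgM; last exact: ch.
  by apply: cvgM; [exact: cvg_cst|exact: cvg_id].
have dF (x : R) : is_derive x 1 F (f x).
  have dhx : is_derive (x : R) 1 h (derive1 h x) by rewrite derive1E; apply: derivableP.
  rewrite /F; apply: is_derive_eq.
  by rewrite /GRing.scale/= /f; ring.
have dFd (x : R) : derivable F x 1 by have [] := dF x.
have cF : continuous F.
  by move=> x; apply: differentiable_continuous; exact/derivable1_diffP.
have E0 : (\int[lebesgue_measure]_(x in `[(- 2^-1)%R, 2^-1%R]) (f x)%:E = 0)%E.
  rewrite (@continuous_FTC2 _ f F)//.
  - by rewrite /F h1 h2 expr0n/= !mulr0 subee.
  - lra.
  - exact: continuous_subspaceT.
  - split => //.
    + by apply: cvg_at_right_filter; exact: cF.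
    + by apply: cvg_at_left_filter; exact: cF.
  - by move=> x _; rewrite derive1E; have [_ ->] := dF x.
have mc (g : R -> R) (A : set (measurableTypeR R)) :
    continuous g -> measurable_fun A g.
  by move=> cg; apply: measurable_funTS;
    exact: continuous_measurable_fun.
have cI (g : R -> R) : continuous g ->
    lebesgue_measure.-integrable `[(- 2^-1)%R, 2^-1%R] (fun x => (g x)%:E).
  move=> cg; apply: continuous_compact_integrable; first exact: segment_compact.
  exact: continuous_subspaceT.
have cg2 : continuous (fun x => derive1 h x ^+ 2).
  by move=> x; exact: (sqc _ ch').
have cg1 : continuous (fun x => h x ^+ 2).
  by move=> x; exact: (sqc _ ch).
have co (g : R -> R) : continuous g ->
    (\int[lebesgue_measure]_(x in `](- 2^-1)%R, 2^-1%R[) (g x)%:E =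
     \int[lebesgue_measure]_(x in `[(- 2^-1)%R, 2^-1%R]) (g x)%:E)%E.
  by move=> cg; apply/esym; apply: integral_itv_bndoo; apply/measurable_EFinP; exact: mc.
rewrite !co//.
have -> : (\int[lebesgue_measure]_(x in `[(- 2^-1)%R, 2^-1%R]) ((derive1 h x) ^+ 2)%:E =
    \int[lebesgue_measure]_(x in `[(- 2^-1)%R, 2^-1%R]) ((2 * f x)%:E + ((derive1 h x) ^+ 2)%:E))%E.
  rewrite integralD//=; last exact: (cI _ cg2).
    under [X in (_ = X + _)%E]eq_integral do rewrite EFinM.
    rewrite integralZl//; last exact: (cI _ cf).
    by rewrite E0 mule0 add0e.
  apply: (cI (fun x => 2 * f x)) => x.
  by apply: cvgM; [exact: cvg_cst|exact: cf].
apply: le_integral => //.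
- exact: (cI _ cg1).
- apply: (cI (fun x => 2 * f x + derive1 h x ^+ 2)) => x.
  by apply: cvgD; [apply: cvgM; [exact: cvg_cst|exact: cf]|exact: cg2].
- move=> x; rewrite inE/= in_itv/= => /andP[x1 x2].
  rewrite -EFinD lee_fin /f.
  have : 0 <= (h x + 2 * x * derive1 h x) ^+ 2 by exact: sqr_ge0.
  have : 0 <= (1 - 4 * x ^+ 2) * derive1 h x ^+ 2.
    by apply: mulr_ge0; [nra|exact: sqr_ge0].
  nra.
Qed.
End plane_facts.

Section H10.
Variable R : realType.

Definition D : set (plane R) :=
  `](- 2^-1), 2^-1[%classic `*` `](- 2^-1), 2^-1[%classic.

Lemma measurable_D : measurable D.
Proof. by apply: measurableX; exact: measurable_itv. Qed.

Definition lebD : {measure set (plane R) -> \bar R} := mrestr (leb2 R) measurable_D.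

Definition pd1 (phi : R * R -> R) (p : R * R) : R :=
  derive1 (fun s => phi (s, p.2)) p.1.
Definition pd2 (phi : R * R -> R) (p : R * R) : R :=
  derive1 (fun s => phi (p.1, s)) p.2.

(* [phi] is of class C^k on the whole plane. *)
Fixpoint Ck (k : nat) (phi : R * R -> R) : Prop :=
  continuous phi /\
  if k is k'.+1 then
    [/\ forall p, derivable (fun s => phi (s, p.2)) p.1 1,
        forall p, derivable (fun s => phi (p.1, s)) p.2 1,
        Ck k' (pd1 phi) & Ck k' (pd2 phi)]
  else True.

Definition test_function (phi : R * R -> R) : Prop :=
  (forall k, Ck k phi) /\
  exists2 K : set (R * R), compact K /\ K `<=` D & forall p, ~ K p -> phi p = 0.

Lemma integral_lebD (f : plane R -> \bar R) : measurable_fun setT f ->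
  (forall p, (0 <= f p)%E) ->
  (\int[lebD]_p f p = \int[leb2 R]_(p in D) f p)%E.
Proof.
move=> mf f0.
have N0 : lebD (~` D) = 0%E by rewrite /lebD/= /mrestr setICl measure0.
have mN : measurable (~` D) by apply: measurableC; exact: measurable_D.
rewrite (@ge0_negligible_integral _ _ _ _ _ (~` D) _ mN measurableT mf _ N0); last first.
  by move=> x _; exact: f0.
rewrite setTD setCK; apply: eq_measure_integral => A mA AD.
by rewrite /lebD/= /mrestr setIidl.
Qed.

Lemma poincare_test (phi : R * R -> R) : test_function phi ->
  (\int[lebD]_p (phi p ^+ 2)%:E <= \int[lebD]_p (pd1 phi p ^+ 2)%:E)%E.
Proof.
move=> [sphi [K [cK KD] phiK]].
have [cphi [d1 _ [cd1 _] _]] := sphi 1%N.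
have mX (g : R * R -> R) : continuous g ->
    measurable_fun [set: plane R] (fun p : plane R => (g p ^+ 2)%:E).
  move=> cg; apply/measurable_EFinP; apply: measurable_funX.
  exact: continuous_plane_measurable.
rewrite (integral_lebD (mX _ cphi)); last by move=> p; rewrite lee_fin sqr_ge0.
rewrite (integral_lebD (mX _ cd1)); last by move=> p; rewrite lee_fin sqr_ge0.
have mR (g : R * R -> R) : continuous g ->
    measurable_fun [set: plane R] ((fun p : plane R => (g p ^+ 2)%:E) \_ D).
  move=> cg; apply/(measurable_restrictT _ measurable_D).
  by apply: measurable_funTS; exact: mX.
have ge0 (g : R * R -> R) (p : plane R) :
    (0 <= ((fun p : plane R => (g p ^+ 2)%:E) \_ D) p)%E.
  by rewrite patchE; case: ifP => // _; rewrite lee_fin sqr_ge0.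
rewrite [leLHS]integral_mkcond [leRHS]integral_mkcond.
rewrite (fubini_tonelli2 _ (mR _ cphi) (ge0 _)).
rewrite (fubini_tonelli2 _ (mR _ cd1) (ge0 _)).
apply: ge0_le_integral => //.
- by move=> y _; apply: integral_ge0.
- by apply: measurable_fun_fubini_tonelli_G => //; exact: mR.
- by apply: measurable_fun_fubini_tonelli_G => //; exact: mR.
move=> y _; rewrite /fubini_G.
have [yI|yI] := pselect (`](- 2^-1)%R, 2^-1%R[%classic y); last first.
  rewrite integral0_eq//; first by apply: integral_ge0.
  by move=> x _; rewrite patchE ifF//; apply/negbTE; rewrite notin_setE => -[].
have E (g : R * R -> R) : (\int[lebesgue_measure]_x
      ((fun p : plane R => (g p ^+ 2)%:E) \_ D) (x, y) =
    \int[lebesgue_measure]_(x in `](- 2^-1)%R, 2^-1%R[) (g (x, y) ^+ 2)%:E)%E.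
  rewrite [RHS]integral_mkcond; apply: eq_integral => x _.
  rewrite !patchE; congr (if _ then _ else _).
  by apply/idP/idP; rewrite !inE => // -[].
rewrite !E; apply: (@poincare1 R (fun x => phi (x, y))).
- by move=> x; exact: (d1 (x, y)).
- have cy : continuous (fun s : R => (s, y) : R * R).
    by move=> s; apply: (@cvg_pair _ _ _ _ (nbhs s) (nbhs (y : R))); [exact: cvg_id|exact: cvg_cst].
  by move=> x; apply: (@continuous_comp _ _ _ (fun s => (s, y)) (pd1 phi));
    [exact: cy|exact: cd1].
- apply: phiK => /KD[/=]; by rewrite in_itv/= ltxx.
- by apply: phiK => /KD[/=]; rewrite in_itv/= ltxx andbF.
Qed.

Local Notation L2D := (L2 lebD).

(* The triples (phi, d1 phi, d2 phi), phi in C_c^oo(D), inside L^2(D)^3. *)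
Definition test_graph : set (L2D * L2D * L2D) :=
  [set t : L2D * L2D * L2D | exists phi : R * R -> R, [/\ test_function phi,
    {ae lebD, forall p, t.1.1 p = phi p},
    {ae lebD, forall p, t.1.2 p = pd1 phi p} &
    {ae lebD, forall p, t.2 p = pd2 phi p}]].

Definition H10_pred : {pred L2D * L2D * L2D} := mem (closure test_graph).

Lemma pd1_lin a (phi psi : R * R -> R) :
  (forall p, derivable (fun s => phi (s, p.2)) p.1 1) ->
  (forall p, derivable (fun s => psi (s, p.2)) p.1 1) ->
  pd1 (a \*: phi \+ psi) = a \*: pd1 phi \+ pd1 psi.
Proof.
move=> d1 d2; apply/funext => -[x y]; rewrite /pd1 /= !derive1E.
have /= h1 := d1 (x, y); have /= h2 := d2 (x, y).
rewrite -[RHS]/(a *: 'D_1 (fun s : R => phi (s, y)) x + 'D_1 (fun s : R => psi (s, y)) x).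
rewrite -(deriveZ _ h1).
exact: (deriveD (derivableZ h1) h2).
Qed.

Lemma pd2_lin a (phi psi : R * R -> R) :
  (forall p, derivable (fun s => phi (p.1, s)) p.2 1) ->
  (forall p, derivable (fun s => psi (p.1, s)) p.2 1) ->
  pd2 (a \*: phi \+ psi) = a \*: pd2 phi \+ pd2 psi.
Proof.
move=> d1 d2; apply/funext => -[x y]; rewrite /pd2 /= !derive1E.
have /= h1 := d1 (x, y); have /= h2 := d2 (x, y).
rewrite -[RHS]/(a *: 'D_1 (fun s : R => phi (x, s)) y + 'D_1 (fun s : R => psi (x, s)) y).
rewrite -(deriveZ _ h1).
exact: (deriveD (derivableZ h1) h2).
Qed.

Lemma Ck_lin k a (phi psi : R * R -> R) :
  Ck k phi -> Ck k psi -> Ck k (a \*: phi \+ psi).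
Proof.
elim: k phi psi => [|k IH] phi psi [c1 h1] [c2 h2]; split.
- by move=> p; apply: cvgD; [apply: cvgZ; [exact: cvg_cst|exact: c1]|exact: c2].
- by [].
- by move=> p; apply: cvgD; [apply: cvgZ; [exact: cvg_cst|exact: c1]|exact: c2].
case: h1 => d1 e1 k1 l1; case: h2 => d2 e2 k2 l2; split.
- by move=> p; apply: derivableD; [apply: derivableZ; exact: d1|exact: d2].
- by move=> p; apply: derivableD; [apply: derivableZ; exact: e1|exact: e2].
- by rewrite pd1_lin//; exact: IH.
- by rewrite pd2_lin//; exact: IH.
Qed.

Lemma test_lin a (phi psi : R * R -> R) :
  test_function phi -> test_function psi -> test_function (a \*: phi \+ psi).
Proof.
move=> [s1 [K1 [c1 D1] z1]] [s2 [K2 [c2 D2] z2]]; split.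
  by move=> k; exact: Ck_lin.
exists (K1 `|` K2).
  split; first exact: compactU.
  by move=> p [/D1|/D2].
move=> p nK; rewrite /= z1 ?z2 ?scaler0 ?addr0//.
  by move=> h; apply: nK; right.
by move=> h; apply: nK; left.
Qed.

Lemma derive1_cst0 (x : R) : derive1 (fun=> 0 : R) x = 0.
Proof. by rewrite derive1E derive_cst. Qed.

Lemma pd1_0 : pd1 (fun=> 0 : R) = fun=> 0 :> R.
Proof. by apply/funext => p; rewrite /pd1 derive1_cst0. Qed.

Lemma pd2_0 : pd2 (fun=> 0 : R) = fun=> 0 :> R.
Proof. by apply/funext => p; rewrite /pd2 derive1_cst0. Qed.

Lemma test_0 : test_function (fun=> 0 : R).
Proof.
split; last by exists set0 => //; split; [exact: compact0|].
elim=> [|k IH]; split => //; [exact: cst_continuous|exact: cst_continuous|].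
by split; rewrite ?pd1_0 ?pd2_0//; move=> p; exact: derivable_cst.
Qed.

Lemma ae_lin (a : R) (x y : L2D) (f g : R * R -> R) :
  {ae lebD, forall p, x p = f p} -> {ae lebD, forall p, y p = g p} ->
  {ae lebD, forall p, (a *: x + y : L2D) p = (a \*: f \+ g) p}.
Proof.
move=> xf yg; apply: filterS3 xf yg (L2ae_lin a x y) => p /= e1 e2 e3.
by rewrite e3 e1 e2.
Qed.

Lemma test_graph_lin a s t :
  test_graph s -> test_graph t -> test_graph (a *: s + t).
Proof.
move=> [phi [tp a1 a2 a3]] [psi [tq b1 b2 b3]].
exists (a \*: phi \+ psi); split.
- exact: test_lin.
- exact: ae_lin.
- have [[sp _] [sq _]] := (tp, tq).
  have [_ [d1 _ _ _]] := sp 1%N; have [_ [d2 _ _ _]] := sq 1%N.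
  by rewrite (pd1_lin _ d1 d2); exact: ae_lin.
- have [[sp _] [sq _]] := (tp, tq).
  have [_ [_ d1 _ _]] := sp 1%N; have [_ [_ d2 _ _]] := sq 1%N.
  by rewrite (pd2_lin _ d1 d2); exact: ae_lin.
Qed.

Lemma test_graph0 : test_graph 0.
Proof.
have h : {ae lebD, forall p, (0 : L2D) p = 0}.
  have := L2ae_lin (-1) (0 : L2D) 0; rewrite scaler0 addr0.
  by apply: filterS => p; rewrite mulN1r addNr.
exists (fun=> 0); split; rewrite ?pd1_0 ?pd2_0//; exact: test_0.
Qed.

Fact H10_submod_closed : submod_closed H10_pred.
Proof.
split; first by rewrite inE; apply: subset_closure; exact: test_graph0.
move=> a s t; rewrite !inE => cs ct B.
have cont : continuous (fun z : (L2D * L2D * L2D) * (L2D * L2D * L2D) => a *: z.1 + z.2).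
  by move=> z; apply: cvgD; [apply: cvgZ; [exact: cvg_cst|exact: cvg_fst]|exact: cvg_snd].
move=> /(cont (s, t))[[A1 A2] /= [n1 n2] sub].
have [s' [gs As]] := cs _ n1; have [t' [gt At]] := ct _ n2.
exists (a *: s' + t'); split; first exact: test_graph_lin.
exact: (sub (s', t')).
Qed.
HB.instance Definition _ := GRing.isSubmodClosed.Build R (L2D * L2D * L2D)%type H10_pred H10_submod_closed.

(* H^1_0(D) is the closure of C_c^oo(D) for the H^1(D)-norm; an element v is
   stored together with its gradient, as the triple (v, d1 v, d2 v). *)
Record H10 := MkH10 { H10val : L2D * L2D * L2D ; H10valP : H10val \in H10_pred }.
HB.instance Definition _ := [isSub for H10val].
HB.instance Definition _ := [Choice of H10 by <:].
HB.instance Definition _ := [SubChoice_isSubLmodule of H10 by <:].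

Definition H10_fun (v : H10) : L2D := (H10val v).1.1.
Definition grad1 (v : H10) : L2D := (H10val v).1.2.
Definition grad2 (v : H10) : L2D := (H10val v).2.

(* Needed only for the definiteness of the norm of H^1_0(D) below. *)
Lemma poincare (v : H10) : `|H10_fun v| <= `|grad1 v|.
Proof.
pose C := [set t : L2D * L2D * L2D | `|t.1.1| - `|t.1.2| <= 0].
suff : C (H10val v) by rewrite /C/= subr_le0.
have cC : closed C.
  apply: (@closed_comp _ _ (fun t : L2D * L2D * L2D => `|t.1.1| - `|t.1.2|) [set x : R | x <= 0]).
    move=> t _; apply: cvgB; apply: cvg_norm.
      by apply: (@cvg_comp _ _ _ fst fst _ (nbhs t.1)); exact: cvg_fst.
    by apply: (@cvg_comp _ _ _ fst snd _ (nbhs t.1)); [exact: cvg_fst|exact: cvg_snd].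
  exact: closed_le.
rewrite (closure_id C).1//.
have vP : closure test_graph (H10val v) by have := H10valP v; rewrite inE.
move: vP; apply: closure_subset => t [phi [tp a1 a2 a3]].
rewrite /C/= subr_le0.
have [cphi [_ _ [cd1 _] _]] := tp.1 1%N.
by apply: (L2norm_le _ _ a1 a2 (poincare_test tp));
  exact: continuous_plane_measurable.
Qed.

(* ||grad v||_{L^2(D)} *)
Definition H10norm (v : H10) : R := Num.sqrt (`|grad1 v| ^+ 2 + `|grad2 v| ^+ 2).
Let normD v w : H10norm (v + w) <= H10norm v + H10norm w.
Proof.
have l2 (a b c e : R) : 0 <= a -> 0 <= b -> 0 <= c -> 0 <= e ->
    Num.sqrt ((a + b) ^+ 2 + (c + e) ^+ 2) <=
    Num.sqrt (a ^+ 2 + c ^+ 2) + Num.sqrt (b ^+ 2 + e ^+ 2).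
  move=> a0 b0 c0 e0.
  have X0 : 0 <= a ^+ 2 + c ^+ 2 by rewrite addr_ge0// sqr_ge0.
  have Y0 : 0 <= b ^+ 2 + e ^+ 2 by rewrite addr_ge0// sqr_ge0.
  rewrite -(@ler_pXn2r _ 2) ?nnegrE ?addr_ge0 ?sqrtr_ge0//.
  rewrite sqr_sqrtr ?addr_ge0 ?sqr_ge0// [leRHS]sqrrD !sqr_sqrtr// -sqrtrM//.
  have cs : a * b + c * e <= Num.sqrt ((a ^+ 2 + c ^+ 2) * (b ^+ 2 + e ^+ 2)).
    rewrite -(@ler_pXn2r _ 2) ?nnegrE ?sqrtr_ge0 ?addr_ge0 ?mulr_ge0//.
    rewrite sqr_sqrtr ?mulr_ge0//.
    have := sqr_ge0 (a * e - b * c); nra.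
  move: cs; set S := Num.sqrt _; rewrite mulr2n; nra.
apply: le_trans (l2 _ _ _ _ _ _ _ _); rewrite ?normr_ge0//.
rewrite ler_sqrt ?addr_ge0 ?sqr_ge0//.
have sq (x y : L2D) : `|x + y| ^+ 2 <= (`|x| + `|y|) ^+ 2.
  by rewrite lerXn2r ?nnegrE ?addr_ge0 ?normr_ge0//; exact: ler_normD.
exact: (lerD (sq (grad1 v) (grad1 w)) (sq (grad2 v) (grad2 w))).
Qed.
Let normZ a v : H10norm (a *: v) = `|a| * H10norm v.
Proof.
rewrite /H10norm /grad1 /grad2 /= !normrZ !exprMn -mulrDr sqrtrM ?sqr_ge0//.
by rewrite sqrtr_sqr normr_id.
Qed.
Let norm0 v : H10norm v = 0 -> v = 0.
Proof.
move=> /eqP; rewrite sqrtr_eq0 => h.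
have g10 : `|grad1 v| = 0.
  by apply/eqP; rewrite -sqrf_eq0 eq_le sqr_ge0 andbT; have := sqr_ge0 `|grad2 v|; lra.
have g20 : `|grad2 v| = 0.
  by apply/eqP; rewrite -sqrf_eq0 eq_le sqr_ge0 andbT; have := sqr_ge0 `|grad1 v|; lra.
have f0 : `|H10_fun v| = 0.
  by apply/eqP; rewrite eq_le normr_ge0 andbT -g10 poincare.
apply: val_inj; move: (normr0_eq0 f0) (normr0_eq0 g10) (normr0_eq0 g20).
by rewrite /H10_fun /grad1 /grad2 /=; case: (H10val v) => -[? ?] ? /= -> -> ->.
Qed.
HB.instance Definition _ := Lmodule_isNormed.Build R H10 normD normZ norm0.
End H10.

Section elliptic.
Variable R : realType.

Definition side (b : bool) : set R :=
  if b then `]0, 2^-1[%classic else `](- 2^-1), 0[%classic.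

(* D_1, ..., D_4, numbered from 0: bottom left, bottom right, top left,
   top right. *)
Definition quadrant (i : 'I_4) : set (plane R) :=
  side (odd i) `*` side (2 <= i)%N.

Definition grad_form (A : set (plane R)) (u v : H10 R) : R :=
  \int[leb2 R]_(p in A) (grad1 u p * grad1 v p + grad2 u p * grad2 v p).

Definition is_weak_solution (theta : R) (f : H10 R -> R) (y : 'rV[R]_4)
    (u : H10 R) : Prop :=
  forall v : H10 R,
    \sum_(i < 4) (1 - theta * y 0 i) * grad_form (quadrant i) u v = f v.

Definition paramU : set 'rV[R]_4 :=
  [set y | forall i, -1 <= y 0 i <= 1].

End elliptic.

Section taylor.
Context (R : realType) (V : normedModType R).
Implicit Types (w : 'rV[R]_4 -> V) (nu : 'I_4 -> nat).

Definition partial (i : 'I_4) w : 'rV[R]_4 -> V :=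
  fun y => 'D_(delta_mx 0 i) w y.

Definition mpartial nu w : 'rV[R]_4 -> V :=
  foldr (fun i g => iter (nu i) (partial i) g) w (enum 'I_4).

Definition taylor_coef w nu : V :=
  (\prod_(i < 4) ((nu i)`!)%:R)^-1 *: mpartial nu w 0.

(* Multi-indices with |nu| <= k have entries at most k. *)
Definition taylor_trunc w (k : nat) (y : 'rV[R]_4) : V :=
  \sum_(nu : {ffun 'I_4 -> 'I_k.+1} | (\sum_(i < 4) nu i <= k)%N)
    (\prod_(i < 4) y 0 i ^+ nu i) *: taylor_coef w (fun i => nu i).

End taylor.

Section rank.
Context (d : measure_display) (T : measurableType d) (R : realType).
Context (V : normedModType R) (mu : {measure set T -> \bar R}) (E : set T).

(* The simple function with value sum_j 1_{A_j} x_j, for s = [:: (A_j, x_j)]. *)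
Definition simple_fun (s : seq (set T * V)) (t : T) : V :=
  \sum_(p <- s) (\1_(p.1) t : R) *: p.2.

Definition simple_integral (s : seq (set T * V)) : V :=
  \sum_(p <- s) fine (mu (p.1 `&` E)) *: p.2.

(* F is Bochner integrable on E, with integral m. *)
Definition is_bochner_integral (F : T -> V) (m : V) : Prop :=
  exists s : nat -> seq (set T * V),
    [/\ forall n p, p \in s n -> measurable p.1 /\ (mu (p.1 `&` E) < +oo)%E,
        {ae mu, forall t, E t -> simple_fun (s n) t @[n --> \oo] --> F t},
        (\int[mu]_(t in E) (`|F t - simple_fun (s n) t|)%:E)%E
          @[n --> \oo] --> 0%E &
        simple_integral (s n) @[n --> \oo] --> m].

(* Range of phi |-> \int_E w phi dmu on L^2(E, mu). *)
Definition moment_range (w : T -> V) : set V :=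
  [set m | exists phi : T -> R,
    [/\ measurable_fun E phi,
        (\int[mu]_(t in E) (phi t ^+ 2)%:E < +oo)%E &
        is_bochner_integral (fun t => phi t *: w t) m]].

Definition lin_indep (n : nat) (e : 'I_n -> V) : Prop :=
  forall c : 'I_n -> R, \sum_(i < n) c i *: e i = 0 -> forall i, c i = 0.

(* Dimension of a linear subspace, possibly +oo. *)
Definition dimension (S : set V) : \bar R :=
  ereal_sup [set n%:R%:E | n in
    [set n : nat | exists e : 'I_n -> V, (forall i, S (e i)) /\ lin_indep e]].

Definition rank (w : T -> V) : \bar R := dimension (moment_range w).

End rank.

(* R^4 with its Borel sigma-algebra. *)
Definition borel4 (R : realType) : Type := g_sigma_algebraType (@open 'rV[R]_4).
HB.instance Definition _ (R : realType) := Measurable.on (borel4 R).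

(* Main.v *)
(** The form of the problem is a(y) = sum_i (1 - theta y_i) G_i, where G_i is the
    Dirichlet form of the i-th quadrant and sum_i G_i is the inner product of V.
    With B_i the operator representing G_i, differentiating the equation gives
    t_nu = theta sum_i B_i t_(nu - e_i), so it suffices to bound the span of the
    words in the B_i applied to t_0.  The B_i are combinations of 1 and of the
    operators C1, C2, C12 representing the gradient form weighted by sgn x2,
    sgn x1, sgn x1 sgn x2.

    A function of V that is odd in x2 vanishes on the axis x2 = 0, hence may be
    multiplied by sgn x2 inside V, and C1 acts on it as this multiplication; the
    same holds for C2 and x1.  Consequently
    - on the functions vanishing on both axes, C1, C2 and C12 generate a Klein
      four-group: a vector g contributes at most the 4 words g, C1 g, C2 g, C12 g;
    - on the orthogonal complement, sorted by parity, C12 preserves the vectors q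
      odd in one variable, C1 and C2 exchange those with the even ones, and all
      words reduce to C12^j q and the even vectors D C12^j q, where D = C1 + C2.
      With components a (even), b and c (odd in one variable), the words of length
      at most k are a, C12^j C_i a (j < k) and D C12^j C_i a (j < k - 1), together
      with C12^j b (j <= k), D C12^j b (j < k) and the same for c.
    In total 4 + (4k - 1) + 2 (2k + 1) = 8k + 5. *)
Require Import Defs.
From HB Require Import structures.
From mathcomp Require Import all_boot all_order all_algebra.
From mathcomp Require Import all_classical all_reals all_analysis.
From mathcomp Require Import measurable_realfun ring lra zify.
From mathcomp Require mpoly.
Import (canonicals, coercions) mpoly.
Import Order.TTheory GRing.Theory Num.Theory.
Import numFieldNormedType.Exports.
Set Implicit Arguments.
Unset Strict Implicit.
Unset Printing Implicit Defensive.
Local Open Scope quotient_scope.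
Local Open Scope ring_scope.
Local Open Scope classical_set_scope.

(** * Symmetric bilinear forms and the Riesz representation theorem *)

(** Elements of V are limits of test functions, without pointwise traces, so that sgn(x2) v stays in
    V for odd v cannot be read off from values on the axis. An odd test function is at most a
    constant times |x2|; its products with smooth approximations of the sign converge together with
    their gradients, because the slope of the approximation is bounded by a constant over |x2|.
    Contractivity then extends the product to every odd element of V. On functions even in x2 the
    operator C1 is no multiplication, and C12 = C1 C2 is recovered there by duality: the defect of
    the relation is odd in x2, so when it is paired with itself C1 moves onto it as a
    multiplication. Differentiability of u is not assumed: it follows from the coercivity estimate,
    whose constant 1 - theta is uniform in y. For the rank no projection onto a span is needed: a
    Bochner integral is orthogonal to every vector to which its integrand is orthogonal. *)

Definition seq_complete (R : realType) (V : normedModType R) : Prop :=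
  forall x : nat -> V,
    (forall e, 0 < e -> exists N, forall m n, (N <= m)%N -> (N <= n)%N -> `|x m - x n| < e) ->
    exists l, forall e, 0 < e -> exists N, forall n, (N <= n)%N -> `|x n - l| < e.

Definition sym_bilinear (R : realType) (V : lmodType R) (a : V -> V -> R) : Prop :=
  (forall u v, a u v = a v u) /\
  (forall k u u' v, a (k *: u + u') v = k * a u v + a u' v).

Section forms.
Context (R : realType) (V : lmodType R) (a : V -> V -> R).
Hypothesis ha : sym_bilinear a.

Lemma formC u v : a u v = a v u. Proof. exact: ha.1. Qed.
Lemma form0l v : a 0 v = 0.
Proof. by have := ha.2 (-1) 0 0 v; rewrite scaler0 addr0; lra. Qed.
Lemma formDl u u' v : a (u + u') v = a u v + a u' v.
Proof. by have := ha.2 1 u u' v; rewrite scale1r mul1r. Qed.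
Lemma formZl k u v : a (k *: u) v = k * a u v.
Proof. by have := ha.2 k u 0 v; rewrite !addr0 form0l addr0. Qed.
Lemma formNl u v : a (- u) v = - a u v.
Proof. by rewrite -scaleN1r formZl mulN1r. Qed.
Lemma formBl u u' v : a (u - u') v = a u v - a u' v.
Proof. by rewrite formDl formNl. Qed.
Lemma formDr u v v' : a u (v + v') = a u v + a u v'.
Proof. by rewrite !(formC u) formDl. Qed.
Lemma formZr k u v : a u (k *: v) = k * a u v.
Proof. by rewrite !(formC u) formZl. Qed.
Lemma formNr u v : a u (- v) = - a u v.
Proof. by rewrite !(formC u) formNl. Qed.
Lemma form_suml (I : Type) (r : seq I) (P : pred I) (F : I -> V) v :
  a (\sum_(i <- r | P i) F i) v = \sum_(i <- r | P i) a (F i) v.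
Proof. by apply: (big_morph (a^~ v)) => [x y|]; rewrite ?formDl ?form0l. Qed.

Hypothesis a_ge0 : forall v, 0 <= a v v.

Lemma form_CS u v : a u v ^+ 2 <= a u u * a v v.
Proof.
have P (s t : R) : 0 <= s ^+ 2 * a u u + 2 * s * t * a u v + t ^+ 2 * a v v.
  have := a_ge0 (s *: u + t *: v).
  rewrite !(formDl, formDr, formZl, formZr) (formC v u); lra.
have uu := a_ge0 u; have vv := a_ge0 v.
have [vv0|vv0] := eqVneq (a v v) 0; last first.
  have {vv0} vp : 0 < a v v by rewrite lt_neqAle eq_sym vv0.
  have := P (a v v) (- a u v); rewrite -(pmulr_rge0 _ vp) => H.
  have : 0 <= a v v * (a u u * a v v - a u v ^+ 2) by move: (P (a v v) (- a u v)); lra.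
  by rewrite pmulr_rge0 // subr_ge0.
(* In the degenerate case the quadratic is affine in [t] and bounded below, hence constant. *)
rewrite vv0 mulr0; set x := a u v.
have Q t : 0 <= a u u + 2 * t * x by have := P 1 t; rewrite vv0 -/x; lra.
suff -> : x = 0 by rewrite expr0n.
apply/eqP; apply/negPn/negP => x0.
have := Q (- (a u u + 1) / (2 * x)); rewrite (_ : 2 * _ * x = - (a u u + 1)); first lra.
by field.
Qed.
End forms.

Lemma sqr_le_eps (R : realType) (x : R) : (forall e, 0 < e -> x ^+ 2 <= e) -> x = 0.
Proof.
move=> h; apply/eqP; rewrite -sqrf_eq0 eq_le sqr_ge0 andbT leNgt; apply/negP => x0.
by have := h (x ^+ 2 / 2) ltac:(lra); lra.
Qed.

Section riesz.
Context (R : realType) (V : normedModType R).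
Hypothesis V_complete : seq_complete V.

(** Dirichlet principle: a minimising sequence of [a v v - 2 * l v] is Cauchy, and the first
    variation along it tends to 0. This serves both to solve the parametric problem and to represent
    each quadrant form by an operator. *)
Lemma riesz (a : V -> V -> R) (c C K : R) (l : V -> R) :
  sym_bilinear a -> 0 < c -> (forall v, c * `|v| ^+ 2 <= a v v) ->
  (forall v, a v v <= C * `|v| ^+ 2) ->
  (forall k u v, l (k *: u + v) = k * l u + l v) ->
  (forall v, `|l v| <= K * `|v|) ->
  exists u, forall v, a u v = l v.
Proof.
move=> ha c0 lo up ll lK.
have a_ge0 v : 0 <= a v v by apply: le_trans (lo v); rewrite mulr_ge0 ?sqr_ge0 // ltW.
have lD u v : l (u + v) = l u + l v by have := ll 1 u v; rewrite scale1r mul1r.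
have l0 : l 0 = 0 by have := lD 0 0; rewrite addr0; lra.
have lZ k u : l (k *: u) = k * l u by have := ll k u 0; rewrite !addr0 l0 addr0.
pose q v := a v v - 2 * l v.
pose E : set R := [set q v | v in setT].
have Elb : lbound E (- (K ^+ 2 / c)).
  move=> _ [v _ <-]; rewrite /q; have := lo v; have := lK v; rewrite ler_norml => /andP[_].
  set x := `|v| => h1 h2.
  have : 0 <= (c * x - K) ^+ 2 / c by rewrite divr_ge0 ?sqr_ge0 // ltW.
  rewrite (_ : (c * x - K) ^+ 2 / c = c * x ^+ 2 - 2 * K * x + K ^+ 2 / c); first lra.
  by field; rewrite gt_eqF.
have Einf : has_inf E by split; [exists (q 0); exists 0|exists (- (K ^+ 2 / c))].
pose m := inf E.
have qm v : m <= q v by apply: ge_inf; [exact: Einf.2|exists v].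
have /choice[x xP] : forall n : nat, exists v, q v < m + n.+1%:R^-1.
  move=> n; have e0 : 0 < n.+1%:R^-1 :> R by rewrite invr_gt0.
  have [_ [v _ <-] h] := inf_adherent e0 Einf.
  by exists v.
have small e : 0 < e -> exists N, forall n, (N <= n)%N -> (n.+1%:R^-1 : R) < e.
  move=> e0; have := near_infty_natSinv_lt (PosNum e0).
  by move=> [N _ h]; exists N => n /h.
have [u uP] : exists l, forall e, 0 < e -> exists N, forall n, (N <= n)%N -> `|x n - l| < e.
  apply: V_complete => e e0.
  have [N NP] := small (c * e ^+ 2 / 4) ltac:(by rewrite !mulr_gt0 ?exprn_gt0 // invr_gt0).
  exists N => i j Ni Nj.
  (* Parallelogram identity: the linear parts of [q] cancel against its value at the midpoint, which
     is at least [m]. *)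
  have par : a (x i - x j) (x i - x j) =
      2 * q (x i) + 2 * q (x j) - 4 * q (2^-1 *: (x i + x j)).
    rewrite /q !(formBl ha, formDl ha, formZl ha, formDr ha, formZr ha, formNr ha, lZ, lD).
    by rewrite (formC ha (x j)); field.
  have := lo (x i - x j); rewrite par.
  have := qm (2^-1 *: (x i + x j)); have := xP i; have := xP j.
  have := NP i Ni; have := NP j Nj => h1 h2 h3 h4 h5 h6.
  have : c * `|x i - x j| ^+ 2 < c * e ^+ 2.
    move: h1 h2 h3 h4 h5 h6; set A := c * _; set B := i.+1%:R^-1; set B' := j.+1%:R^-1; set N' := c * _; lra.
  rewrite ltr_pM2l // ltr_pXn2r // ?nnegrE ?(ltW e0) //.
exists u => w.
pose M := `|C| * `|w| ^+ 2 + 1.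
have M0 : 0 < M by rewrite ltr_wpDl // mulr_ge0 ?sqr_ge0.
have Mw : a w w <= M.
  have := up w; have : C * `|w| ^+ 2 <= `|C| * `|w| ^+ 2 by rewrite ler_wpM2r ?sqr_ge0 ?ler_norm.
  by rewrite /M; lra.
(* [x n] is within [n.+1%:R^-1] of the infimum. The competitor uses the step [- d / M] along [w],
   optimal once [a w w] is replaced by its bound [M]. *)
have dn n : (a (x n) w - l w) ^+ 2 <= M * n.+1%:R^-1.
  have [d dE] : exists d, a (x n) w - l w = d by eexists.
  have := qm (x n + (- d / M) *: w); have := xP n; rewrite dE.
  have [e ->] : exists e : R, n.+1%:R^-1 = e by eexists.
  rewrite /q !(formDl ha, formZl ha, formDr ha, formZr ha, lZ, lD).
  rewrite (formC ha w) (_ : a (x n) w = d + l w); last by lra.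
  set Q := a (x n) (x n) => h1 h2.
  have : 0 <= e + 2 * (- d / M) * d + (d / M) ^+ 2 * M.
    have : (d / M) ^+ 2 * a w w <= (d / M) ^+ 2 * M by rewrite ler_wpM2l ?sqr_ge0.
    by lra.
  rewrite (_ : _ + _ = (M * e - d ^+ 2) / M); last by field; rewrite gt_eqF.
  by rewrite pmulr_lge0 ?invr_gt0 // subr_ge0.
suff : a u w - l w = 0 by lra.
apply: sqr_le_eps => e e0.
(* [K'] gathers the constants of the two error terms; the cap at 1 in [e'] gives [e' ^+ 2 <= e']. *)
pose K' := 2 * (`|C| + 1) * M + 1.
have K0 : 0 < K' by rewrite ltr_wpDl // !mulr_ge0 ?addr_ge0 // ltW.
pose e' := Num.min 1 (e / (2 * K')).
have e'0 : 0 < e' by rewrite lt_min ltr01 /= divr_gt0 // mulr_gt0.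
have e'1 : e' <= 1 by rewrite /e' ge_min lexx.
have [N1 P1] := uP e' e'0; have [N2 P2] := small e' e'0.
pose n := maxn N1 N2.
have h1 := P1 n (leq_maxl _ _); have h2 := P2 n (leq_maxr _ _).
have h3 := dn n; have h4 := form_CS ha a_ge0 (u - x n) w; move: h4.
rewrite formBl //.
have h5 := up (u - x n).
have h6 : `|u - x n| ^+ 2 <= e'.
  rewrite distrC (le_trans (y := e' ^+ 2)) //.
    by rewrite ler_pXn2r ?nnegrE ?(ltW e'0) // ltW.
  by rewrite -[leRHS]mulr1 expr2 ler_wpM2l // ltW.
have h7 : a (u - x n) (u - x n) <= (`|C| + 1) * e'.
  apply: le_trans h5 _; apply: (@le_trans _ _ (`|C| * `|u - x n| ^+ 2)).
    by rewrite ler_wpM2r ?sqr_ge0 ?ler_norm.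
  by rewrite ler_pM ?sqr_ge0 //; lra.
have h8 : a (u - x n) (u - x n) * a w w <= (`|C| + 1) * e' * M.
  by rewrite ler_pM.
have h9 : M * n.+1%:R^-1 <= M * e' by rewrite ler_wpM2l // ltW.
have h10 : (K' * 2) * e' <= e.
  rewrite mulrC -ler_pdivlMr ?mulr_gt0 //.
  by rewrite /e' (mulrC K') ge_min lexx orbT.
have CM : M * e' <= (`|C| + 1) * e' * M.
  rewrite -mulrA (mulrC e') -[leLHS]mul1r ler_wpM2r ?mulr_ge0 ?(ltW M0) ?(ltW e'0) //.
  by have := normr_ge0 C; lra.
move=> h4.
have : (a u w - l w) ^+ 2 <= 2 * (a u w - a (x n) w) ^+ 2 + 2 * (a (x n) w - l w) ^+ 2.
  have := sqr_ge0 ((a u w - a (x n) w) - (a (x n) w - l w)); lra.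
have : K' * 2 * e' = 2 * (2 * ((`|C| + 1) * e' * M)) + 2 * e' by rewrite /K'; ring.
have := le_trans (le_trans h3 h9) CM; have := le_trans h4 h8; clear -h10 e'0.
set X := _ ^+ 2; set Y := (_ - l w) ^+ 2; set Z := _ * M; set W := K' * _ * _.
move: h10; rewrite -/W; lra.
Qed.
End riesz.

(** * Words in the sign operators *)

Section klein_words.
Context (R : realFieldType) (V : lmodType R).
Variables C1 C2 C12 : {linear V -> V}.

(** Coefficients are indexed by [nat], so that their type does not depend on the size of [s]. *)
Definition spanned (s : seq V) (v : V) : Prop :=
  exists c : nat -> R, v = \sum_(i < size s) c i *: s`_i.

Lemma spanned0 s : spanned s 0.
Proof. by exists (fun=> 0); rewrite big1 // => i _; rewrite scale0r. Qed.

Lemma spannedD s u v : spanned s u -> spanned s v -> spanned s (u + v).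
Proof.
move=> [c ->] [e ->]; exists (fun i => c i + e i).
by rewrite -big_split; apply: eq_bigr => i _; rewrite scalerDl.
Qed.

Lemma spannedZ s a v : spanned s v -> spanned s (a *: v).
Proof.
move=> [c ->]; exists (fun i => a * c i).
by rewrite scaler_sumr; apply: eq_bigr => i _; rewrite scalerA.
Qed.

Lemma spanned_sum s (I : Type) (r : seq I) (P : pred I) F :
  (forall i, P i -> spanned s (F i)) -> spanned s (\sum_(i <- r | P i) F i).
Proof.
by move=> h; elim/big_ind: _ => //; [exact: spanned0|exact: spannedD].
Qed.

Lemma spanned_mem s v : v \in s -> spanned s v.
Proof.
move=> /[dup] vs; rewrite -index_mem => lt; exists (fun i => (i == index v s)%:R).
rewrite (bigD1 (Ordinal lt)) //= eqxx scale1r nth_index // big1 ?addr0 // => i.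
by rewrite -val_eqE /= => /negbTE ->; rewrite scale0r.
Qed.

Lemma spanned_trans s t v :
  {in s, forall x, spanned t x} -> spanned s v -> spanned t v.
Proof.
move=> st [c ->]; apply: spanned_sum => i _; apply: spannedZ; apply: st.
exact: mem_nth.
Qed.

Variables S1 S2 : {linear V -> V}.
Hypothesis S11 : forall v, S1 (S1 v) = v.
Hypothesis S22 : forall v, S2 (S2 v) = v.
Hypothesis S12 : forall v, S1 (S2 v) = S2 (S1 v).
Hypothesis S1C1 : forall v, S1 (C1 v) = C1 (S1 v).
Hypothesis S2C1 : forall v, S2 (C1 v) = - C1 (S2 v).
Hypothesis S1C2 : forall v, S1 (C2 v) = - C2 (S1 v).
Hypothesis S2C2 : forall v, S2 (C2 v) = C2 (S2 v).
Hypothesis S1C12 : forall v, S1 (C12 v) = - C12 (S1 v).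
Hypothesis S2C12 : forall v, S2 (C12 v) = - C12 (S2 v).
Hypothesis C11 : forall v, S2 v = - v -> C1 (C1 v) = v.
Hypothesis C22 : forall v, S1 v = - v -> C2 (C2 v) = v.
Hypothesis C21_odd : forall v, S2 v = - v -> C12 v = C2 (C1 v).
Hypothesis C12_odd : forall v, S1 v = - v -> C12 v = C1 (C2 v).
Hypothesis C12_even : forall v, S2 v = v -> C12 v = C1 (C2 v).
Hypothesis C21_even : forall v, S1 v = v -> C12 v = C2 (C1 v).
Hypothesis C121 : forall v, S2 v = - v -> C12 (C1 v) = C2 v.
Hypothesis C122 : forall v, S1 v = - v -> C12 (C2 v) = C1 v.

(* C1, C2 and C12 act on v as the elements of a Klein four-group. *)
Definition klein v := [/\ C1 (C1 v) = v, C2 (C2 v) = v & C12 (C12 v) = v] /\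
  [/\ C1 (C2 v) = C12 v, C2 (C1 v) = C12 v, C1 (C12 v) = C2 v, C12 (C1 v) = C2 v &
   C2 (C12 v) = C1 v /\ C12 (C2 v) = C1 v].

Lemma kleinD u v : klein u -> klein v -> klein (u + v).
Proof.
move=> [[a1 a2 a3] [a4 a5 a6 a7 [a8 a9]]] [[b1 b2 b3] [b4 b5 b6 b7 [b8 b9]]].
by split; split; rewrite !linearD ?(a1, a2, a3, a4, a5, a6, a7, a8, a9, b1, b2, b3, b4, b5, b6, b7, b8, b9) //.
Qed.

(** Both operators multiply [v] by a sign, but [C1 v] is odd only in the first variable and [C2 v]
    only in the second. Each relation is therefore factored so that every step uses a parity still
    present. *)
Lemma klein_odd v : S1 v = - v -> S2 v = - v -> klein v.
Proof.
move=> o1 o2.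
have o1C1 : S1 (C1 v) = - C1 v by rewrite S1C1 o1 (linearN C1).
have o2C2 : S2 (C2 v) = - C2 v by rewrite S2C2 o2 (linearN C2).
have e12 : C12 v = C1 (C2 v) by exact: C12_odd.
have e21 : C12 v = C2 (C1 v) by exact: C21_odd.
split; split; rewrite -?e12 -?e21 ?C11 ?C22 ?C121 ?C122 //.
- by rewrite e21 C122 ?C11.
- by rewrite e12 C11.
- by rewrite e21 C22.
Qed.

Lemma klein_C1 v : klein v -> klein (C1 v).
Proof.
move=> [[a1 a2 a3] [a4 a5 a6 a7 [a8 a9]]].
by split; split; rewrite ?(a1, a2, a3, a4, a5, a6, a7, a8, a9).
Qed.

Lemma klein_C2 v : klein v -> klein (C2 v).
Proof.
move=> [[a1 a2 a3] [a4 a5 a6 a7 [a8 a9]]].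
by split; split; rewrite ?(a1, a2, a3, a4, a5, a6, a7, a8, a9).
Qed.

Lemma klein_C12 v : klein v -> klein (C12 v).
Proof.
move=> [[a1 a2 a3] [a4 a5 a6 a7 [a8 a9]]].
by split; split; rewrite ?(a1, a2, a3, a4, a5, a6, a7, a8, a9).
Qed.

(* The vectors orthogonal to the functions vanishing on both axes, sorted by parity. *)
Definition odd2_harm q := [/\ S1 q = q, S2 q = - q & C2 q = 0].
Definition odd1_harm q := [/\ S1 q = - q, S2 q = q & C1 q = 0].
Definition even_harm a := [/\ S1 a = a, S2 a = a & C12 a = 0].

(** [C1] acts on [q] as a sign, and [C12 (C1 q) = C2 q = 0] makes [C1 q] harmonic. For [C12 q], one
    has [C1 (C12 q) = C1 (C2 (C1 q)) = C12 (C1 q) = 0], since [C1 q] is even. *)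
Lemma odd2_harmP q : odd2_harm q ->
  [/\ even_harm (C1 q), C1 (C1 q) = q, C2 (C1 q) = C12 q & odd1_harm (C12 q)].
Proof.
move=> [e1 o2 z].
have e1' : S1 (C1 q) = C1 q by rewrite S1C1 e1.
have e2' : S2 (C1 q) = C1 q by rewrite S2C1 o2 (linearN C1) opprK.
have h : even_harm (C1 q) by split => //; rewrite C121.
have n : C12 q = C2 (C1 q) by exact: C21_odd.
split => //; first exact: C11.
split; rewrite ?S1C12 ?S2C12 ?e1 ?o2 ?linearN ?opprK //.
by rewrite n -C12_even // C121.
Qed.

Lemma odd1_harmP q : odd1_harm q ->
  [/\ even_harm (C2 q), C2 (C2 q) = q, C1 (C2 q) = C12 q & odd2_harm (C12 q)].
Proof.
move=> [h1 e2 z].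
have e2' : S2 (C2 q) = C2 q by rewrite S2C2 e2.
have e1' : S1 (C2 q) = C2 q by rewrite S1C2 h1 (linearN C2) opprK.
have h : even_harm (C2 q) by split => //; rewrite C122.
have n : C12 q = C1 (C2 q) by exact: C12_odd.
split => //; first exact: C22.
split; rewrite ?S1C12 ?S2C12 ?e2 ?h1 ?linearN ?opprK //.
by rewrite n -C21_even // C122.
Qed.

Lemma even_harmP a : even_harm a -> odd2_harm (C1 a) /\ odd1_harm (C2 a).
Proof.
move=> [e1 e2 z]; split; split.
- by rewrite S1C1 e1.
- by rewrite S2C1 e2.
- by rewrite -C21_even.
- by rewrite S1C2 e1.
- by rewrite S2C2 e2.
- by rewrite -C12_even.
Qed.

Definition odd_harm q := odd1_harm q \/ odd2_harm q.
(* On an [odd_harm] vector one of the two summands vanishes. *)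
Definition fold q := C1 q + C2 q.

Lemma odd_harmN q : odd_harm q -> odd_harm (C12 q).
Proof. by move=> [/odd1_harmP[]|/odd2_harmP[]]; [right|left]. Qed.

Lemma odd_harm_iter q j : odd_harm q -> odd_harm (iter j C12 q).
Proof. by move=> h; elim: j => //= j; exact: odd_harmN. Qed.

(** Models the passage to words with one more letter; it suffices to test the generators. *)
Definition step (s t : seq V) := {in s, forall v,
  [/\ spanned t v, spanned t (C1 v), spanned t (C2 v) & spanned t (C12 v)]}.

(** Folding costs one letter, so only the powers below [n] are folded; hence the two different
    ranges. *)
Definition chain q n := [seq iter j C12 q | j <- iota 0 n.+1] ++
   [seq fold (iter j C12 q) | j <- iota 0 n].

Lemma size_chain q n : size (chain q n) = (n + n).+1.
Proof. by rewrite size_cat !size_map !size_iota. Qed.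

Lemma step_cat s1 s2 t1 t2 : step s1 t1 -> step s2 t2 -> step (s1 ++ s2) (t1 ++ t2).
Proof.
move=> h1 h2 v; rewrite mem_cat => /orP[/h1|/h2] [p1 p2 p3 p4];
  split; move: p1 p2 p3 p4 => ? ? ? ?;
  (apply: spanned_trans; last eassumption) => x xt; apply: spanned_mem;
  by rewrite mem_cat xt ?orbT.
Qed.

(** Along the chain [C12] raises the power and kills the folded vectors. Of [C1] and [C2], one kills
    the power [j] and the other folds it; on the folded vector one of them returns the power [j] and
    the other the power [j.+1]. *)
Lemma step_chain q n : odd_harm q -> step (chain q n) (chain q n.+1).
Proof.
move=> hq.
have mi j : (j <= n.+1)%N -> spanned (chain q n.+1) (iter j C12 q).
  move=> jn; apply: spanned_mem; rewrite mem_cat; apply/orP; left.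
  by apply/mapP; exists j => //; rewrite mem_iota.
have mf j : (j <= n)%N -> spanned (chain q n.+1) (fold (iter j C12 q)).
  move=> jn; apply: spanned_mem; rewrite mem_cat; apply/orP; right.
  by apply/mapP; exists j => //; rewrite mem_iota.
move=> v; rewrite mem_cat => /orP[] /mapP[j]; rewrite mem_iota /= add0n => jn ->.
  have hj := odd_harm_iter j hq; split.
  - by apply: mi; rewrite ltnW.
  - case: hj => h.
      by case: h => _ _ ->; exact: spanned0.
    by have := mf j jn; rewrite /fold; case: h => _ _ ->; rewrite addr0.
  - case: hj => h; last by case: h => _ _ ->; exact: spanned0.
    by have := mf j jn; rewrite /fold; case: h => _ _ ->; rewrite add0r.
  - by rewrite -iterS; apply: mi.
have hj := odd_harm_iter j hq; split.
- by apply: mf; rewrite ltnW.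
- rewrite /fold; case: hj => h.
    case: (h) => _ _ ->; rewrite add0r; case: (odd1_harmP h) => _ _ -> _.
    by rewrite -iterS; apply: mi; rewrite ltnS ltnW.
  case: (h) => _ _ ->; rewrite addr0; case: (odd2_harmP h) => _ -> _ _.
  by apply: mi; rewrite ltnW // ltnW.
- rewrite /fold; case: hj => h.
    case: (h) => _ _ ->; rewrite add0r; case: (odd1_harmP h) => _ -> _ _.
    by apply: mi; rewrite ltnW // ltnW.
  case: (h) => _ _ ->; rewrite addr0; case: (odd2_harmP h) => _ _ -> _.
  by rewrite -iterS; apply: mi; rewrite ltnS ltnW.
- rewrite /fold; case: hj => h; case: (h) => _ _ ->; rewrite ?add0r ?addr0.
    by case: (odd1_harmP h) => -[_ _ ->] _ _ _; exact: spanned0.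
  by case: (odd2_harmP h) => -[_ _ ->] _ _ _; exact: spanned0.
Qed.

(** [C12 a = 0], so the only words of one letter are [C1 a] and [C2 a]; having used that letter,
    their chains stop at [n - 1]. *)
Definition chain_even a n :=
  a :: (if n is m.+1 then chain (C1 a) m ++ chain (C2 a) m else [::]).

Lemma step_chain_even a n : even_harm a -> step (chain_even a n) (chain_even a n.+1).
Proof.
move=> ha; have [h1 h2] := even_harmP ha.
have sa : spanned (chain_even a n.+1) a by apply: spanned_mem; rewrite mem_head.
have sub x : x \in chain (C1 a) n ++ chain (C2 a) n -> spanned (chain_even a n.+1) x.
  by move=> xs; apply: spanned_mem; rewrite in_cons xs orbT.
have c0 q m : q \in chain q m by rewrite mem_cat; apply/orP; left; apply/mapP; exists 0%N.
move=> v; rewrite in_cons => /predU1P[->|].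
  split => //; last by case: ha => _ _ ->; exact: spanned0.
    by apply: sub; rewrite mem_cat c0.
  by apply: sub; rewrite mem_cat c0 orbT.
case: n sa sub => [//|m] sa sub vs.
have := step_cat (@step_chain _ m (or_intror h1)) (@step_chain _ m (or_introl h2)) vs.
by move=> [p1 p2 p3 p4]; split; apply: spanned_trans; try eassumption.
Qed.

Definition words g a b c n :=
  [:: g; C1 g; C2 g; C12 g] ++ (chain_even a n ++ (chain b n ++ chain c n)).

(** The count fails at [n = 0], where [chain_even] has one element instead of [4 * n - 1] and the
    list has 7. *)
Lemma size_words g a b c n : (1 <= n)%N -> size (words g a b c n) = (8 * n + 5)%N.
Proof.
case: n => // n _; rewrite size_cat [size (chain_even _ _ ++ _)]size_cat [size (chain b _ ++ _)]size_cat.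
rewrite (_ : size (chain_even a n.+1) = (4 * n + 3)%N); first by rewrite !size_chain /=; lia.
by rewrite -[LHS]/((size (chain (C1 a) n ++ chain (C2 a) n)).+1) size_cat !size_chain; lia.
Qed.

Lemma step_words g a b c n : klein g -> even_harm a -> odd2_harm b -> odd1_harm c ->
  step (words g a b c n) (words g a b c n.+1).
Proof.
move=> kg ha hb hc; apply: step_cat; last apply: step_cat; last apply: step_cat.
- have m x : x \in [:: g; C1 g; C2 g; C12 g] -> spanned [:: g; C1 g; C2 g; C12 g] x.
    exact: spanned_mem.
  case: kg => [[a1 a2 a3] [a4 a5 a6 a7 [a8 a9]]].
  move=> v; rewrite !inE => /or4P[] /eqP ->; split; apply: m;
    by rewrite ?(a1, a2, a3, a4, a5, a6, a7, a8, a9) !inE eqxx ?orbT.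
- exact: step_chain_even.
- by apply: step_chain; right.
- by apply: step_chain; left.
Qed.

(** On the parity components [a], [b], [c], the vectors [C12 a], [C2 b], [C1 c] are odd in both
    variables, hence Klein. So [C12 \o C12], [C2 \o C2] and [C1 \o C1] act there as projections with
    Klein values; these values go into [g] and the remainders are harmonic. *)
Lemma words_decomp (v : V) : exists g a b c,
  [/\ klein g, even_harm a, odd2_harm b, odd1_harm c & v = g + a + b + c].
Proof.
pose h : R := 2^-1.
have h2 (x : V) : h *: x + h *: x = x.
  by rewrite -scalerDl (_ : h + h = 1) ?scale1r // /h; lra.
(* The last clause preserves a parity already obtained: if [S'] commutes with [S] and acts on [x] by
   a scalar, it acts on both halves by that scalar. *)
have dec (S : {linear V -> V}) : (forall v, S (S v) = v) -> forall x,
    exists e o, [/\ S e = e, S o = - o, x = e + o &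
     forall S' : {linear V -> V}, (forall v, S' (S v) = S (S' v)) ->
     forall k : R, S' x = k *: x -> S' e = k *: e /\ S' o = k *: o].
  move=> SS x; exists (h *: (x + S x)), (h *: (x - S x)); split.
  - by rewrite linearZ linearD /= SS addrC.
  - by rewrite linearZ linearB /= SS -scalerN opprB.
  - by rewrite -scalerDr addrACA addrN addr0 scalerDr h2.
  - move=> S' comm k xk; split; rewrite linearZ ?linearD ?linearN /= comm xk linearZ /=;
      by rewrite ?scalerBr ?scalerDr !scalerA ?(mulrC h k) //.
have [e [w [Se So ve _]]] := dec S1 S11 v.
have [a [b [Sa Sb eab hab]]] := dec S2 S22 e.
have [c [d [Sc Sd ocd hcd]]] := dec S2 S22 w.
have [Sa1 Sb1] : S1 a = a /\ S1 b = b.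
  by have := hab S1 S12 1; rewrite !scale1r; apply.
have [Sc1 Sd1] : S1 c = - c /\ S1 d = - d.
  by have := hcd S1 S12 (-1); rewrite !scaleN1r; apply.
have [ea eaE] : exists x, C12 a = x by eexists.
have [eb ebE] : exists x, C2 b = x by eexists.
have [ec ecE] : exists x, C1 c = x by eexists.
have o_ea : S1 ea = - ea /\ S2 ea = - ea by rewrite -eaE S1C12 S2C12 Sa1 Sa.
have o_eb : S1 eb = - eb /\ S2 eb = - eb by rewrite -ebE S1C2 S2C2 Sb1 Sb linearN.
have o_ec : S1 ec = - ec /\ S2 ec = - ec by rewrite -ecE S1C1 S2C1 Sc1 Sc linearN.
have [ka kb kc kd] : [/\ klein ea, klein eb, klein ec & klein d].
  by split; apply: klein_odd => //; [case: o_ea|case: o_ea|case: o_eb|case: o_eb|case: o_ec|case: o_ec].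
exists (d + C12 ea + C2 eb + C1 ec), (a - C12 ea), (b - C2 eb), (c - C1 ec); split.
- by do !apply: kleinD => //; [exact: klein_C12|exact: klein_C2|exact: klein_C1].
- case: o_ea => o1 o2; split; rewrite linearB /=.
  + by rewrite S1C12 o1 (linearN C12) opprK Sa1.
  + by rewrite S2C12 o2 (linearN C12) opprK Sa.
  + by rewrite eaE; case: ka => -[_ _ ->] _; rewrite subrr.
- case: o_eb => o1 o2; split; rewrite linearB /=.
  + by rewrite S1C2 o1 (linearN C2) opprK Sb1.
  + by rewrite S2C2 o2 (linearN C2) Sb opprB opprK addrC.
  + by rewrite ebE; case: kb => -[_ -> _] _; rewrite subrr.
- case: o_ec => o1 o2; split; rewrite linearB /=.
  + by rewrite S1C1 o1 (linearN C1) Sc1 opprB opprK addrC.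
  + by rewrite S2C1 o2 (linearN C1) opprK Sc.
  + by rewrite ecE; case: kc => -[-> _ _] _; rewrite subrr.
- rewrite ve eab ocd; set x := C12 _; set y := C2 _; set z := C1 _.
  rewrite -!addrA; set G := GRing.add.
  suff /(_ V a b c d x y z) : forall (W : zmodType) (a b c d x y z : W),
    a + (b + (c + d)) = d + (x + (y + (z + (a + (- x + (b + (- y + (c - z)))))))) by [].
  clear=> W a b c d x y z.
  rewrite [z + _]addrCA [y + (a + _)]addrCA [x + (a + _)]addrCA.
  rewrite [d + (a + _)]addrCA; congr (_ + _).
  rewrite [z + (- x + _)]addrCA [y + (- x + _)]addrCA [x + (- x + _)]addrA addrN add0r.
  rewrite [z + (b + _)]addrCA [y + (b + _)]addrCA [d + (b + _)]addrCA; congr (_ + _).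
  rewrite [z + (- y + _)]addrCA [y + (- y + _)]addrA addrN add0r.
  by rewrite [z + (c + _)]addrCA addrN addr0 addrC.
Qed.

(** Hides the four components: from here on only the size and the effect of one letter matter. *)
Lemma klein_words (v0 : V) : exists Z : nat -> seq V,
  [/\ forall n, (1 <= n)%N -> size (Z n) = (8 * n + 5)%N, spanned (Z 0%N) v0 &
      forall n v, spanned (Z n) v -> [/\ spanned (Z n.+1) v, spanned (Z n.+1) (C1 v),
        spanned (Z n.+1) (C2 v) & spanned (Z n.+1) (C12 v)]].
Proof.
have [g [a [b [c [kg ka kb kc ->]]]]] := words_decomp v0.
exists (words g a b c); split.
- by move=> n; exact: size_words.
- by do !apply: spannedD; apply: spanned_mem; rewrite !inE eqxx ?orbT.
- move=> n v [k ->]; have st := @step_words g a b c n kg ka kb kc.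
  split; rewrite ?linear_sum; apply: spanned_sum => i _; rewrite ?linearZ;
    by apply: spannedZ; case: (st _ (mem_nth 0 (ltn_ord i))).
Qed.
End klein_words.

(** * Taylor coefficients of the solution map *)

Section parametric.
Context (R : realType) (V : normedModType R) (G : 'I_4 -> V -> V -> R).
Hypothesis V_complete : seq_complete V.
Hypothesis G_form : forall i, sym_bilinear (G i).
Hypothesis G_ge0 : forall i v, 0 <= G i v v.
Hypothesis G_norm : forall v, \sum_i G i v v = `|v| ^+ 2.

Definition wform (k : 'I_4 -> R) (u v : V) : R := \sum_i k i * G i u v.
Definition ip := wform (fun=> 1).

Lemma wform_form k : sym_bilinear (wform k).
Proof.
split=> [u v|x u u' v]; first by apply: eq_bigr => i _; rewrite (formC (G_form i)).
rewrite /wform mulr_sumr -big_split; apply: eq_bigr => i _ /=.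
by rewrite (G_form i).2; ring.
Qed.

Lemma ip_form : sym_bilinear ip. Proof. exact: wform_form. Qed.

Lemma ip_norm v : ip v v = `|v| ^+ 2.
Proof. by rewrite -G_norm; apply: eq_bigr => i _; rewrite mul1r. Qed.

Lemma ip_ge0 v : 0 <= ip v v.
Proof. by rewrite ip_norm sqr_ge0. Qed.

Lemma ip_CS u v : `|ip u v| <= `|u| * `|v|.
Proof.
rewrite -(@ler_pXn2r _ 2) ?nnegrE ?mulr_ge0 // real_normK ?num_real //.
by rewrite exprMn -!ip_norm; exact: form_CS ip_form ip_ge0 _ _.
Qed.

Lemma ip_inj u v : (forall w, ip u w = ip v w) -> u = v.
Proof.
move=> h; apply/eqP; rewrite -subr_eq0 -normr_eq0 -sqrf_eq0 -ip_norm.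
by rewrite (formBl ip_form) h subrr.
Qed.

Lemma G_le i v : G i v v <= `|v| ^+ 2.
Proof. by rewrite -G_norm (bigD1 i) //= lerDl sumr_ge0. Qed.

Lemma G_CS i u v : `|G i u v| <= `|u| * `|v|.
Proof.
rewrite -(@ler_pXn2r _ 2) ?nnegrE ?mulr_ge0 // real_normK ?num_real // exprMn.
apply: le_trans (form_CS (G_form i) (G_ge0 i) _ _) _.
by rewrite ler_pM ?G_le.
Qed.

(** The bound 2 is that of [1 - theta * y 0 i] on the parameter cube. *)
Lemma wform_solve k (c : R) (z : V) : 0 < c -> (forall i, c <= k i <= 2) ->
  exists w, forall v, wform k w v = ip z v.
Proof.
move=> c0 kc; apply: (@riesz _ _ V_complete (wform k) c 2 `|z|) => //.
- exact: wform_form.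
- move=> v; rewrite -G_norm mulr_sumr; apply: ler_sum => i _.
  by rewrite ler_wpM2r //; case/andP: (kc i).
- move=> v; rewrite -G_norm mulr_sumr; apply: ler_sum => i _.
  by rewrite ler_wpM2r //; case/andP: (kc i).
- by move=> t u v; rewrite !(formC ip_form z) ip_form.2.
- by move=> v; exact: ip_CS.
Qed.

(** Testing with [w] itself. All limits in the differentiation of the solution map come from this
    estimate. *)
Lemma wform_stable k (c : R) (w z : V) : 0 < c -> (forall i, c <= k i) ->
  (forall v, wform k w v = ip z v) -> c * `|w| <= `|z|.
Proof.
move=> c0 kc h; have [->|w0] := eqVneq w 0; first by rewrite normr0 mulr0.
rewrite -(@ler_pM2r _ `|w|) ?normr_gt0 // -mulrA -expr2.
apply: le_trans (_ : ip z w <= _); last by apply: le_trans (ler_norm _) (ip_CS _ _).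
rewrite -h -G_norm mulr_sumr; apply: ler_sum => i _.
by rewrite ler_wpM2r.
Qed.

Lemma form_op i : exists B : {linear V -> V}, forall v w, ip (B v) w = G i v w.
Proof.
have /choice[B0 B0P] : forall v, exists u, forall w, ip u w = G i v w.
  move=> v; apply: (@riesz _ _ V_complete ip 1 1 `|v|) => //.
  - exact: ip_form.
  - by move=> u; rewrite ip_norm mul1r.
  - by move=> u; rewrite ip_norm mul1r.
  - by move=> k u w; rewrite !(formC (G_form i) v) (G_form i).2.
  - by move=> w; exact: G_CS.
have lin : linear B0.
  move=> k u v; apply: ip_inj => w.
  by rewrite ip_form.2 !B0P (G_form i).2.
pose Bm := GRing.isLinear.Build _ _ _ _ B0 lin.
pose B : {linear V -> V} := HB.pack B0 Bm.
by exists B.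
Qed.

Variables (theta : R) (B : 'I_4 -> {linear V -> V}).
Hypothesis theta01 : 0 < theta < 1.
Hypothesis BP : forall i v w, ip (B i v) w = G i v w.

Lemma B_le i v : `|B i v| <= `|v|.
Proof.
have [->|w0] := eqVneq (B i v) 0; first by rewrite normr0.
rewrite -(@ler_pM2r _ `|B i v|) ?normr_gt0 // -expr2 -ip_norm BP.
by apply: le_trans (ler_norm _) (G_CS _ _ _).
Qed.

Definition coef (y : 'rV[R]_4) (i : 'I_4) : R := 1 - theta * y 0 i.

Lemma coef_ge y : paramU y -> forall i, 1 - theta <= coef y i <= 2.
Proof.
move=> yU i; have /andP[y1 y2] := yU i; have /andP[t0 t1] := theta01.
rewrite /coef; apply/andP; split; nra.
Qed.

Let c := 1 - theta.
Let c0 : 0 < c. Proof. by rewrite /c; case/andP: theta01; lra. Qed.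

(** The equation constrains [u] only on the closed cube; at the points of its interior small
    increments remain admissible. *)
Definition inside (y : 'rV[R]_4) := forall i, `|y 0 i| < 1.

Lemma insideW y : inside y -> paramU y.
Proof. by move=> h i; have := h i; rewrite ltr_norml => /andP[? ?]; rewrite !ltW. Qed.

Definition line_point (j : 'I_4) (y : 'rV[R]_4) (h : R) : 'rV[R]_4 := h *: delta_mx 0 j + y.

Lemma line_pointE j y h i : line_point j y h 0 i = h * (i == j)%:R + y 0 i.
Proof. by rewrite !mxE eqxx. Qed.

Lemma near_inside j y : inside y -> \forall h \near (0 : R)^', inside (line_point j y h).
Proof.
move=> yO; have e0 : 0 < 1 - `|y 0 j| by rewrite subr_gt0.
near=> h => i.
rewrite line_pointE; have [->|_] := eqVneq i j; last by rewrite mulr0 add0r.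
rewrite mulr1; apply: le_lt_trans (ler_normD _ _) _; rewrite -ltrBrDr.
by near: h; exact: dnbhs0_lt.
Unshelve. all: by end_near. Qed.

(** [partial] is a [lim] and has a value even where the quotients diverge; here the convergence
    itself is recorded. *)
Definition deriv_at (w : 'rV[R]_4 -> V) (j : 'I_4) (y : 'rV[R]_4) (d : V) : Prop :=
  h^-1 *: (w (line_point j y h) - w y) @[h --> 0^'] --> d.

Lemma deriv_atE w j y d : deriv_at w j y d -> partial j w y = d.
Proof. by move=> h; apply: cvg_lim h. Qed.

Lemma deriv_at_B i w j y d : deriv_at w j y d -> deriv_at (B i \o w) j y (B i d).
Proof.
move=> h; apply/cvgrPdist_lt => e e0.
have /cvgrPdist_lt /(_ _ e0) := h; apply: filterS => t; apply: le_lt_trans.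
by rewrite /= -linearB -linearZ -linearB; exact: B_le.
Qed.

(** Vanishing coefficients are exempted because [decr nu i] is [nu] itself when [nu i = 0], which no
    induction on the order reaches. *)
Lemma deriv_at_sum (I : finType) (F : I -> 'rV[R]_4 -> V) (k : I -> R) j y (d : I -> V) :
  (forall i, k i != 0 -> deriv_at (F i) j y (d i)) ->
  deriv_at (fun y => \sum_i k i *: F i y) j y (\sum_i k i *: d i).
Proof.
move=> h; rewrite /deriv_at.
have -> : (fun t => t^-1 *: (\sum_i k i *: F i (line_point j y t) - \sum_i k i *: F i y)) =
    (fun t => \sum_i k i *: (t^-1 *: (F i (line_point j y t) - F i y))).
  apply/funext => t; rewrite -sumrB scaler_sumr; apply: eq_bigr => i _.
  by rewrite -scalerBr !scalerA mulrC.
elim: (index_enum I) => [|i r IH].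
  by under eq_cvg do rewrite big_nil; rewrite big_nil; exact: cvg_cst.
under eq_cvg do rewrite big_cons; rewrite big_cons; apply: cvgD; last exact: IH.
have [->|ki] := eqVneq (k i) 0.
  by under eq_cvg do rewrite scale0r; rewrite scale0r; exact: cvg_cst.
by apply: cvgZ; [exact: cvg_cst|exact: h].
Qed.

Lemma deriv_at_add_cst a w j y d : deriv_at w j y d -> deriv_at (fun y => a + w y) j y d.
Proof.
rewrite /deriv_at; under [in X in _ -> X]eq_cvg do rewrite opprD addrACA subrr add0r.
by [].
Qed.

(** Implicit differentiation by stability alone. The estimate is applied to the shifted solution for
    boundedness, to the increment for continuity, and to the difference quotient minus [w'] for
    convergence. *)
Lemma deriv_solution (w g : 'rV[R]_4 -> V) j y d w' : inside y ->
  (forall y, inside y -> forall v, wform (coef y) (w y) v = ip (g y) v) ->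
  deriv_at g j y d ->
  (forall v, wform (coef y) w' v = ip (d + theta *: B j (w y)) v) ->
  deriv_at w j y w'.
Proof.
move=> yO eqw dg eqw'.
have /andP[t0 t1] := theta01.
have coefs t i : coef (line_point j y t) i = coef y i - t * theta * (i == j)%:R.
  by rewrite /coef line_pointE; ring.
have lo y' : inside y' -> forall i, c <= coef y' i.
  by move=> /insideW h i; case/andP: (coef_ge h i).
have stab y' x z : inside y' -> (forall v, wform (coef y') x v = ip z v) -> c * `|x| <= `|z|.
  by move=> /lo h; exact: wform_stable.
(* The increment solves an equation with coefficients frozen at [y]: the change of the [j]-th
   coefficient moves to the right-hand side, where [B j] represents it. *)
have diff t v : inside (line_point j y t) -> wform (coef y) (w (line_point j y t) - w y) v =
    ip (g (line_point j y t) - g y + (t * theta) *: B j (w (line_point j y t))) v.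
  move=> sO; rewrite (formBl (wform_form _)) eqw // (formDl ip_form) (formBl ip_form) -!eqw //.
  rewrite (formZl ip_form) BP; set x := w (line_point j y t).
  have -> : wform (coef (line_point j y t)) x v = wform (coef y) x v - t * theta * G j x v.
    rewrite /wform [in RHS](bigD1 j) //= (bigD1 j) //= coefs eqxx.
    rewrite [X in _ + X = _](eq_bigr (fun i => coef y i * G i x v)).
      by rewrite mulr1 mulrBl addrAC.
    by move=> i /negbTE ij; rewrite coefs ij mulr0 subr0.
  by rewrite eqw //; ring.
have gcvg : g (line_point j y t) - g y @[t --> 0^'] --> 0.
  have : t *: (t^-1 *: (g (line_point j y t) - g y)) @[t --> 0^'] --> 0 *: d.
    by apply: cvgZ; [exact: nbhs_dnbhs|exact: dg].
  rewrite scale0r; apply: cvg_trans; apply: near_eq_cvg.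
  near=> t; rewrite scalerA divff ?scale1r //; near: t; exact: nbhs_dnbhs_neq.
pose M := (`|g y| + 1) / c.
have M0 : 0 <= M by rewrite divr_ge0 ?(ltW c0) // addr_ge0.
have wbound : \forall t \near 0^', `|w (line_point j y t)| <= M.
  near=> t.
  have sO : inside (line_point j y t) by near: t; exact: near_inside.
  rewrite /M ler_pdivlMr // mulrC; apply: le_trans (stab _ _ _ sO (eqw _ sO)) _.
  rewrite -[g _](subrK (g y)) addrC (le_trans (ler_normD _ _)) // lerD2l.
  by near: t; move/cvgr0_norm_le : gcvg; apply.
have wcvg : w (line_point j y t) - w y @[t --> 0^'] --> 0.
  have bnd : \forall t \near 0^', `|w (line_point j y t) - w y| <=
      c^-1 * (`|g (line_point j y t) - g y| + `|t| * M).
    near=> t.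
    have sO : inside (line_point j y t) by near: t; exact: near_inside.
    rewrite mulrC ler_pdivlMr // mulrC.
    apply: le_trans (stab _ _ _ yO (fun v => diff t v sO)) _.
    apply: le_trans (ler_normD _ _) _; rewrite lerD2l normrZ normrM -mulrA ler_wpM2l //.
    rewrite (gtr0_norm t0) -[leRHS]mul1r ler_pM ?(ltW t0) ?(ltW t1) //.
    apply: le_trans (B_le _ _) _; near: t; exact: wbound.
  apply: norm_cvg0.
  apply: (squeeze_cvgr (f := cst 0) (h := fun t => c^-1 * (`|g (line_point j y t) - g y| + `|t| * M))).
  - by near=> t; rewrite normr_ge0 /=; near: t.
  - exact: cvg_cst.
  - rewrite [X in _ --> X](_ : 0 = c^-1 * (`|0 : V| + `|0 : R| * M)); last by rewrite !normr0 mul0r addr0 mulr0.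
    apply: cvgM; first exact: cvg_cst.
    apply: cvgD; first exact: cvg_norm.
    apply: cvgM; last exact: cvg_cst.
    by apply: cvg_norm; exact: nbhs_dnbhs.
apply/subr_cvg0; apply: norm_cvg0.
have bnd : \forall t \near 0^', `|t^-1 *: (w (line_point j y t) - w y) - w'| <=
    c^-1 * (`|t^-1 *: (g (line_point j y t) - g y) - d| + `|w (line_point j y t) - w y|).
  near=> t.
  have sO : inside (line_point j y t) by near: t; exact: near_inside.
  have tn0 : t != 0 by near: t; exact: nbhs_dnbhs_neq.
  rewrite mulrC ler_pdivlMr // mulrC.
  have : forall v, wform (coef y) (t^-1 *: (w (line_point j y t) - w y) - w') v =
     ip (t^-1 *: (g (line_point j y t) - g y) - d + theta *: (B j (w (line_point j y t) - w y))) v.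
    move=> v; rewrite (formBl (wform_form _)) (formZl (wform_form _)) diff // eqw'.
    rewrite -(formZl ip_form) -(formBl ip_form); congr (ip _ v).
    rewrite (linearB (B j)) (scalerBr theta) [in LHS]scalerDr scalerA mulrA mulVf // mul1r opprD.
    by rewrite addrACA.
  move=> /(stab _ _ _ yO) /le_trans; apply.
  apply: le_trans (ler_normD _ _) _; rewrite lerD2l normrZ (gtr0_norm t0).
  by rewrite -[leRHS]mul1r ler_pM ?(ltW t0) ?(ltW t1) ?B_le.
apply: (squeeze_cvgr (f := cst 0) (h := fun t =>
    c^-1 * (`|t^-1 *: (g (line_point j y t) - g y) - d| + `|w (line_point j y t) - w y|))).
- by near=> t; rewrite normr_ge0 /=; near: t.
- exact: cvg_cst.
- rewrite [X in _ --> X](_ : 0 = c^-1 * (`|0 : V| + `|0 : V|)); last by rewrite !normr0 addr0 mulr0.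
  apply: cvgM; first exact: cvg_cst.
  by apply: cvgD; apply: cvg_norm => //; exact/subr_cvg0.
Unshelve. all: by end_near. Qed.

Definition decr (nu : 'I_4 -> nat) (i : 'I_4) : 'I_4 -> nat := fun j => (nu j - (j == i))%N.
Definition incr (nu : 'I_4 -> nat) (i : 'I_4) : 'I_4 -> nat := fun j => (nu j + (j == i))%N.
Definition mi_order (nu : 'I_4 -> nat) : nat := (\sum_i nu i)%N.

Lemma mi_order_incr nu i : mi_order (incr nu i) = (mi_order nu).+1.
Proof.
rewrite /mi_order /incr big_split /= -[RHS]addn1; congr (_ + _)%N.
by rewrite (bigD1 i) //= eqxx big1 // => j /negbTE ->.
Qed.

Lemma decr_incr nu i : decr (incr nu i) i = nu.
Proof. by apply/funext => j; rewrite /decr /incr addnK. Qed.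

Lemma incr_decr nu i : (0 < nu i)%N -> incr (decr nu i) i = nu.
Proof.
move=> h; apply/funext => j; rewrite /decr /incr.
by have [->|] := eqVneq j i; rewrite ?subn0 ?addn0 ?subnK.
Qed.

Lemma decr_incrC nu i j : (0 < nu i)%N -> decr (incr nu j) i = incr (decr nu i) j.
Proof.
move=> h; apply/funext => l; rewrite /decr /incr.
by have [->|_] := eqVneq l i; rewrite ?subn0 // addnBAC.
Qed.

Lemma mi_order_decr nu i : (0 < nu i)%N -> (mi_order (decr nu i)).+1 = mi_order nu.
Proof. by move=> /incr_decr {2}<-; rewrite mi_order_incr. Qed.

Variable u : 'rV[R]_4 -> V.
Hypothesis uP : forall y, paramU y -> forall v, wform (coef y) (u y) v = ip (u 0) v.

(** Candidates for the partial derivatives, defined by the formally differentiated equation before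
    any derivative is known to exist. *)
Lemma derivative_family : exists W : ('I_4 -> nat) -> 'rV[R]_4 -> V,
  forall y, inside y -> W (fun=> 0%N) y = u y /\
    forall nu, (0 < mi_order nu)%N -> forall v, wform (coef y) (W nu y) v =
      ip (\sum_i (theta * (nu i)%:R) *: B i (W (decr nu i) y)) v.
Proof.
have /choice[S SP] : forall yz : 'rV[R]_4 * V, exists w, inside yz.1 ->
    forall v, wform (coef yz.1) w v = ip yz.2 v.
  move=> [y z]; have [yO|nO] := pselect (inside y); last by exists 0.
  have [w wP] := wform_solve z c0 (coef_ge (insideW yO)).
  by exists w => _; exact: wP.
(* Recursion on the order [n] of [nu], as [decr nu i] is not structurally smaller. Order 0 is the
   given [u] and not a chosen solution. *)
pose fix U (n : nat) (nu : 'I_4 -> nat) (y : 'rV[R]_4) {struct n} : V :=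
  if n is m.+1 then S (y, \sum_i (theta * (nu i)%:R) *: B i (U m (decr nu i) y)) else u y.
exists (fun nu => U (mi_order nu) nu) => y yO; split.
  by rewrite /mi_order big1.
move=> nu; case E : (mi_order nu) => [//|m] _ v /=.
rewrite (SP (y, _) yO v) /=; congr (ip _ v); apply: eq_bigr => i _.
case F : (nu i) => [|k]; first by rewrite mulr0 !scale0r.
by have := @mi_order_decr nu i; rewrite F E => /(_ isT) [->].
Qed.

Lemma derivative_family_deriv (W : ('I_4 -> nat) -> 'rV[R]_4 -> V) :
  (forall y, inside y -> W (fun=> 0%N) y = u y /\
    forall nu, (0 < mi_order nu)%N -> forall v, wform (coef y) (W nu y) v =
      ip (\sum_i (theta * (nu i)%:R) *: B i (W (decr nu i) y)) v) ->
  forall nu j y, inside y -> deriv_at (W nu) j y (W (incr nu j) y).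
Proof.
move=> HW nu j y; have [n] := ubnP (mi_order nu); elim: n nu j y => // n IH nu j y nun yO.
(* One datum for all orders: at order 0 it is the fixed load represented by [u 0], and the sum
   vanishes. *)
pose g y := (if mi_order nu is 0 then u 0 else 0) +
  \sum_i (theta * (nu i)%:R) *: B i (W (decr nu i) y).
have eqW z : inside z -> forall v, wform (coef z) (W nu z) v = ip (g z) v.
  move=> zO v; rewrite /g; have [W0 Wn] := HW z zO.
  case E : (mi_order nu) => [|m]; last by rewrite add0r Wn ?E.
  have nu0 i : nu i = 0%N.
    by apply/eqP; move/eqP: E; rewrite /mi_order sum_nat_eq0 => /forallP /(_ i).
  rewrite (_ : nu = fun=> 0%N); last exact/funext.
  rewrite W0 (uP (insideW zO)) big1 ?addr0 // => i _.
  by rewrite mulr0 scale0r.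
apply: (deriv_solution yO eqW (d := \sum_i (theta * (nu i)%:R) *: B i (W (incr (decr nu i) j) y))).
  apply: deriv_at_add_cst; apply: (deriv_at_sum (F := fun i => B i \o W (decr nu i))) => i.
  rewrite mulf_eq0 negb_or pnatr_eq0 -lt0n => /andP[_ nui].
  by apply: deriv_at_B; apply: IH => //; rewrite -ltnS mi_order_decr.
move=> v; rewrite (HW y yO).2 ?mi_order_incr //; congr (ip _ v).
(* The extra unit of [incr nu j] at [j] splits off the term [theta *: B j (W nu y)], which is the
   derivative of the coefficient. *)
rewrite (eq_bigr (fun i => (theta * (nu i)%:R) *: B i (W (incr (decr nu i) j) y) +
    (if i == j then theta *: B j (W nu y) else 0))); last first.
  move=> i _; rewrite [in X in X%:R]/incr; have [->|_] := eqVneq i j.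
    rewrite decr_incr natrD mulrDr mulr1 scalerDl; congr (_ + _).
    case E : (nu j) => [|m]; first by rewrite mulr0 !scale0r.
    by rewrite incr_decr // E.
  rewrite addn0 addr0; case E : (nu i) => [|m]; first by rewrite mulr0 !scale0r.
  by rewrite -decr_incrC ?E.
by rewrite big_split -big_mkcond big_pred1_eq.
Qed.

(** Iterated partials are known to agree with the family only in the open cube, which suffices since
    a derivative depends on the germ. *)
Lemma partial_local j (w w' : 'rV[R]_4 -> V) y : inside y ->
  (forall y, inside y -> w y = w' y) -> partial j w y = partial j w' y.
Proof.
move=> yO ww'; rewrite /partial /derive; congr (lim _).
have E : \forall t \near 0^', t^-1 *: (w (t *: delta_mx 0 j + y) - w y) =
    t^-1 *: (w' (t *: delta_mx 0 j + y) - w' y).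
  by apply: filterS (near_inside j yO) => t tO; rewrite (ww' _ tO) ww'.
by apply/seteqP; split; apply: near_eq_cvg; apply: filterS E => t ->.
Qed.

Lemma mpartial_family (W : ('I_4 -> nat) -> 'rV[R]_4 -> V) :
  (forall y, inside y -> W (fun=> 0%N) y = u y) ->
  (forall nu j y, inside y -> deriv_at (W nu) j y (W (incr nu j) y)) ->
  forall nu y, inside y -> mpartial nu u y = W nu y.
Proof.
move=> W0 dW nu.
(* Induction over the variables already differentiated: [rst s] keeps the orders of [nu] in [s] and
   is 0 elsewhere. *)
pose rst (s : seq 'I_4) := fun i => if i \in s then nu i else 0%N.
suff key s : uniq s -> forall y, inside y ->
    foldr (fun i g => iter (nu i) (@partial _ _ i) g) u s y = W (rst s) y.
  move=> y yO; rewrite /mpartial key ?enum_uniq //; congr (W _ y).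
  by apply/funext => i; rewrite /rst mem_enum.
elim: s => [_ y yO|j s IH /= /andP[js us]]; first by rewrite /= W0.
pose ex m := fun i => if i == j then m else rst s i.
suff it m y : inside y -> iter m (@partial _ _ j)
    (foldr (fun i g => iter (nu i) (@partial _ _ i) g) u s) y = W (ex m) y.
  move=> y yO; rewrite it //; congr (W _ y); apply/funext => i.
  by rewrite /ex /rst in_cons; case: eqVneq => // ->.
elim: m y => [|m IHm] y yO.
  rewrite /= IH //; congr (W _ y); apply/funext => i.
  by rewrite /ex; case: eqVneq => // ->; rewrite /rst (negbTE js).
rewrite iterS (partial_local j yO IHm) (deriv_atE (dW _ _ _ yO)); congr (W _ y).
apply/funext => i; rewrite /incr /ex; case: eqVneq => _; first by rewrite addn1.
by rewrite addn0.
Qed.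

(** At the origin all weights are 1, so the differentiated equation is an identity for the inner
    product, and the factorials absorb the factor [nu i]. Indices with [nu i = 0] are left out since
    [decr] truncates. *)
Lemma taylor_recursion nu : (0 < mi_order nu)%N -> taylor_coef u nu =
  theta *: \sum_(i | (0 < nu i)%N) B i (taylor_coef u (decr nu i)).
Proof.
have [W HW] := derivative_family; have dW := derivative_family_deriv HW.
have O0 : inside 0 by move=> i; rewrite mxE normr0 ltr01.
have mW := mpartial_family (fun y yO => (HW y yO).1) dW.
move=> nu0; rewrite /taylor_coef mW //.
have -> : W nu 0 = \sum_i (theta * (nu i)%:R) *: B i (W (decr nu i) 0).
  apply: ip_inj => v; rewrite -(HW 0 O0).2 //; apply: eq_bigr => i _.
  by rewrite /coef mxE mulr0 subr0.
rewrite scaler_sumr scaler_sumr [RHS]big_mkcond; apply: eq_bigr => i _.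
case: ifPn => [nui|]; last by rewrite -eqn0Ngt => /eqP ->; rewrite mulr0 scale0r scaler0.
rewrite mW // [B i (_ *: _)]linearZ /= !scalerA; congr (_ *: _).
rewrite (bigD1 i) //= [in RHS](bigD1 i) //= /decr eqxx subn1.
rewrite [in RHS](eq_bigr (fun j => (nu j)`!%:R)); last by move=> j /negbTE ->; rewrite subn0.
case: (nu i) nui => // m _; rewrite factS natrM /=.
set P := \prod_(_ | _) _.
have P0 : P != 0 by apply/prodf_neq0 => j _; rewrite pnatr_eq0 -lt0n fact_gt0.
have m0 : (m`!%:R : R) != 0 by rewrite pnatr_eq0 -lt0n fact_gt0.
by field; rewrite P0 m0 addrC natr1 pnatr_eq0.
Qed.

Lemma taylor_coef0 : taylor_coef u (fun=> 0%N) = u 0.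
Proof.
rewrite /taylor_coef /mpartial big1 ?invr1 ?scale1r; last by move=> i _; rewrite fact0.
by congr (_ 0); elim: (enum 'I_4).
Qed.

End parametric.

(** * The checkerboard: Taylor coefficients lie in small spans *)

Definition flip1 (i : 'I_4) : 'I_4 := inord (if odd i then i.-1 else i.+1).
Definition flip2 (i : 'I_4) : 'I_4 := inord (if (2 <= i)%N then i.-2 else i.+2).
(* The signs of the two coordinates on the i-th quadrant. *)
Definition sign1 (R : pzRingType) (i : 'I_4) : R := if odd i then 1 else - 1.
Definition sign2 (R : pzRingType) (i : 'I_4) : R := if (2 <= i)%N then 1 else - 1.

Lemma flip1K : involutive flip1.
Proof. by case=> [[|[|[|[|i]]]] hi] //; apply/val_inj; rewrite /flip1 /= !inordK //= inordK. Qed.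
Lemma flip2K : involutive flip2.
Proof. by case=> [[|[|[|[|i]]]] hi] //; apply/val_inj; rewrite /flip2 /= !inordK //= inordK. Qed.
Lemma sign1_flip1 (R : pzRingType) i : sign1 R (flip1 i) = - sign1 R i.
Proof. by case: i => [[|[|[|[|i]]]] hi] //; rewrite /sign1 /flip1 /= inordK //= opprK. Qed.
Lemma sign1_flip2 (R : pzRingType) i : sign1 R (flip2 i) = sign1 R i.
Proof. by case: i => [[|[|[|[|i]]]] hi] //; rewrite /sign1 /flip2 /= inordK. Qed.
Lemma sign2_flip1 (R : pzRingType) i : sign2 R (flip1 i) = sign2 R i.
Proof. by case: i => [[|[|[|[|i]]]] hi] //; rewrite /sign2 /flip1 /= inordK. Qed.
Lemma sign2_flip2 (R : pzRingType) i : sign2 R (flip2 i) = - sign2 R i.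
Proof. by case: i => [[|[|[|[|i]]]] hi] //; rewrite /sign2 /flip2 /= inordK //= opprK. Qed.
Lemma sign1M (R : pzRingType) i : sign1 R i * sign1 R i = 1.
Proof. by rewrite /sign1; case: ifP => _; rewrite ?mulrNN mulr1. Qed.
Lemma sign2M (R : pzRingType) i : sign2 R i * sign2 R i = 1.
Proof. by rewrite /sign2; case: ifP => _; rewrite ?mulrNN mulr1. Qed.

Section checkerboard.
Context (R : realType) (V : normedModType R) (G : 'I_4 -> V -> V -> R).
Hypothesis V_complete : seq_complete V.
Hypothesis G_form : forall i, sym_bilinear (G i).
Hypothesis G_ge0 : forall i v, 0 <= G i v v.
Hypothesis G_norm : forall v, \sum_i G i v v = `|v| ^+ 2.
Variables S1 S2 : {linear V -> V}.
Hypothesis S11 : forall v, S1 (S1 v) = v.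
Hypothesis S22 : forall v, S2 (S2 v) = v.
Hypothesis S12 : forall v, S1 (S2 v) = S2 (S1 v).
Hypothesis G_S1 : forall i v w, G i (S1 v) (S1 w) = G (flip1 i) v w.
Hypothesis G_S2 : forall i v w, G i (S2 v) (S2 w) = G (flip2 i) v w.
Hypothesis G_J1 : forall v, S1 v = - v ->
  exists v', forall i w, G i v' w = sign1 R i * G i v w.
Hypothesis G_J2 : forall v, S2 v = - v ->
  exists v', forall i w, G i v' w = sign2 R i * G i v w.

Local Notation wform := (wform G).
Local Notation ip := (ip G).
Let ipB := ip_form G_form.
Let ip_inj := ip_inj G_form G_norm.

Lemma wform_op (k : 'I_4 -> R) :
  exists C : {linear V -> V}, forall v w, ip (C v) w = wform k v w.
Proof.
have /choice[B BP] := fun i => form_op V_complete G_form G_ge0 G_norm i.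
pose C0 v := \sum_i k i *: B i v.
have lin : linear C0.
  move=> a u v; rewrite /C0 scaler_sumr -big_split; apply: eq_bigr => i _.
  by rewrite linearD linearZ scalerDr !scalerA /= mulrC.
pose C : {linear V -> V} := HB.pack C0 (GRing.isLinear.Build _ _ _ _ C0 lin).
exists C => v w; rewrite /= /C0 (form_suml ipB); apply: eq_bigr => i _.
by rewrite (formZl ipB) BP.
Qed.

Lemma reflect_adjoint (S : {linear V -> V}) (fl : 'I_4 -> 'I_4) : involutive fl ->
  (forall v, S (S v) = v) -> (forall i v w, G i (S v) (S w) = G (fl i) v w) ->
  forall k v w, wform k (S v) w = wform (k \o fl) v (S w).
Proof.
move=> flK SS GS k v w; rewrite /wform (reindex_inj (can_inj flK)) /=.
by apply: eq_bigr => i _; rewrite -{1}(SS w) GS flK.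
Qed.

(** [S] is an isometry permuting the quadrants, so the parity [e] of the weight under this
    permutation decides between commuting and anticommuting. *)
Lemma reflect_op (S : {linear V -> V}) (fl : 'I_4 -> 'I_4) (e : R) k (C : {linear V -> V}) :
  involutive fl -> (forall v, S (S v) = v) ->
  (forall i v w, G i (S v) (S w) = G (fl i) v w) ->
  (forall v w, ip (C v) w = wform k v w) -> e * e = 1 -> (forall i, k (fl i) = e * k i) ->
  forall v, S (C v) = e *: C (S v).
Proof.
move=> flK SS GS CP e2 ke v; apply: ip_inj => w.
rewrite (formZl ipB) CP /ip !(reflect_adjoint flK SS GS).
rewrite -[wform _ (C v) _]/(ip (C v) (S w)) CP /wform mulr_sumr.
by apply: eq_bigr => i _; rewrite /= ke !mulrA e2 mul1r.
Qed.

Variables (u : 'rV[R]_4 -> V) (theta : R).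
Hypothesis theta01 : 0 < theta < 1.
Hypothesis uP : forall y, paramU y -> forall v, wform (coef theta y) (u y) v = ip (u 0) v.

Lemma taylor_spanned k : (1 <= k)%N -> exists s : seq V, size s = (8 * k + 5)%N /\
  forall nu, (mi_order nu <= k)%N -> spanned s (taylor_coef u nu).
Proof.
move=> k1.
have /choice[B BP] := fun i => form_op V_complete G_form G_ge0 G_norm i.
have [C1 C1P] := wform_op (sign2 R).
have [C2 C2P] := wform_op (sign1 R).
have [C12 C12P] := wform_op (fun i => sign1 R i * sign2 R i).
have S1C1 v : S1 (C1 v) = C1 (S1 v).
  rewrite (reflect_op (e := 1) flip1K S11 G_S1 C1P) ?scale1r ?mulr1 // => i.
  by rewrite sign2_flip1 mul1r.
have S2C1 v : S2 (C1 v) = - C1 (S2 v).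
  rewrite (reflect_op (e := -1) flip2K S22 G_S2 C1P) ?scaleN1r ?mulrNN ?mulr1 // => i.
  by rewrite sign2_flip2 mulN1r.
have S1C2 v : S1 (C2 v) = - C2 (S1 v).
  rewrite (reflect_op (e := -1) flip1K S11 G_S1 C2P) ?scaleN1r ?mulrNN ?mulr1 // => i.
  by rewrite sign1_flip1 mulN1r.
have S2C2 v : S2 (C2 v) = C2 (S2 v).
  rewrite (reflect_op (e := 1) flip2K S22 G_S2 C2P) ?scale1r ?mulr1 // => i.
  by rewrite sign1_flip2 mul1r.
have S1C12 v : S1 (C12 v) = - C12 (S1 v).
  rewrite (reflect_op (e := -1) flip1K S11 G_S1 C12P) ?scaleN1r ?mulrNN ?mulr1 // => i.
  by rewrite sign1_flip1 sign2_flip1 mulN1r mulNr.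
have S2C12 v : S2 (C12 v) = - C12 (S2 v).
  rewrite (reflect_op (e := -1) flip2K S22 G_S2 C12P) ?scaleN1r ?mulrNN ?mulr1 // => i.
  by rewrite sign1_flip2 sign2_flip2 mulN1r mulrN.
(* Here [C1 v] is the signed function itself, so the sign passes through every weighted form and not
   only through the inner product. *)
have J2 v : S2 v = - v -> forall k w, wform k (C1 v) w = wform (fun i => k i * sign2 R i) v w.
  move=> /G_J2[v' v'P].
  have -> : C1 v = v'.
    by apply: ip_inj => w; rewrite C1P; apply: eq_bigr => i _; rewrite v'P mul1r.
  by move=> l w; apply: eq_bigr => i _; rewrite v'P mulrA.
have J1 v : S1 v = - v -> forall k w, wform k (C2 v) w = wform (fun i => k i * sign1 R i) v w.
  move=> /G_J1[v' v'P].
  have -> : C2 v = v'.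
    by apply: ip_inj => w; rewrite C2P; apply: eq_bigr => i _; rewrite v'P mul1r.
  by move=> l w; apply: eq_bigr => i _; rewrite v'P mulrA.
have C11 v : S2 v = - v -> C1 (C1 v) = v.
  move=> h; apply: ip_inj => w; rewrite C1P J2 //; apply: eq_bigr => i _.
  by rewrite sign2M.
have C22 v : S1 v = - v -> C2 (C2 v) = v.
  move=> h; apply: ip_inj => w; rewrite C2P J1 //; apply: eq_bigr => i _.
  by rewrite sign1M.
have C21o v : S2 v = - v -> C12 v = C2 (C1 v).
  by move=> h; apply: ip_inj => w; rewrite C12P C2P J2.
have C12o v : S1 v = - v -> C12 v = C1 (C2 v).
  move=> h; apply: ip_inj => w; rewrite C12P C1P J1 //; apply: eq_bigr => i _.
  by rewrite (mulrC (sign1 R i)).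
have C121 v : S2 v = - v -> C12 (C1 v) = C2 v.
  move=> h; apply: ip_inj => w; rewrite C12P C2P J2 //; apply: eq_bigr => i _.
  by rewrite -(mulrA (sign1 R i)) sign2M mulr1.
have C122 v : S1 v = - v -> C12 (C2 v) = C1 v.
  move=> h; apply: ip_inj => w; rewrite C12P C1P J1 //; apply: eq_bigr => i _.
  by rewrite (mulrAC (sign1 R i)) sign1M mul1r.
have sub0 x y : ip (x - y) (x - y) = 0 -> x = y.
  move=> /eqP; rewrite (ip_norm G_norm) sqrf_eq0 normr_eq0 subr_eq0; exact: eqP.
have wC k1 x y : wform k1 x y = wform k1 y x := formC (wform_form G_form k1) x y.
(* Duality: the defect [d] is odd in the second variable, so in its pairing with [C1 (C2 v)] the
   operator [C1] moves onto [d] as a multiplication, and both terms agree. *)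
have C12e v : S2 v = v -> C12 v = C1 (C2 v).
  move=> h; apply: sub0; set d := _ - _.
  have od : S2 d = - d by rewrite linearB /= S2C12 S2C1 S2C2 h opprB opprK addrC.
  rewrite {1}/d (formBl ipB) C12P C1P wC (wC (sign2 R)) -C1P /ip (wC (fun=> 1)) -/ip C2P.
  by rewrite (wC (sign1 R)) J2 // subrr.
have C21e v : S1 v = v -> C12 v = C2 (C1 v).
  move=> h; apply: sub0; set d := _ - _.
  have od : S1 d = - d by rewrite linearB /= S1C12 S1C2 S1C1 h opprB opprK addrC.
  rewrite {1}/d (formBl ipB) C12P C2P wC (wC (sign1 R)) -C2P /ip (wC (fun=> 1)) -/ip C1P.
  rewrite (wC (sign2 R)) J1 //.
  by apply/eqP; rewrite subr_eq0; apply/eqP; apply: eq_bigr => i _; rewrite (mulrC (sign1 R i)).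
(* With s1, s2 the signs of the two coordinates and e1, e2 their values on quadrant [i], its
   indicator is (1 + e1 s1)(1 + e2 s2) / 4. *)
have BE i v : B i v = 4^-1 *: (v + sign2 R i *: C1 v + sign1 R i *: C2 v +
    (sign1 R i * sign2 R i) *: C12 v).
  apply: ip_inj => w; rewrite BP !(formZl ipB, formDl ipB) C1P C2P C12P /ip /wform.
  rewrite !mulr_sumr -!big_split mulr_sumr (bigD1 i) //= big1 ?addr0.
    by rewrite /sign1 /sign2; case: ifP => _; case: ifP => _; field.
  move=> j ij; have ij0 : (j : nat) != i by [].
  move: i j ij0 {ij} => [[|[|[|[|i]]]] hi] // [[|[|[|[|j]]]] hj] //= _; rewrite /sign1 /sign2 /=; by field.
have [Z [Zsize Z0 Zstep]] := @klein_words R V C1 C2 C12 S1 S2 S11 S22 S12 S1C1 S2C1 S1C2 S2C2 S1C12 S2C12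
  C11 C22 C21o C12o C12e C21e C121 C122 (u 0).
exists (Z k); split; first exact: Zsize.
have mono m n v : (m <= n)%N -> spanned (Z m) v -> spanned (Z n) v.
  by move=> /subnK <-; elim: (n - m)%N => // p IH /IH /Zstep[].
suff key n nu : mi_order nu = n -> spanned (Z n) (taylor_coef u nu).
  by move=> nu nuk; apply: mono nuk _; exact: key.
elim: n nu => [|n IH] nu nun.
  rewrite (_ : nu = fun=> 0%N) ?taylor_coef0 //.
  apply/funext => i; move/eqP: nun; rewrite /mi_order sum_nat_eq0 => /forallP /(_ i).
  by move=> /eqP.
rewrite (taylor_recursion V_complete G_form G_ge0 G_norm theta01 BP uP) ?nun //.
apply: spannedZ; apply: spanned_sum => i nui.
have /IH/Zstep[z0 z1 z2 z3] : mi_order (decr nu i) = n by have := mi_order_decr nui; rewrite nun => -[].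
by rewrite BE; apply: spannedZ; do !apply: spannedD => //; exact: spannedZ.
Qed.

End checkerboard.

(** * Polynomial coefficients and the rank bound *)

(** Exchanging the sums makes the coordinates of the Taylor coefficients the coefficients of the
    polynomials. [msize] is the degree plus one. *)
Lemma taylor_trunc_poly (R : realType) (V : normedModType R) (w : 'rV[R]_4 -> V)
    (k n : nat) (s : seq V) : size s = n ->
  (forall nu, (mi_order nu <= k)%N -> spanned s (taylor_coef w nu)) ->
  exists (v : 'I_n -> V) (phi : 'I_n -> mpoly.mpoly 4 R),
    (forall l, (mpoly.msize (phi l) <= k.+1)%N) /\
    (forall y, taylor_trunc w k y =
       \sum_(l < n) mpoly.meval (y 0) (phi l) *: v l).
Proof.
move=> <- {n} sp.
have /choice[c cP] : forall nu : {ffun 'I_4 -> 'I_k.+1}, exists c : nat -> R,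
    (\sum_(i < 4) nu i <= k)%N ->
    taylor_coef w (fun i => nu i) = \sum_(l < size s) c l *: s`_l.
  move=> nu; have [nuk|_] := boolP (\sum_(i < 4) nu i <= k)%N; last by exists (fun=> 0).
  by have [c cE] := sp (fun i => nu i) nuk; exists c.
pose X (nu : {ffun 'I_4 -> 'I_k.+1}) : mpoly.mpoly 4 R :=
  mpoly.mpolyX R (mpoly.Multinom [tuple (nu i : nat) | i < 4]).
exists (fun l => s`_l), (fun l => \sum_(nu : {ffun 'I_4 -> 'I_k.+1} |
   (\sum_(i < 4) nu i <= k)%N) c nu l *: X nu); split=> [l|y].
  apply: leq_trans (mpoly.mmeasure_sum _ _ _ _) _.
  apply/bigmax_leqP => nu nuk; apply: leq_trans (mpoly.msizeZ_le _ _) _.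
  rewrite mpoly.msizeX mpoly.mdegE ltnS (eq_bigr (fun i => nu i : nat)) // => i _.
  by rewrite mpoly.mnmE.
under eq_bigr do rewrite linear_sum scaler_suml /=.
rewrite exchange_big; apply: eq_bigr => nu nuk; rewrite cP // scaler_sumr.
apply: eq_bigr => l _; rewrite mpoly.mevalZ scalerA mulrC; congr (_ * _ *: _).
by rewrite mpoly.mevalX; apply: eq_bigr => i _; rewrite mpoly.mnmE.
Qed.

(** * Rank of a finite sum of separated terms *)

Section rank_bound.
Context (d : measure_display) (T : measurableType d) (R : realType).
Context (V : normedModType R) (mu : {measure set T -> \bar R}) (E : set T).
Hypothesis mE : measurable E.

(* Unlike [ge0_le_integral], this needs no measurability. *)
Lemma le_integral_nonmeasurable (f g : T -> \bar R) :
  (forall t, E t -> (0 <= f t)%E) -> (forall t, E t -> (f t <= g t)%E) ->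
  (\int[mu]_(t in E) f t <= \int[mu]_(t in E) g t)%E.
Proof.
move=> f0 fg; rewrite !ge0_integralE //; last by move=> t Et; apply: le_trans (fg t Et); exact: f0.
apply: le_ereal_sup => _ [h hf <-]; exists h => //= t.
apply: le_trans (hf t) _; rewrite !patchE; case: ifPn => //; rewrite inE; exact: fg.
Qed.

Variable b : V -> V -> R.
Hypothesis b_form : sym_bilinear b.
Hypothesis b_norm : forall v, b v v = `|v| ^+ 2.

Lemma b_CS u v : `|b u v| <= `|u| * `|v|.
Proof.
rewrite -(@ler_pXn2r _ 2) ?nnegrE ?mulr_ge0 // real_normK ?num_real //.
rewrite exprMn -!b_norm; apply: form_CS b_form _ _ _ => w.
by rewrite b_norm sqr_ge0.
Qed.

Lemma simple_integral_form (s : seq (set T * V)) q :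
  (forall p, p \in s -> measurable p.1 /\ (mu (p.1 `&` E) < +oo)%E) ->
  (mu.-integrable E (fun t => (b (simple_fun s t) q)%:E) /\
   \int[mu]_(t in E) (b (simple_fun s t) q)%:E = (b (simple_integral mu E s) q)%:E)%E.
Proof.
elim: s => [_|p s IH sP].
  rewrite /simple_fun /simple_integral; under eq_fun do rewrite big_nil (form0l b_form).
  by rewrite big_nil (form0l b_form) integral0; split => //; exact: integrable0.
have [|Is Es] := IH; first by move=> p' p's; apply: sP; rewrite inE p's orbT.
have [mp fp] := sP p (mem_head _ _).
have ip : mu.-integrable E (fun t => (b p.2 q)%:E * (\1_(p.1) t)%:E)%E.
  apply: integrableZl => //; apply/integrableP; split.
    exact/measurable_EFinP/measurable_indic.
  rewrite (eq_integral (fun t => (\1_(p.1) t)%:E)); last by move=> t _; rewrite gee0_abs // lee_fin.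
  by rewrite integral_indic.
have hE t : (b (simple_fun (p :: s) t) q)%:E =
    ((b p.2 q)%:E * (\1_(p.1) t)%:E + (b (simple_fun s t) q)%:E)%E.
  by rewrite /simple_fun big_cons (formDl b_form) (formZl b_form) EFinD EFinM muleC.
rewrite (funext hE).
split; first exact: integrableD.
rewrite integralD // Es /simple_integral big_cons (formDl b_form) EFinD (formZl b_form).
congr (_ + _)%E; rewrite integralZl //; last first.
  apply/integrableP; split; first exact/measurable_EFinP/measurable_indic.
  rewrite (eq_integral (fun t => (\1_(p.1) t)%:E)); last by move=> t _; rewrite gee0_abs // lee_fin.
  by rewrite integral_indic.
by rewrite integral_indic // EFinM fineK 1?muleC // ge0_fin_numE.
Qed.

(** For normalised [q], the integral of the [n]-th simple function pairs with it to at most the L^1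
    distance of that function from [F], which tends to 0. *)
Lemma bochner_orthogonal (F : T -> V) m q : is_bochner_integral mu E F m ->
  (forall t, E t -> b (F t) q = 0) -> b m q = 0.
Proof.
move=> [s [sP _ sF sm]] Fq; have [->|q0] := eqVneq q 0.
  by rewrite (formC b_form) (form0l b_form).
pose q' := `|q|^-1 *: q.
have nq' : `|q'| = 1 by rewrite normrZ normfV normr_id mulVf // normr_eq0.
have Fq' t : E t -> b (F t) q' = 0 by move=> Et; rewrite (formZr b_form) Fq // mulr0.
suff : b m q' = 0.
  by rewrite (formZr b_form) => /eqP; rewrite mulf_eq0 invr_eq0 normr_eq0 (negbTE q0) => /eqP.
have bound n : (`|b (simple_integral mu E (s n)) q'|%:E <=
    \int[mu]_(t in E) (`|F t - simple_fun (s n) t|)%:E)%E.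
  have [Is Es] := simple_integral_form q' (sP n).
  rewrite -abse_EFin -Es; apply: le_trans (le_abse_integral _ _ _) _ => //.
    by case/integrableP: Is.
  apply: le_integral_nonmeasurable => t Et; first by [].
  rewrite lee_fin -[b _ _]subr0 -(Fq' t Et) -(formBl b_form) distrC.
  by apply: le_trans (b_CS _ _) _; rewrite nq' mulr1 distrC.
apply/eqP; rewrite -normr_le0; apply/ler_addgt0Pr => e e0; rewrite add0r.
have e20 : 0 < e / 2 by rewrite divr_gt0.
have /cvgrPdist_lt /(_ _ e20) near1 := sm.
have near2 : \forall n \near \oo, (\int[mu]_(t in E) (`|F t - simple_fun (s n) t|)%:E < (e / 2)%:E)%E.
  have /(_ [set x | (x < (e / 2)%:E)%E]) := sF; apply.
  by apply: (@open_nbhs_nbhs _ _) ; split; [exact: open_ereal_lt_ereal|rewrite /= lte_fin].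
have [n [n1 n2]] : exists n, `|m - simple_integral mu E (s n)| < e / 2 /\
    (\int[mu]_(t in E) (`|F t - simple_fun (s n) t|)%:E < (e / 2)%:E)%E.
  have [N _ h] := filterI near1 near2; exists N; exact: (h N (leqnn N)).
have n3 : `|b (simple_integral mu E (s n)) q'| < e / 2.
  by rewrite -lte_fin; exact: le_lt_trans (bound n) n2.
rewrite -[m](subrK (simple_integral mu E (s n))) (formDl b_form).
apply: le_trans (ler_normD _ _) _; rewrite [leRHS]splitr lerD ?(ltW n3) //.
by apply: le_trans (b_CS _ _) _; rewrite nq' mulr1 ltW.
Qed.

(** If [N > n] vectors of the range were independent, some nontrivial combination [m] of them would
    be orthogonal to all [v l], hence to every vector of the range, and so to itself. *)
Lemma rank_le (n : nat) (w : T -> V) (v : 'I_n -> V) (phi : T -> 'I_n -> R) :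
  (forall t, E t -> w t = \sum_l phi t l *: v l) ->
  (rank mu E w <= (n%:R)%:E)%E.
Proof.
move=> wE; apply: ub_ereal_sup => _ [N [e [eS eI]] <-].
rewrite lee_fin ler_nat leqNgt; apply/negP => nN.
(* More rows than columns: a nonzero left kernel vector gives the coefficients of [m]. *)
pose M : 'M[R]_(N, n) := \matrix_(i, l) b (e i) (v l).
have : kermx M != 0.
  rewrite -mxrank_eq0 mxrank_ker subn_eq0 -ltnNge.
  exact: leq_ltn_trans (rank_leq_col _) nN.
move=> /rowV0Pn[c /sub_kermxP cM c0].
pose m := \sum_i c 0 i *: e i.
have mv l : b m (v l) = 0.
  have /matrixP /(_ 0 l) := cM; rewrite !mxE => <-.
  by rewrite (form_suml b_form); apply: eq_bigr => i _; rewrite mxE (formZl b_form).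
have em i : b (e i) m = 0.
  have [phi' [_ _ he]] := eS i; apply: bochner_orthogonal he _ => t Et.
  rewrite (formZl b_form) wE // (form_suml b_form) big1 ?mulr0 // => l _.
  by rewrite (formZl b_form) (formC b_form) mv mulr0.
have /eI ci : m = 0.
  apply/eqP; rewrite -normr_eq0 -sqrf_eq0 -b_norm {1}/m (form_suml b_form).
  by rewrite big1 // => i _; rewrite (formZl b_form) em mulr0.
by move/negP: c0; apply; apply/eqP/rowP => i; rewrite ci mxE.
Qed.

End rank_bound.

(** * The Hilbert space of square-integrable functions *)

Section L2theory.
Context (d : measure_display) (T : measurableType d) (R : realType).
Variable mu : {measure set T -> \bar R}.
Local Notation L2 := (L2 mu).

Lemma L2fun_measurable (x : L2) : measurable_fun setT x.
Proof. by rewrite /L2fun; exact: measurable_funP. Qed.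

Lemma Lnorm2_sqr (f : T -> R) : measurable_fun setT f ->
  'N[mu]_2%:E[EFin \o f]%E = ((\int[mu]_t (f t ^+ 2)%:E) `^ 2^-1)%E.
Proof.
move=> mf; rewrite unlock; congr (_ `^ _)%E.
by apply: eq_integral => t _ /=; rewrite powR_mulrn // real_normK // num_real.
Qed.

Lemma L2_sqr_integral (x : L2) : (\int[mu]_t (x t ^+ 2)%:E = (`|x| ^+ 2)%:E)%E.
Proof.
have I0 : (0 <= \int[mu]_t (x t ^+ 2)%:E)%E.
  by apply: integral_ge0 => t _; rewrite lee_fin sqr_ge0.
rewrite /Num.Def.normr /= /L2norm -powR_mulrn; last exact: nrm2_ge0.
rewrite -poweR_EFin /nrm2 finite_norm_fine Lnorm2_sqr; last exact: L2fun_measurable.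
by rewrite -poweRrM mulVf // poweRe1.
Qed.

Lemma L2_sqr_integrable (x : L2) : mu.-integrable setT (fun t => (x t ^+ 2)%:E).
Proof.
apply/integrableP; split.
  by apply/measurable_EFinP; apply: measurable_funX; exact: L2fun_measurable.
rewrite (eq_integral (fun t => (x t ^+ 2)%:E)) ?L2_sqr_integral ?ltry //.
by move=> t _; rewrite gee0_abs // lee_fin sqr_ge0.
Qed.

Lemma L2_mk (f : T -> R) : measurable_fun setT f ->
  (\int[mu]_t (f t ^+ 2)%:E < +oo)%E -> exists x : L2, {ae mu, forall t, x t = f t}.
Proof.
move=> mf If.
have fL : f \in Lfun mu 2%:E.
  rewrite inE; apply/andP; split; first by rewrite inE.
  by rewrite inE /= /finite_norm Lnorm2_sqr // poweR_lty.
exists (\pi_L2 (Lfun_Sub (lee1n 2) fL)).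
exact: (L2ae_pi (Lfun_Sub (lee1n 2) fL)).
Qed.

Lemma L2_subE (x y : L2) : {ae mu, forall t, (x - y : L2) t = x t - y t}.
Proof.
have := L2ae_lin (-1) y x; rewrite scaleN1r addrC; apply: filterS => t ->.
by rewrite mulN1r addrC.
Qed.

Lemma L2_norm_ae (x : L2) (f : T -> R) : measurable_fun setT f ->
  {ae mu, forall t, x t = f t} -> (\int[mu]_t (f t ^+ 2)%:E = (`|x| ^+ 2)%:E)%E.
Proof.
move=> mf xf; rewrite -L2_sqr_integral; apply: ae_eq_integral => //.
- by apply/measurable_EFinP; exact: measurable_funX.
- by apply/measurable_EFinP; apply: measurable_funX; exact: L2fun_measurable.
- by apply: filterS xf => t -> _.
Qed.

Lemma L2_ext (x y : L2) : {ae mu, forall t, x t = y t} -> x = y.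
Proof.
move=> xy; apply/eqP; rewrite -subr_eq0 -normr_eq0 -sqrf_eq0; apply/eqP/EFin_inj.
rewrite -(@L2_norm_ae _ (fun=> 0)) //.
  by rewrite expr0n /= integral0.
by apply: filterS2 (L2_subE x y) xy => t -> ->; rewrite subrr.
Qed.

Lemma L2_mul_integrable (A : set T) (x y : L2) : measurable A ->
  mu.-integrable A (fun t => (x t * y t)%:E).
Proof.
move=> mA; apply: (@integrableS _ _ _ _ setT) => //.
apply: (@le_integrable _ _ _ _ _ measurableT _
    (fun t => (x t ^+ 2)%:E + (y t ^+ 2)%:E)%E).
- by apply/measurable_EFinP; apply: measurable_funM; exact: L2fun_measurable.
- move=> t _; rewrite -EFinD !abse_EFin lee_fin ler_norml.
  rewrite (ger0_norm (addr_ge0 (sqr_ge0 _) (sqr_ge0 _))).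
  have := sqr_ge0 (x t + y t); have := sqr_ge0 (x t - y t); have := sqr_ge0 (x t).
  have := sqr_ge0 (y t); move: (x t) (y t) => a b; nra.
- by apply: integrableD => //; exact: L2_sqr_integrable.
Qed.

Definition L2form (A : set T) (x y : L2) : R := \int[mu]_(t in A) (x t * y t).

Lemma L2form_sym (A : set T) : measurable A -> sym_bilinear (L2form A).
Proof.
move=> mA; split=> [x y|k x x' y].
  by apply: eq_Rintegral => t _; rewrite mulrC.
rewrite /L2form -RintegralZl //; last exact: L2_mul_integrable.
rewrite -RintegralD //; last exact: L2_mul_integrable.
  rewrite /Rintegral; congr fine; apply: ae_eq_integral => //.
  - by apply: measurable_int (L2_mul_integrable _ _ mA).
  - apply/measurable_EFinP; apply: measurable_funD; last first.
      by apply/measurable_EFinP; apply: measurable_int (L2_mul_integrable _ _ mA).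
    apply: measurable_funM => //.
    by apply/measurable_EFinP; apply: measurable_int (L2_mul_integrable _ _ mA).
  - by apply: filterS (L2ae_lin k x x') => t -> _; rewrite mulrDl mulrA.
rewrite [X in _.-integrable _ X](_ : _ = (fun t => k%:E * ((x : L2) t * (y : L2) t)%:E)%E) //.
by apply: integrableZl => //; exact: L2_mul_integrable.
Qed.

Lemma L2form_ge0 (A : set T) x : 0 <= L2form A x x.
Proof. by apply: Rintegral_ge0 => t _; rewrite -expr2 sqr_ge0. Qed.

(** Riesz-Fischer: a rapidly converging subsequence converges almost everywhere, and Fatou's lemma
    identifies its limit in norm. The finite measure lets the increments be summed in L^1. *)
Lemma L2_complete : (mu setT < +oo)%E -> seq_complete L2.
Proof.
move=> muT x cx.
have /choice[N NP] : forall k : nat, exists N, forall m n, (N <= m)%N -> (N <= n)%N ->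
    `|x m - x n| < (2^-1) ^+ k.
  by move=> k; apply: cx; rewrite exprn_gt0.
(* Partial sums of [N] dominate [N k] and are monotone in [k]. *)
pose n k := (\sum_(i < k.+1) N i)%N.
have nN k : (N k <= n k)%N by rewrite /n big_ord_recr /= leq_addl.
have nS k : (n k <= n k.+1)%N by rewrite /n [in leqRHS]big_ord_recr /= leq_addr.
have nmono : {homo n : i j / (i <= j)%N} by apply: homo_leq => //; exact: leq_trans.
pose z k : L2 := x (n k).
have zz k j : (k <= j)%N -> `|z j - z k| < (2^-1) ^+ k.
  by move=> kj; apply: NP; rewrite ?nN // (leq_trans (nN k)) ?nmono.
have mz k : measurable_fun setT (z k) by exact: L2fun_measurable.
pose D k t := z k.+1 t - z k t.
have mD k : measurable_fun setT (D k) by exact: measurable_funB.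
pose M := fine (mu setT).
have ME : mu setT = M%:E by rewrite fineK // ge0_fin_numE.
have M0 : 0 <= M by rewrite fine_ge0.
have diffE j k (e : R) : `|z j - z k| <= e -> 0 <= e ->
    (\int[mu]_t ((z j t - z k t) ^+ 2)%:E <= (e ^+ 2)%:E)%E.
  move=> h e0; rewrite (@L2_norm_ae (z j - z k)) ?lee_fin ?lerXn2r ?nnegrE //.
    exact: measurable_funB.
  exact: L2_subE.
(* [|D k| <= 2^k (D k)^2 + 2^-k] makes the increments summable in L^1. *)
have ID k : (\int[mu]_t (`|D k t|)%:E <= ((1 + M) * (2^-1) ^+ k)%:E)%E.
  apply: (@le_trans _ _ (\int[mu]_t ((2 ^+ k)%:E * (D k t ^+ 2)%:E + ((2^-1) ^+ k)%:E))%E).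
    apply: ge0_le_integral => //.
    - by apply/measurable_EFinP; exact: measurableT_comp.
    - apply: emeasurable_funD => //; apply: emeasurable_funM => //.
      by apply/measurable_EFinP; exact: measurable_funX.
    - move=> t _; rewrite -EFinM -EFinD lee_fin exprVn.
      have p0 : (0 : R) < 2 ^+ k by rewrite exprn_gt0.
      move: (2 ^+ k : R) p0 => p p0; rewrite -(real_normK (num_real (D k t))).
      have := sqr_ge0 (p * `|D k t| - 1) => /(mulr_ge0 (_ : 0 <= p^-1)).
      rewrite invr_ge0 ltW // => /(_ isT).
      rewrite (_ : p^-1 * _ = p * `|D k t| ^+ 2 + p^-1 - 2 * `|D k t|).
        by have := normr_ge0 (D k t); move: `|D k t| => a; move: (p * _) p^-1 => b c ? ?; lra.
      by field; rewrite gt_eqF.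
  rewrite ge0_integralD //; first last.
  - apply: emeasurable_funM => //.
    by apply/measurable_EFinP; exact: measurable_funX.
  - by move=> t _; rewrite -EFinM lee_fin mulr_ge0 ?sqr_ge0 ?exprn_ge0.
  rewrite ge0_integralZl_EFin ?exprn_ge0 //; first last.
  - by apply/measurable_EFinP; exact: measurable_funX.
  - by move=> t _; rewrite lee_fin sqr_ge0.
  rewrite integral_cst // ME -EFinM mulrDl mul1r EFinD [(M * _)%R]mulrC leeD //.
  have := diffE k.+1 k _ (ltW (zz k k.+1 (leqnSn k))) (exprn_ge0 _ _).
  rewrite invr_ge0 ler0n => /(_ isT) h.
  apply: le_trans (lee_wpmul2l _ h) _; first by rewrite lee_fin exprn_ge0.
  by rewrite -EFinM lee_fin expr2 mulrA -exprMn mulfV // expr1n mul1r.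
have Ifin : (\int[mu]_t (\sum_(k <oo) (`|D k t|)%:E) < +oo)%E.
  rewrite integral_nneseries //; last first.
    by move=> k; apply/measurable_EFinP; exact: measurableT_comp.
  apply: (@le_lt_trans _ _ (2 * (1 + M))%:E); last exact: ltry.
  apply: lime_le; first by apply: is_cvg_nneseries => k _ _; exact: integral_ge0.
  apply: nearW => m.
  apply: (@le_trans _ _ (\sum_(0 <= k < m) ((1 + M) * (2^-1) ^+ k)%:E)%E).
    by apply: lee_sum => k _; exact: ID.
  rewrite sumEFin lee_fin -mulr_sumr mulrC ler_wpM2r ?addr_ge0 //.
  suff -> : \sum_(0 <= k < m) (2^-1 : R) ^+ k = 2 - 2 * (2^-1) ^+ m.
    by rewrite gerBl mulr_ge0 ?exprn_ge0 // invr_ge0.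
  elim: m => [|m IH]; first by rewrite big_nil expr0 mulr1 subrr.
  by rewrite big_nat_recr //= IH exprS; field.
have mS : measurable_fun setT (fun t => \sum_(k <oo) (`|D k t|)%:E)%E.
  apply: (ge0_emeasurable_sum (P := predT)) => // k _.
  by apply/measurable_EFinP; exact: measurableT_comp.
have S0 t : (0 <= \sum_(k <oo) (`|D k t|)%:E)%E by exact: nneseries_ge0.
have aefin : {ae mu, forall t, setT t -> (\sum_(k <oo) (`|D k t|)%:E)%E \is a fin_num}.
  apply: integrable_ae => //; apply/integrableP; split => //.
  by under eq_integral do rewrite gee0_abs //.
(* The upper limit is measurable without any choice; [fine] only alters it where it is infinite, on
   a null set. *)
pose y t := fine (limn_esup (fun k => (z k t)%:E)).
have my : measurable_fun setT y.
  apply: measurableT_comp => //; apply: measurable_fun_limn_esup => k.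
  exact/measurable_EFinP.
have zy : {ae mu, forall t, z k t @[k --> \oo] --> y t}.
  apply: filterS aefin => t /(_ I) tfin.
  have cD : cvgn (series (fun k => D k t)).
    apply: normed_cvg; apply: nondecreasing_is_cvgn.
      by apply: nondecreasing_series => i _ _ /=.
    exists (fine (\sum_(k <oo) (`|D k t|)%:E)%E) => _ [k _ <-].
    rewrite -lee_fin fineK // /series /= -sumEFin.
    by apply: nneseries_lim_ge => i _ _; rewrite lee_fin.
  have cz : cvgn (fun k => z k t).
    have -> : (fun k => z k t) = (fun k => series (fun k => D k t) k + z 0%N t).
      apply/funext; elim=> [|k IH]; first by rewrite /series /= big_nil add0r.
      by rewrite /series /= big_nat_recr //= -[X in _ = X + _]addrC -addrA -IH /D subrK.
    by apply: is_cvgD => //; exact: is_cvg_cst.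
  have cz' := cz; move/cvg_ex: cz' => [l zl].
  have zlE : (z k t)%:E @[k --> \oo] --> l%:E by apply: cvg_EFin => //; exact: nearW.
  by rewrite /y (cvg_limn_einf_sup zlE).2 /=.
(* Fatou's lemma in [j], on the squared distances from [z j] to [z k]. *)
have yz k : (\int[mu]_t ((y t - z k t) ^+ 2)%:E <= (((2^-1) ^+ k) ^+ 2)%:E)%E.
  rewrite (ae_eq_integral (fun t => limn_einf (fun j => ((z j t - z k t) ^+ 2)%:E))) //.
  - apply: le_trans (fatou _ measurableT _ _) _.
    + by move=> j; apply/measurable_EFinP; apply: measurable_funX; exact: measurable_funB.
    + by move=> j t _; rewrite lee_fin sqr_ge0.
    rewrite limn_einf_lim; apply: lime_le; first exact: is_cvg_einfs.
    near=> j; apply: le_trans (_ : (\int[mu]_t ((z j t - z k t) ^+ 2)%:E <= _)%E).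
      by apply: ereal_inf_lbound; exists j => //=.
    apply: diffE; last by rewrite exprn_ge0 // invr_ge0.
    by apply: ltW; apply: zz; near: j; exact: nbhs_infty_ge.
  - by apply/measurable_EFinP; apply: measurable_funX; exact: measurable_funB.
  - apply: (measurableT_comp (f := oppe)) => //.
    apply: (measurable_fun_limn_esup (f := fun j t => (- ((z j t - z k t) ^+ 2)%:E)%E)) => j.
    apply: (measurableT_comp (f := oppe)) => //.
    by apply/measurable_EFinP; apply: measurable_funX; exact: measurable_funB.
  - apply: filterS zy => t zt _.
    suff /cvg_limn_einf_sup[-> _] : ((z j t - z k t) ^+ 2)%:E @[j --> \oo] --> ((y t - z k t) ^+ 2)%:E by [].
    apply: cvg_EFin; first exact: nearW.
    apply: (@cvg_comp _ _ _ _ (fun u : R => u ^+ 2)); last exact: exprn_continuous.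
    by apply: cvgB => //; exact: cvg_cst.
(* Square-integrability is available for [y - z 0], not directly for [y], so the limit is
   [w + z 0]. *)
have [w wE] : exists w : L2, {ae mu, forall t, w t = y t - z 0%N t}.
  apply: L2_mk; first exact: measurable_funB.
  exact: le_lt_trans (yz 0%N) (ltry _).
have wz k : `|z k - (w + z 0%N)| <= (2^-1) ^+ k.
  rewrite distrC -(@ler_pXn2r _ 2) ?nnegrE ?exprn_ge0 ?invr_ge0 // -lee_fin.
  rewrite -(@L2_norm_ae _ (fun t => y t - z k t)) //; first exact: measurable_funB.
  have := L2_subE (w + z 0%N) (z k); have := L2ae_lin 1 w (z 0%N); rewrite scale1r.
  apply: filterS3 wE => t -> -> ->.
  by rewrite mul1r subrK.
exists (w + z 0%N) => e e0.
have [k ke] : exists k : nat, (2^-1) ^+ k < e / 2 :> R.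
  have := @cvg_expr R 2^-1; rewrite gtr0_norm ?invr_gt0 // invf_lt1 // ltr1n => /(_ isT).
  move/cvgrPdist_lt => /(_ (e / 2)); rewrite divr_gt0 // => /(_ isT)[k _ /(_ k (leqnn k))] /=.
  by rewrite sub0r normrN gtr0_norm ?exprn_gt0 ?invr_gt0 //; exists k.
exists (n k) => m nkm; rewrite -[x m](subrK (z k)) -addrA.
apply: le_lt_trans (ler_normD _ _) _; rewrite [ltRHS]splitr ltrD //.
  by apply: lt_trans ke; apply: NP => //; exact: leq_trans (nN k) nkm.
by apply: le_lt_trans ke.
Unshelve. all: by end_near. Qed.

End L2theory.

(** * Weighted composition operators and reflections of the plane *)

Section weighted_composition.
Context (d : measure_display) (T : measurableType d) (R : realType).
Variable mu : {measure set T -> \bar R}.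
Variable r : T -> T.
Hypothesis mr : measurable_fun setT r.
Hypothesis mur : forall A, measurable A -> mu (r @^-1` A) = mu A.
Local Notation L2 := (L2 mu).

Lemma ae_comp (P : T -> Prop) : {ae mu, forall t, P t} -> {ae mu, forall t, P (r t)}.
Proof.
move=> [N [mN N0 PN]]; exists (r @^-1` N); split.
- by rewrite -[X in measurable X]setTI; exact: mr.
- by rewrite mur.
- by move=> t /= nP; exact: PN.
Qed.

Lemma integral_comp_invariant (A : set T) (f : T -> \bar R) : measurable A ->
  measurable_fun setT f -> mu.-integrable (r @^-1` A) (f \o r) ->
  (\int[mu]_(t in r @^-1` A) f (r t) = \int[mu]_(t in A) f t)%E.
Proof.
move=> mA mf intf; rewrite -(integral_pushforward mr mf intf mA).
by apply: eq_measure_integral => B mB _; exact: mur.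
Qed.

Lemma ge0_integral_comp_invariant (f : T -> \bar R) : measurable_fun setT f ->
  (forall t, (0 <= f t)%E) -> (\int[mu]_t f (r t) = \int[mu]_t f t)%E.
Proof.
move=> mf f0; rewrite -[LHS](ge0_integral_pushforward mr mu measurableT mf) //.
by apply: eq_measure_integral => B mB _; exact: mur.
Qed.

Variable w : T -> R.
Hypothesis mw : measurable_fun setT w.
Hypothesis w2 : forall t, w t ^+ 2 = 1.

(** One construction for two isometries: reflections ([w = 1]) and multiplication by a sign
    ([r = id]). *)
Lemma L2_wcomp : exists F : {linear L2 -> L2},
  (forall x : L2, {ae mu, forall t, (F x : L2) t = w t * x (r t)}) /\ (forall x, `|F x| = `|x|).
Proof.
have mf (x : L2) : measurable_fun setT (fun t => w t * x (r t)).
  by apply: measurable_funM => //; apply: (measurableT_comp (f := L2fun x)).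
have sq (x : L2) : (\int[mu]_t ((w t * x (r t)) ^+ 2)%:E = (`|x| ^+ 2)%:E)%E.
  under eq_integral do rewrite exprMn w2 mul1r.
  rewrite -L2_sqr_integral -(ge0_integral_comp_invariant (f := fun t => (x t ^+ 2)%:E)) //.
    by apply/measurable_EFinP; apply: measurable_funX; exact: L2fun_measurable.
  by move=> t; rewrite lee_fin sqr_ge0.
have /choice[F0 FE] : forall x : L2, exists y : L2,
    {ae mu, forall t, y t = w t * x (r t)}.
  by move=> x; apply: L2_mk => //; rewrite sq ltry.
have lin : linear F0.
  move=> k x y; apply: L2_ext.
  apply: filterS2 (L2ae_lin k (F0 x) (F0 y)) _ => [t -> h|]; first exact: h.
  apply: filterS2 (filterI (FE x) (FE y)) (filterI (FE (k *: x + y)) (ae_comp (L2ae_lin k x y))).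
  by move=> t [-> ->] [-> ->]; ring.
pose F : {linear L2 -> L2} := HB.pack F0 (GRing.isLinear.Build _ _ _ _ F0 lin).
exists F; split; first exact: FE.
move=> x; apply/eqP; rewrite -(@eqrXn2 _ 2) //; apply/eqP/EFin_inj.
rewrite -(sq x); apply/esym; apply: L2_norm_ae => //; exact: FE.
Qed.

End weighted_composition.

Section plane_reflections.
Variable R : realType.

Definition refl (a b : R) (p : R * R) : R * R := (a * p.1, b * p.2).

Lemma measurable_refl a b : measurable_fun setT (refl a b : plane R -> plane R).
Proof.
apply/measurable_fun_pairP; split.
  by apply: measurable_funM => //; exact: measurable_fst.
by apply: measurable_funM => //; exact: measurable_snd.
Qed.

Lemma lebesgue_scale_sign (a : R) (A : set (measurableTypeR R)) : a ^+ 2 = 1 ->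
  measurable A -> lebesgue_measure ((fun x => a * x) @^-1` A) = lebesgue_measure A.
Proof.
move=> /eqP; rewrite sqrf_eq1 => /orP[] /eqP-> mA.
  by congr lebesgue_measure; apply/seteqP; split=> x /=; rewrite mul1r.
rewrite -[RHS]lebesgue_measureN //; congr lebesgue_measure.
by apply/seteqP; split=> x /=; rewrite mulN1r.
Qed.

(** The pushforward agrees with [leb2] on rectangles, and product measures are unique. *)
Lemma leb2_refl a b (A : set (plane R)) : a ^+ 2 = 1 -> b ^+ 2 = 1 ->
  measurable A -> leb2 R (refl a b @^-1` A) = leb2 R A.
Proof.
move=> a2 b2 mA.
have mr := measurable_refl a b.
pose m : {measure set (measurableTypeR R * measurableTypeR R) -> \bar R} :=
  measure_function_pushforward__canonical__measure_function_Measure (leb2 R) mr.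
have E : forall X Y : set (measurableTypeR R), measurable X -> measurable Y ->
    m (X `*` Y) = (lebesgue_measure X * lebesgue_measure Y)%E.
  move=> X Y mX mY; rewrite /m /= /pushforward /leb2.
  rewrite (_ : _ @^-1` _ = ((fun x => a * x) @^-1` X) `*` ((fun x => b * x) @^-1` Y)) //.
  have ms (c : R) (Z : set (measurableTypeR R)) : measurable Z -> measurable ((fun x => c * x) @^-1` Z).
    by move=> mZ; rewrite -[X in measurable X]setTI; exact: measurable_funM.
  rewrite product_measure1E; [|exact: ms|exact: ms].
  by congr (_ * _)%E; exact: lebesgue_scale_sign.
exact/esym/(product_measure_unique E).
Qed.

Lemma refl_D a b : a ^+ 2 = 1 -> b ^+ 2 = 1 -> refl a b @^-1` (@D R) = @D R.
Proof.
have s c (x : R) : c ^+ 2 = 1 -> `](- 2^-1), 2^-1[%classic x ->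
    `](- 2^-1), 2^-1[%classic (c * x).
  move=> /eqP; rewrite sqrf_eq1 => /orP[] /eqP->; first by rewrite mul1r.
  by rewrite mulN1r /= !in_itv /= => /andP[? ?]; apply/andP; split; lra.
move=> a2 b2; apply/seteqP; split=> -[x y] [h1 h2]; split; last 2 first.
- exact: s.
- exact: s.
- by have := s a _ a2 h1; rewrite /= mulrA -expr2 a2 mul1r.
- by have := s b _ b2 h2; rewrite /= mulrA -expr2 b2 mul1r.
Qed.

Lemma lebD_refl a b (A : set (plane R)) : a ^+ 2 = 1 -> b ^+ 2 = 1 ->
  measurable A -> lebD R (refl a b @^-1` A) = lebD R A.
Proof.
move=> a2 b2 mA; rewrite /lebD /= /mrestr -[in LHS](refl_D a2 b2) -preimage_setI.
by apply: leb2_refl => //; apply: measurableI => //; exact: measurable_D.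
Qed.

Definition axis1 : set (plane R) := [set p | p.1 = 0].
Definition axis2 : set (plane R) := [set p | p.2 = 0].

Lemma axes_null : [/\ measurable axis1, measurable axis2,
  leb2 R axis1 = 0%E & leb2 R axis2 = 0%E].
Proof.
have m0 : measurable ([set 0] : set (measurableTypeR R)) by exact: measurable_set1.
have -> : axis1 = [set 0] `*` setT by apply/seteqP; split=> [p /= ->|p []].
have -> : axis2 = setT `*` [set 0] by apply/seteqP; split=> [p /= ->|p []].
split; [exact: measurableX|exact: measurableX| |].
  apply: etrans (product_measure1E _ _ m0 measurableT) _.
  by rewrite [X in (X * _)%E](_ : _ = 0%E) ?mul0e //; exact: lebesgue_measure_set1.
apply: etrans (product_measure1E _ _ measurableT m0) _.
by rewrite [X in (_ * X)%E](_ : _ = 0%E) ?mule0 //; exact: lebesgue_measure_set1.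
Qed.

Lemma leb2_axes (A : set (plane R)) :
  A `<=` axis1 `|` axis2 -> measurable A -> leb2 R A = 0%E.
Proof.
have [m1 m2 z1 z2] := axes_null => Asub mA.
apply/eqP; rewrite eq_le measure_ge0 andbT.
apply: le_trans (le_measure _ _ _ Asub) _; rewrite ?inE //; first exact: measurableU.
apply: (@le_trans _ _ (leb2 R axis1 + leb2 R axis2)%E); first exact: measureU2.
by rewrite z1 z2 adde0.
Qed.

Lemma lebD_fin : (lebD R setT < +oo)%E.
Proof.
pose I : set (measurableTypeR R) := `](- 2^-1), 2^-1[%classic.
have mI : measurable I by exact: measurable_itv.
have LI : (lebesgue_measure I < +oo)%E.
  by rewrite /I lebesgue_measure_itv /=; case: ifP => _; rewrite -?EFinB ltry.
have E : leb2 R (@D R) = (lebesgue_measure I * lebesgue_measure I)%E.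
  exact: product_measure1E.
rewrite /lebD /= /mrestr setTI.
apply: le_lt_trans (_ : ((lebesgue_measure I * lebesgue_measure I) < +oo)%E); first by rewrite E.
by apply: lte_mul_pinfty => //; rewrite ge0_fin_numE.
Qed.

Lemma ae_off_axes : {ae lebD R, forall p, [/\ D p, p.1 != 0 & p.2 != 0]}.
Proof.
have [m1 m2 _ _] := axes_null.
exists (~` (@D R) `|` (axis1 `|` axis2)); split.
- apply: measurableU; first by apply: measurableC; exact: measurable_D.
  exact: measurableU.
- rewrite /lebD /= /mrestr; apply: leb2_axes; first by move=> p [[nD|h] //].
  apply: measurableI; last exact: measurable_D.
  apply: measurableU; first by apply: measurableC; exact: measurable_D.
  exact: measurableU.
move=> [x y] /=; have [Dp|nD] := pselect (D (x, y)); last by left.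
have [->|x0] := eqVneq x 0; first by move=> _; right; left.
have [->|y0] := eqVneq y 0; first by move=> _; right; right.
by move=> h; exfalso; exact: h.
Qed.

End plane_reflections.

(** * Smooth multipliers *)

Section smooth.
Variable R : realType.
Implicit Types phi psi : R * R -> R.

Lemma Ck_continuous k phi : Ck k phi -> continuous phi.
Proof. by case: k => [|k] []. Qed.

Lemma CkW k phi : Ck k.+1 phi -> Ck k phi.
Proof.
elim: k phi => [|k IH] phi [c [d1 d2 h1 h2]]; first by split.
split; [exact: c|split; [exact: d1|exact: d2|exact: (IH _ h1)|exact: (IH _ h2)]].
Qed.

Lemma Ck_cst k (a : R) : Ck k (fun=> a).
Proof.
elim: k a => [|k IH] a; split=> //; first exact: cst_continuous.
  exact: cst_continuous.
split; [by move=> p; exact: derivable_cst|by move=> p; exact: derivable_cst| |].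
  rewrite (_ : pd1 _ = fun=> 0); first exact: IH.
  by apply/funext => p; rewrite /pd1 derive1_cst.
rewrite (_ : pd2 _ = fun=> 0); first exact: IH.
by apply/funext => p; rewrite /pd2 derive1_cst.
Qed.

Lemma pd1_mul phi psi p :
  derivable (fun s => phi (s, p.2)) p.1 1 -> derivable (fun s => psi (s, p.2)) p.1 1 ->
  derivable (fun s => phi (s, p.2) * psi (s, p.2)) p.1 1 /\
  pd1 (fun p => phi p * psi p) p = phi p * pd1 psi p + psi p * pd1 phi p.
Proof.
case: p => x y /= d1 d2; rewrite /pd1 /= !derive1E.
by split; [exact: (derivableM d1 d2)|exact: (deriveM d1 d2)].
Qed.

Lemma pd2_mul phi psi p :
  derivable (fun s => phi (p.1, s)) p.2 1 -> derivable (fun s => psi (p.1, s)) p.2 1 ->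
  derivable (fun s => phi (p.1, s) * psi (p.1, s)) p.2 1 /\
  pd2 (fun p => phi p * psi p) p = phi p * pd2 psi p + psi p * pd2 phi p.
Proof.
case: p => x y /= d1 d2; rewrite /pd2 /= !derive1E.
by split; [exact: (derivableM d1 d2)|exact: (deriveM d1 d2)].
Qed.

Lemma Ck_mul k phi psi : Ck k phi -> Ck k psi -> Ck k (fun p => phi p * psi p).
Proof.
elim: k phi psi => [|k IH] phi psi h1 h2; have c1 := Ck_continuous h1;
  have c2 := Ck_continuous h2.
  by split=> // p; apply: cvgM; [exact: c1|exact: c2].
split; first by move=> p; apply: cvgM; [exact: c1|exact: c2].
have w1 := CkW h1; have w2 := CkW h2.
case: h1 => _ [a1 b1 e1 f1]; case: h2 => _ [a2 b2 e2 f2].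
split.
- by move=> p; case: (pd1_mul (a1 p) (a2 p)).
- by move=> p; case: (pd2_mul (b1 p) (b2 p)).
- rewrite (_ : pd1 _ = 1 \*: (fun p => phi p * pd1 psi p) \+ (fun p => psi p * pd1 phi p)).
    by apply: Ck_lin; exact: IH.
  by apply/funext => p /=; rewrite scale1r; case: (pd1_mul (a1 p) (a2 p)).
- rewrite (_ : pd2 _ = 1 \*: (fun p => phi p * pd2 psi p) \+ (fun p => psi p * pd2 phi p)).
    by apply: Ck_lin; exact: IH.
  by apply/funext => p /=; rewrite scale1r; case: (pd2_mul (b1 p) (b2 p)).
Qed.

Lemma test_mul m phi : (forall k, Ck k m) -> test_function phi ->
  test_function (fun p => m p * phi p).
Proof.
move=> cm [cphi [K hK phi0]]; split; first by move=> k; exact: Ck_mul.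
by exists K => // p nK; rewrite phi0 // mulr0.
Qed.

Lemma derive1_scale_arg (f : R -> R) a x : derivable f (a * x) 1 ->
  derivable (fun s => f (a * s)) x 1 /\
  derive1 (fun s => f (a * s)) x = a * derive1 f (a * x).
Proof.
move=> df; rewrite !derive1E.
have [d e] : is_derive x 1 (fun s => f (a * s)) (a * 'D_1 f (a * x)).
  have h1 : is_derive (a * x) 1 f ('D_1 f (a * x)) by exact: derivableP.
  have h2 : is_derive x 1 (fun s : R => a * s) a.
    by apply: is_derive_eq; rewrite /GRing.scale /= mulr1.
  have := is_derive1_comp (f := f) (g := fun s => a * s) h1 h2.
  by rewrite mulrC.
by split.
Qed.

Lemma pd1_refl a b phi p : derivable (fun s => phi (s, b * p.2)) (a * p.1) 1 ->
  derivable (fun s => phi (refl a b (s, p.2))) p.1 1 /\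
  pd1 (phi \o refl a b) p = a * pd1 phi (refl a b p).
Proof. exact: derive1_scale_arg. Qed.

Lemma pd2_refl a b phi p : derivable (fun s => phi (a * p.1, s)) (b * p.2) 1 ->
  derivable (fun s => phi (refl a b (p.1, s))) p.2 1 /\
  pd2 (phi \o refl a b) p = b * pd2 phi (refl a b p).
Proof. exact: (@derive1_scale_arg (fun s => phi (a * p.1, s))). Qed.

Lemma refl_continuous a b : continuous (@refl R a b).
Proof.
move=> p; apply: (@cvg_pair _ _ _ _ (nbhs (a * p.1)) (nbhs (b * p.2))).
  by apply: cvgM; [exact: cvg_cst|exact: cvg_fst].
by apply: cvgM; [exact: cvg_cst|exact: cvg_snd].
Qed.

Lemma Ck_refl a b k phi : Ck k phi -> Ck k (phi \o refl a b).
Proof.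
have cont phi' : continuous phi' -> continuous (phi' \o refl a b).
  by move=> c p; apply: continuous_comp; [exact: refl_continuous|exact: c].
elim: k phi => [|k IH] phi [c h]; split=> //; try exact: cont.
case: h => a1 b1 e1 f1; split.
- by move=> p; case: (@pd1_refl a b phi p (a1 (refl a b p))).
- by move=> p; case: (@pd2_refl a b phi p (b1 (refl a b p))).
- rewrite (_ : pd1 _ = (fun p => a * (pd1 phi \o refl a b) p)).
    by apply: Ck_mul; [exact: Ck_cst|exact: IH].
  by apply/funext => p; case: (@pd1_refl a b phi p (a1 (refl a b p))).
- rewrite (_ : pd2 _ = (fun p => b * (pd2 phi \o refl a b) p)).
    by apply: Ck_mul; [exact: Ck_cst|exact: IH].
  by apply/funext => p; case: (@pd2_refl a b phi p (b1 (refl a b p))).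
Qed.

Lemma refl_involutive a b : a ^+ 2 = 1 -> b ^+ 2 = 1 -> involutive (@refl R a b).
Proof. by move=> a2 b2 [x y]; rewrite /refl /= !mulrA -!expr2 a2 b2 !mul1r. Qed.

Lemma test_refl a b phi : a ^+ 2 = 1 -> b ^+ 2 = 1 ->
  test_function phi -> test_function (phi \o refl a b).
Proof.
move=> a2 b2 [cphi [K [cK KD] phi0]]; have rK := refl_involutive a2 b2.
split; first by move=> k; exact: Ck_refl.
exists (refl a b @` K).
  split.
    apply: continuous_compact => //; apply: continuous_subspaceT; exact: refl_continuous.
  by move=> _ [p /KD Dp <-]; rewrite -(refl_D a2 b2) /preimage /= rK.
by move=> p nK; rewrite /= phi0 // => Kp; apply: nK; exists (refl a b p) => //; exact: rK.
Qed.

(* Solves s' = s (1 - s), whence its smoothness; 2 logistic(n y) - 1 = tanh(n y / 2)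
   tends to the sign of y. *)
Definition logistic (t : R) : R := (1 + expR (- t))^-1.

Lemma logistic_den (t : R) : 0 < 1 + expR (- t).
Proof. by rewrite addr_gt0 ?expR_gt0. Qed.

Lemma logisticN t : logistic (- t) = 1 - logistic t.
Proof.
rewrite /logistic opprK expRN; have := expR_gt0 t; move: (expR t) => e e0.
by field; rewrite !gt_eqF //; lra.
Qed.

Lemma logistic_gt0 t : 0 < logistic t.
Proof. by rewrite invr_gt0 logistic_den. Qed.

Lemma logistic_lt1 t : logistic t < 1.
Proof. by have := logistic_gt0 (- t); rewrite logisticN subr_gt0. Qed.

Lemma logistic_derive (c t : R) :
  is_derive t 1 (fun s => logistic (c * s)) (c * (logistic (c * t) * (1 - logistic (c * t)))).
Proof.
have d0 : 1 + expR (- (c * t)) != 0 by rewrite gt_eqF ?logistic_den.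
have h : is_derive t 1 (fun s : R => 1 + expR (- (c * s))) (- c * expR (- (c * t))).
  have h1 : is_derive t 1 (fun s : R => - (c * s)) (- c).
    by apply: is_derive_eq; rewrite /GRing.scale /= mulr1.
  have h2 : is_derive (- (c * t)) 1 expR (expR (- (c * t))) by exact: is_derive_expR.
  have h3 := is_derive1_comp (f := expR) (g := fun s => - (c * s)) h2 h1.
  by apply: is_derive_eq; rewrite add0r mul1r mulrC.
have h' := is_deriveV (f := fun s : R => 1 + expR (- (c * s))) d0 h.
rewrite /logistic; apply: is_derive_eq.
rewrite /GRing.scale /=; move: d0; move: (expR _) => e e0; field.
by rewrite e0.
Qed.
End smooth.

(** * Smooth approximation of the sign *)

Section soft_sign.
Variable R : realType.
Implicit Types t y : R.

Definition logistic_slope t : R := logistic t * (1 - logistic t).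

(** By symmetry [t >= 0], where the slope is at most 1 / (1 + e^t); the quadratic bound uses e^t >=
    (1 + t/2)^2. The linear weight will give domination, the quadratic one a rate 1/n. *)
Lemma logistic_slope_bound t :
  [/\ 0 <= logistic_slope t, `|t| * logistic_slope t <= 1 & t ^+ 2 * logistic_slope t <= 4].
Proof.
have l0 := logistic_gt0 t; have l1 := logistic_lt1 t.
have q0 : 0 <= logistic_slope t by rewrite mulr_ge0; lra.
wlog t0 : t l0 l1 q0 / 0 <= t.
  move=> H; have [|t0] := leP 0 t; first exact: H.
  have := H (- t); rewrite normrN sqrrN /logistic_slope logisticN opprB addrCA subrr addr0.
  by rewrite (mulrC (1 - _)); apply => //; lra.
rewrite ger0_norm //.
have E1 := expR_ge1Dx t; have E2 := expR_ge1Dx (t / 2).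
have E3 : expR t = expR (t / 2) * expR (t / 2) by rewrite -expRD -splitr.
have qE : logistic_slope t <= (1 + expR t)^-1.
  by rewrite /logistic_slope -logisticN {2}/logistic opprK -[leRHS]mul1r ler_wpM2r ?(ltW l1) //.
have d0 : 0 < 1 + expR t by rewrite addr_gt0 ?expR_gt0.
split => //.
  apply: le_trans (ler_wpM2l t0 qE) _; rewrite ler_pdivrMr //; lra.
apply: le_trans (ler_wpM2l (sqr_ge0 t) qE) _; rewrite ler_pdivrMr // E3.
by move: E2; move: (expR (t / 2)) => a E2; nra.
Qed.

Lemma logistic_tail t : 0 <= t -> t * (1 - logistic t) <= 1.
Proof.
move=> t0; rewrite -logisticN /logistic opprK; have := expR_ge1Dx t => h.
by rewrite ler_pdivrMr; lra.
Qed.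

(** The value 1 at 0 keeps [sg y ^+ 2 = 1] everywhere, as the weight of [L2_wcomp] requires. *)
Definition sg y : R := if 0 <= y then 1 else -1.
Definition soft_sign (n : nat) y : R := 2 * logistic (n.+1%:R * y) - 1.
Definition soft_slope (n : nat) y : R := 2 * n.+1%:R * logistic_slope (n.+1%:R * y).

Lemma sg_sqr y : sg y ^+ 2 = 1.
Proof. by rewrite /sg; case: ifP => _; rewrite ?sqrrN expr1n. Qed.

Lemma soft_sign_le1 n y : `|soft_sign n y| <= 1.
Proof.
have := logistic_gt0 (n.+1%:R * y); have := logistic_lt1 (n.+1%:R * y).
by rewrite /soft_sign ler_norml => ? ?; apply/andP; split; lra.
Qed.

Lemma soft_sign_dist n y : `|sg y - soft_sign n y| <= 2 /\
  (y != 0 -> `|sg y - soft_sign n y| <= 2 / `|y| / n.+1%:R).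
Proof.
split.
  apply: le_trans (ler_normB _ _) _; have := soft_sign_le1 n y.
  have : `|sg y| = 1 by rewrite /sg; case: ifP => _; rewrite ?normrN normr1.
  by move=> ->; lra.
move=> y0; have n0 : 0 < n.+1%:R :> R by rewrite ltr0n.
have ay : 0 < `|y| by rewrite normr_gt0.
rewrite ler_pdivlMr // ler_pdivlMr //.
rewrite /sg /soft_sign; case: (leP 0 y) => ys.
  have := logistic_tail (mulr_ge0 (ltW n0) ys).
  have l1 := logistic_lt1 (n.+1%:R * y); rewrite (ger0_norm ys) ger0_norm; nra.
have ys' : 0 <= - y by lra.
have := logistic_tail (mulr_ge0 (ltW n0) ys').
rewrite mulrN logisticN; have l0 := logistic_gt0 (n.+1%:R * y).
rewrite (ltr0_norm ys) ltr0_norm; nra.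
Qed.

(** The factor [|y|] will come from the vanishing of an odd function on the axis. One bound is
    uniform in [n], the other tends to 0 off the axis. *)
Lemma soft_slope_bound n y : [/\ 0 <= soft_slope n y, `|y| * soft_slope n y <= 2 &
  (y != 0 -> `|y| * soft_slope n y <= 8 / `|y| / n.+1%:R)].
Proof.
have n0 : 0 < n.+1%:R :> R by rewrite ltr0n.
have [q0 q1 q2] := logistic_slope_bound (n.+1%:R * y).
rewrite normrM (gtr0_norm n0) in q1; rewrite exprMn in q2.
rewrite /soft_slope; move: (logistic_slope _) q0 q1 q2 => q q0 q1 q2.
split; [by rewrite !mulr_ge0 // ltW|by nra|move=> y0].
have ay : 0 < `|y| by rewrite normr_gt0.
rewrite -(real_normK (num_real y)) in q2.
by rewrite ler_pdivlMr // ler_pdivlMr //; nra.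
Qed.

Lemma soft_sign_derive n y :
  derivable (soft_sign n) y 1 /\ derive1 (soft_sign n) y = soft_slope n y.
Proof.
have h := logistic_derive n.+1%:R y.
have h' : is_derive y 1 (soft_sign n) (soft_slope n y).
  apply: is_derive_eq; rewrite /GRing.scale /= /soft_slope /logistic_slope.
  by ring.
by rewrite derive1E; case: h' => ? ->.
Qed.

(** Oddness forces [g 0 = 0], and the mean value theorem does the rest; this replaces a vanishing
    trace. *)
Lemma odd_lipschitz (g : R -> R) (L y : R) : (forall s, derivable g s 1) ->
  (forall s, g (- s) = - g s) -> (forall s, - 2^-1 < s < 2^-1 -> `|derive1 g s| <= L) ->
  - 2^-1 < y < 2^-1 -> `|g y| <= L * `|y|.
Proof.
move=> dg og bg; wlog y0 : y / 0 <= y.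
  move=> H yb; have [y0|y0] := leP 0 y; first exact: H.
  by rewrite -normrN -og -(normrN y); apply: H; lra.
move=> yb; have g0 : g 0 = 0 by have := og 0; rewrite oppr0; lra.
have [c cy E] : exists2 c, c \in `[0, y]%R & g y - g 0 = derive1 g c * (y - 0).
  apply: MVT_segment => //.
    by move=> x _; rewrite derive1E; apply: derivableP.
  apply: continuous_subspaceT => x.
  by apply: differentiable_continuous; apply/derivable1_diffP.
rewrite -[g y]subr0 -{1}g0 E normrM subr0 ler_wpM2r // bg //.
by move: cy; rewrite in_itv /= => /andP[? ?]; apply/andP; split; lra.
Qed.

End soft_sign.

(** * Smoothness of the approximate sign and convergence in L^2(D) *)

Section coordinate_sign.
Variable R : realType.
Implicit Types phi psi : R * R -> R.
Local Notation L2D := (L2 (lebD R)).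

(* [e = true] stands for the second coordinate. *)
Definition crd (e : bool) (p : R * R) : R := if e then p.2 else p.1.

(** The induction closes because the derivative is a polynomial in the function itself. *)
Lemma Ck_logistic e c k : Ck k (fun p => logistic (c * crd e p)).
Proof.
have cont : continuous (fun p : R * R => logistic (c * crd e p)).
  have cl : continuous (fun s : R => logistic (c * s)).
    move=> s; apply: differentiable_continuous; apply/derivable1_diffP.
    by case: (logistic_derive c s).
  move=> p; apply: (@continuous_comp _ _ _ (crd e) (fun s => logistic (c * s))); last exact: cl.
  by rewrite /crd; case: e; [exact: cvg_snd|exact: cvg_fst].
elim: k => [|k IH]; first by split.
have slope : Ck k (fun p => c * (logistic (c * crd e p) * (1 - logistic (c * crd e p)))).
  apply: Ck_mul; first exact: Ck_cst.
  apply: Ck_mul => //.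
  rewrite (_ : (fun p => _) = -1 \*: (fun p => logistic (c * crd e p)) \+ (fun=> 1)).
    by apply: Ck_lin => //; exact: Ck_cst.
  by apply/funext => p /=; rewrite scaleN1r addrC.
have D s : derivable (fun s => logistic (c * s)) s 1 /\
    derive1 (fun s => logistic (c * s)) s = c * (logistic (c * s) * (1 - logistic (c * s))).
  by rewrite derive1E; case: (logistic_derive c s) => ? ->.
split; first exact: cont.
split.
- by move=> p; rewrite /crd; case: e {IH slope cont} => /=; [exact: derivable_cst|case: (D p.1)].
- by move=> p; rewrite /crd; case: e {IH slope cont} => /=; [case: (D p.2)|exact: derivable_cst].
- case: e IH slope {cont} => IH slope.
    rewrite (_ : pd1 _ = fun=> 0); first exact: Ck_cst.
    by apply/funext => p; rewrite /pd1 /crd /= derive1_cst.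
  rewrite (_ : pd1 _ = fun p => c * (logistic (c * crd false p) * (1 - logistic (c * crd false p)))); first exact: slope.
  by apply/funext => p; rewrite /pd1 /crd /=; case: (D p.1).
- case: e IH slope {cont} => IH slope.
    rewrite (_ : pd2 _ = fun p => c * (logistic (c * crd true p) * (1 - logistic (c * crd true p)))); first exact: slope.
    by apply/funext => p; rewrite /pd2 /crd /=; case: (D p.2).
  rewrite (_ : pd2 _ = fun=> 0); first exact: Ck_cst.
  by apply/funext => p; rewrite /pd2 /crd /= derive1_cst.
Qed.

Lemma Ck_soft_sign e n k : Ck k (fun p => soft_sign n (crd e p)).
Proof.
rewrite (_ : (fun p => _) = 2 \*: (fun p => logistic (n.+1%:R * crd e p)) \+ (fun=> -1)) //.
by apply: Ck_lin; [exact: Ck_logistic|exact: Ck_cst].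
Qed.

Lemma pd1_soft_sign e n p :
  derivable (fun s => soft_sign n (crd e (s, p.2))) p.1 1 /\
  pd1 (fun p => soft_sign n (crd e p)) p = if e then 0 else soft_slope n p.1.
Proof.
case: e; rewrite /pd1 /=; last exact: soft_sign_derive.
by rewrite derive1_cst; split => //; exact: derivable_cst.
Qed.

Lemma pd2_soft_sign e n p :
  derivable (fun s => soft_sign n (crd e (p.1, s))) p.2 1 /\
  pd2 (fun p => soft_sign n (crd e p)) p = if e then soft_slope n p.2 else 0.
Proof.
case: e; rewrite /pd2 /=; first exact: soft_sign_derive.
by rewrite derive1_cst; split => //; exact: derivable_cst.
Qed.

Lemma bounded_on_D (g : R * R -> R) : continuous g ->
  exists2 C, 0 <= C & forall p, D p -> `|g p| <= C.
Proof.
move=> cg; pose Q : set (R * R) := `[(- 2^-1), 2^-1] `*` `[(- 2^-1), 2^-1].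
have cQ : compact Q by apply: compact_setX; exact: segment_compact.
have /compact_bounded [M [_ HM]] : compact (g @` Q).
  by apply: continuous_compact => //; exact: continuous_subspaceT.
exists (`|M| + 1); first by rewrite addr_ge0.
move=> [x y] [/= xD yD]; apply: (HM (`|M| + 1)).
  by rewrite (le_lt_trans (ler_norm M)) // ltrDl.
exists (x, y) => //; split => /=; move: xD yD; rewrite !in_itv /= => /andP[? ?] /andP[? ?];
  by apply/andP; split; exact: ltW.
Qed.

Lemma L2_mk_bounded (g : plane R -> R) (C : R) : measurable_fun setT g ->
  (forall p, D p -> `|g p| <= C) -> exists x : L2D, {ae lebD R, forall p, x p = g p}.
Proof.
move=> mg gC; apply: L2_mk => //.
apply: (@le_lt_trans _ _ (\int[lebD R]_p (C ^+ 2)%:E)%E).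
  apply: ae_ge0_le_integral => //.
  - by move=> p _; rewrite lee_fin sqr_ge0.
  - by apply/measurable_EFinP; exact: measurable_funX.
  - by move=> p _; rewrite lee_fin sqr_ge0.
  - apply: filterS (ae_off_axes R) => p [Dp _ _] _; rewrite lee_fin.
    rewrite -(real_normK (num_real (g p))) lerXn2r ?nnegrE //; last exact: gC.
    exact: le_trans (gC _ Dp).
rewrite integral_cst //; apply: lte_mul_pinfty => //; first by rewrite lee_fin sqr_ge0.
exact: lebD_fin.
Qed.

Lemma graph_exists psi : test_function psi -> exists t : L2D * L2D * L2D, [/\
  {ae lebD R, forall p, t.1.1 p = psi p},
  {ae lebD R, forall p, t.1.2 p = pd1 psi p} &
  {ae lebD R, forall p, t.2 p = pd2 psi p}].
Proof.
move=> [/(_ 1%N) [c0 [_ _ [c1 _] [c2 _]]] _].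
have mk g : continuous g -> exists x : L2D, {ae lebD R, forall p, x p = g p}.
  move=> cg; have [C _ gC] := bounded_on_D cg.
  by apply: L2_mk_bounded gC; exact: continuous_plane_measurable.
have [x0 h0] := mk _ c0; have [x1 h1] := mk _ c1; have [x2 h2] := mk _ c2.
by exists (x0, x1, x2).
Qed.

Lemma ae_sqr_cvg (g : nat -> plane R -> R) :
  (forall p, D p -> p.1 != 0 -> p.2 != 0 -> exists K, forall n, `|g n p| <= K / n.+1%:R) ->
  {ae lebD R, forall p, setT p -> (g n p ^+ 2)%:E @[n --> \oo] --> 0%E}.
Proof.
move=> g0; apply: filterS (ae_off_axes R) => p [Dp p1 p2] _.
have [K gK] := g0 p Dp p1 p2.
have gc : g n p @[n --> \oo] --> 0.
  have Kc : K / n.+1%:R @[n --> \oo] --> 0.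
    rewrite -[X in _ --> X](mulr0 K); apply: cvgM; first exact: cvg_cst.
    exact: cvg_harmonic.
  apply: norm_cvg0; apply: (squeeze_cvgr (f := cst 0) (h := fun n => K / n.+1%:R)) => //.
    by apply: nearW => n; rewrite normr_ge0 gK.
  exact: cvg_cst.
apply: cvg_EFin; first exact: nearW.
rewrite -[X in _ --> X](expr0n R 2).
by apply: (@cvg_comp _ _ _ _ (fun u : R => u ^+ 2) _ _ _ gc); exact: exprn_continuous.
Qed.

Lemma integrable_cst_lebD (C : R) : (lebD R).-integrable setT (fun=> C%:E).
Proof.
apply/integrableP; split => //.
rewrite integral_cst //; apply: lte_mul_pinfty => //; exact: lebD_fin.
Qed.

Lemma ae_sqr_le (g : nat -> plane R -> R) (C : R) :
  (forall n p, D p -> `|g n p| <= C) ->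
  {ae lebD R, forall p n, setT p -> (`|(g n p ^+ 2)%:E| <= (C ^+ 2)%:E)%E}.
Proof.
move=> gC; apply: filterS (ae_off_axes R) => p [Dp _ _] n _.
rewrite lee_fin normrX lerXn2r ?nnegrE //; last exact: gC.
exact: le_trans (gC n _ Dp).
Qed.

(** Dominated convergence: constants are integrable on [D], and the rate [K] may depend on the
    point, the axes being null. *)
Lemma L2_cvg0 (x : nat -> L2D) (g : nat -> plane R -> R) (C : R) :
  (forall n, measurable_fun setT (g n)) ->
  (forall n, {ae lebD R, forall p, x n p = g n p}) ->
  (forall n p, D p -> `|g n p| <= C) ->
  (forall p, D p -> p.1 != 0 -> p.2 != 0 -> exists K, forall n, `|g n p| <= K / n.+1%:R) ->
  `|x n| @[n --> \oo] --> 0.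
Proof.
move=> mg xg gC g0.
have msq n : measurable_fun setT (fun p => (g n p ^+ 2)%:E).
  by apply/measurable_EFinP; exact: measurable_funX.
have [_ _ cv] := @dominated_convergence _ _ _ (lebD R) setT measurableT
  (fun n p => (g n p ^+ 2)%:E) (fun=> 0%E) (fun=> (C ^+ 2)%:E) msq (measurable_cst _)
  ltac:(exact: (ae_sqr_cvg g0)) ltac:(exact: integrable_cst_lebD) ltac:(exact: (ae_sqr_le gC)).
rewrite integral0 in cv.
have nE n : (\int[lebD R]_p (g n p ^+ 2)%:E = (`|x n| ^+ 2)%:E)%E by exact: L2_norm_ae.
apply/cvgr0Pnorm_lt => e e0; move: cv => /(_ [set x | (x < (e ^+ 2)%:E)%E]).
case.
  apply: open_nbhs_nbhs; split; first exact: open_ereal_lt_ereal.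
  by rewrite /= lte_fin exprn_gt0.
move=> N _ h; exists N => // n /h /=; rewrite nE lte_fin normr_id.
by rewrite ltr_pXn2r // ?nnegrE // ltW.
Qed.

End coordinate_sign.

(** * Multiplying odd test functions by the sign of a coordinate *)

Section sign_multiplication.
Variable R : realType.
Implicit Types phi psi : R * R -> R.
Local Notation L2D := (L2 (lebD R)).

Definition flip_sign1 (e : bool) : R := if e then 1 else -1.
Definition flip_sign2 (e : bool) : R := if e then -1 else 1.

Lemma flip_sign1_sqr e : flip_sign1 e ^+ 2 = 1.
Proof. by case: e; rewrite /flip_sign1 ?sqrrN expr1n. Qed.
Lemma flip_sign2_sqr e : flip_sign2 e ^+ 2 = 1.
Proof. by case: e; rewrite /flip_sign2 ?sqrrN expr1n. Qed.

(* Reverses the coordinate [crd e]. *)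
Definition flip (e : bool) : R * R -> R * R := refl (flip_sign1 e) (flip_sign2 e).

Lemma norm_triple_lt (t : L2D * L2D * L2D) (r : R) :
  `|t.1.1| < r -> `|t.1.2| < r -> `|t.2| < r -> `|t| < r.
Proof.
by move=> h1 h2 h3; rewrite prod_normE gt_max h3 andbT prod_normE gt_max h1 h2.
Qed.

Lemma norm_triple_ge (t : L2D * L2D * L2D) :
  [/\ `|t.1.1| <= `|t|, `|t.1.2| <= `|t| & `|t.2| <= `|t|].
Proof.
rewrite [`|t|]prod_normE [`|t.1|]prod_normE.
by split; rewrite !le_max lexx ?orbT.
Qed.

Lemma closureP (A : set (L2D * L2D * L2D)) t :
  closure A t <-> forall r, 0 < r -> exists2 s, A s & `|t - s| < r.
Proof.
split=> [h r r0|h B].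
  have [s [As Bs]] := h _ (nbhsx_ballx t r r0).
  by exists s => //; move: Bs; rewrite -ball_normE.
move=> /nbhs_ballP[r /= r0 rB]; have [s As st] := h r r0.
by exists s; split => //; apply: rB; rewrite -ball_normE.
Qed.

Lemma sg_measurable e : measurable_fun setT (fun p : plane R => sg (crd e p)).
Proof.
have mc : measurable_fun setT (crd e : plane R -> R).
  by rewrite /crd; case: e; [exact: measurable_snd|exact: measurable_fst].
by apply: measurable_fun_ifT => //; apply: measurable_fun_ler.
Qed.

(* The products of psi with tanh(n crd / 2) are test functions converging to t:
   since |psi| <= L |crd|, the term of their gradient containing the derivative of
   tanh stays bounded and tends to 0 off the axes. *)
Lemma signed_graph_closure e psi (t : L2D * L2D * L2D) : test_function psi ->
  (forall p, psi (flip e p) = - psi p) ->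
  {ae lebD R, forall p, t.1.1 p = sg (crd e p) * psi p} ->
  {ae lebD R, forall p, t.1.2 p = sg (crd e p) * pd1 psi p} ->
  {ae lebD R, forall p, t.2 p = sg (crd e p) * pd2 psi p} ->
  closure (@test_graph R) t.
Proof.
move=> tpsi opsi t0 t1 t2.
have [c0 [d1 d2 [c1 _] [c2 _]]] := tpsi.1 1%N.
have [C0 C00 psiC] := bounded_on_D c0.
have [C1 C10 pd1C] := bounded_on_D c1.
have [C2 C20 pd2C] := bounded_on_D c2.
pose L := if e then C2 else C1.
have L0 : 0 <= L by rewrite /L; case: (e).
have crdD (p : plane R) : D p -> - 2^-1 < crd e p < 2^-1.
  by case: p => x y [/=]; rewrite !in_itv /= /crd => hx hy; case: (e).
have lip (p : plane R) : D p -> `|psi p| <= L * `|crd e p|.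
  move=> Dp; have := crdD p Dp; case: p Dp => x y [/= xD yD].
  rewrite /L; move: opsi; case: (e) => opsi cD.
    apply: (@odd_lipschitz R (fun s => psi (x, s))) => //.
    - by move=> s; exact: (d2 (x, s)).
    - by move=> s; have := opsi (x, s); rewrite /flip /refl /= mul1r mulN1r.
    - by move=> s sD; apply: (pd2C (x, s)); split=> //=; rewrite in_itv.
  apply: (@odd_lipschitz R (fun s => psi (s, y))) => //.
  - by move=> s; exact: (d1 (s, y)).
  - by move=> s; have := opsi (s, y); rewrite /flip /refl /= mul1r mulN1r.
  - by move=> s sD; apply: (pd1C (s, y)); split=> //=; rewrite in_itv.
pose m n := fun p : R * R => soft_sign n (crd e p).
have tm n : test_function (fun p => m n p * psi p).
  by apply: test_mul => // k; exact: Ck_soft_sign.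
have /choice[s sP] := fun n => graph_exists (tm n).
have pd1E n p : pd1 (fun p => m n p * psi p) p =
    m n p * pd1 psi p + (if e then 0 else soft_slope n (crd e p)) * psi p.
  have [h E] := pd1_soft_sign e n p; have [_ ->] := @pd1_mul R (m n) psi p h (d1 p).
  rewrite [pd1 (m n) p]E (mulrC (psi p)); congr (_ + _ * _).
  by rewrite /crd; case: (e).
have pd2E n p : pd2 (fun p => m n p * psi p) p =
    m n p * pd2 psi p + (if e then soft_slope n (crd e p) else 0) * psi p.
  have [h E] := pd2_soft_sign e n p; have [_ ->] := @pd2_mul R (m n) psi p h (d2 p).
  rewrite [pd2 (m n) p]E (mulrC (psi p)); congr (_ + _ * _).
  by rewrite /crd; case: (e).
(* Taking [b] to be 0 or [soft_slope] lets one estimate serve the function and both partial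
   derivatives. *)
have bound (h : R * R -> R) C (b : nat -> R -> R) n (p : plane R) : D p -> 0 <= C -> `|h p| <= C ->
    b n (crd e p) = 0 \/ b n (crd e p) = soft_slope n (crd e p) ->
    `|sg (crd e p) * h p - (m n p * h p + b n (crd e p) * psi p)| <= 2 * C + 2 * L /\
    (crd e p != 0 -> `|sg (crd e p) * h p - (m n p * h p + b n (crd e p) * psi p)| <=
      (2 / `|crd e p| * C + 8 / `|crd e p| * L) / n.+1%:R).
  move=> Dp C_ge0 hC bE.
  have [s1 s2] := soft_sign_dist n (crd e p).
  have [u0 u1 u2] := soft_slope_bound n (crd e p).
  have lp := lip p Dp.
  have -> : sg (crd e p) * h p - (m n p * h p + b n (crd e p) * psi p) =
    (sg (crd e p) - m n p) * h p - b n (crd e p) * psi p by ring.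
  have bpsi : `|b n (crd e p) * psi p| <= (`|crd e p| * soft_slope n (crd e p)) * L.
    case: bE => ->; first by rewrite mul0r normr0; apply: mulr_ge0 => //; apply: mulr_ge0.
    rewrite normrM (ger0_norm u0) -mulrA mulrCA ler_wpM2l //.
    by rewrite mulrC.
  split.
    apply: le_trans (ler_normB _ _) _; rewrite normrM lerD //.
      by rewrite ler_pM.
    by apply: le_trans bpsi _; rewrite ler_wpM2r.
  move=> cp; apply: le_trans (ler_normB _ _) _; rewrite normrM mulrDl lerD //.
    by rewrite mulrAC ler_pM ?s2.
  by apply: le_trans bpsi _; rewrite [leRHS]mulrAC ler_wpM2r ?u2.
have small (x : L2D) (z : nat -> L2D) (h : R * R -> R) (hm : nat -> R * R -> R) C (b : nat -> R -> R) :
    continuous h -> (forall n, continuous (hm n)) -> 0 <= C -> (forall p, D p -> `|h p| <= C) ->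
    (forall n p, hm n p = m n p * h p + b n (crd e p) * psi p) ->
    (forall n p, b n (crd e p) = 0 \/ b n (crd e p) = soft_slope n (crd e p)) ->
    {ae lebD R, forall p, x p = sg (crd e p) * h p} ->
    (forall n, {ae lebD R, forall p, z n p = hm n p}) ->
    `|x - z n| @[n --> \oo] --> 0.
  move=> ch chm C_ge0 hC hmE bE xE zE.
  apply: (@L2_cvg0 R (fun n => x - z n) (fun n p => sg (crd e p) * h p - hm n p) (2 * C + 2 * L)).
  - move=> n; apply: measurable_funB; last exact: continuous_plane_measurable.
    by apply: measurable_funM; [exact: sg_measurable|exact: continuous_plane_measurable].
  - by move=> n; apply: filterS3 (L2_subE x (z n)) xE (zE n) => p -> -> ->.
  - by move=> n p Dp; rewrite hmE; case: (bound h C b n p Dp C_ge0 (hC p Dp) (bE n p)).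
  - move=> p Dp p1 p2; exists (2 / `|crd e p| * C + 8 / `|crd e p| * L) => n.
    rewrite hmE; case: (bound h C b n p Dp C_ge0 (hC p Dp) (bE n p)) => _; apply.
    by rewrite /crd; case: (e).
have cm n : [/\ continuous (fun p => m n p * psi p), continuous (pd1 (fun p => m n p * psi p)) &
    continuous (pd2 (fun p => m n p * psi p))].
  by have [k0 [_ _ [k1 _] [k2 _]]] := (tm n).1 1%N.
have z0 : `|t.1.1 - (s n).1.1| @[n --> \oo] --> 0.
  apply: (small _ _ psi (fun n p => m n p * psi p) C0 (fun _ _ => 0)) => //.
  - by move=> n; case: (cm n).
  - by move=> n p; rewrite mul0r addr0.
  - by left.
  - by move=> n; case: (sP n).
have z1 : `|t.1.2 - (s n).1.2| @[n --> \oo] --> 0.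
  apply: (small _ _ (pd1 psi) (fun n => pd1 (fun p => m n p * psi p)) C1
    (fun n y => if e then 0 else soft_slope n y) c1 _ C10 pd1C pd1E _ t1 _).
  - by move=> n; case: (cm n).
  - by move=> n p; case: (e); [left|right].
  - by move=> n; case: (sP n).
have z2 : `|t.2 - (s n).2| @[n --> \oo] --> 0.
  apply: (small _ _ (pd2 psi) (fun n => pd2 (fun p => m n p * psi p)) C2
    (fun n y => if e then soft_slope n y else 0) c2 _ C20 pd2C pd2E _ t2 _).
  - by move=> n; case: (cm n).
  - by move=> n p; case: (e); [right|left].
  - by move=> n; case: (sP n).
apply/closureP => r r0.
have [n [n0 n1 n2]] : exists n, [/\ `|t.1.1 - (s n).1.1| < r, `|t.1.2 - (s n).1.2| < r &
    `|t.2 - (s n).2| < r].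
  have lt (x : nat -> L2D) : `|x n| @[n --> \oo] --> 0 -> \forall n \near \oo, `|x n| < r.
    by move=> /cvgr0Pnorm_lt /(_ r r0); apply: filterS => n; rewrite normr_id.
  have [N _ h] := filterI (lt _ z0) (filterI (lt _ z1) (lt _ z2)).
  by exists N; have [? [? ?]] := h N (leqnn N).
exists (s n); last exact: norm_triple_lt.
exists (fun p => m n p * psi p); have [? ? ?] := sP n; split => //; exact: tm.
Qed.

End sign_multiplication.

(** * Completeness of the energy space and lifting of maps *)

Section H10_theory.
Variable R : realType.
Local Notation L2D := (L2 (lebD R)).
Local Notation triple := (L2D * L2D * L2D)%type.

Lemma H10_closure (v : H10 R) : closure (@test_graph R) (H10val v).
Proof. by have := H10valP v; rewrite inE. Qed.

Lemma H10_norm_ge (v : H10 R) :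
  [/\ `|H10_fun v| <= `|v|, `|grad1 v| <= `|v| & `|grad2 v| <= `|v|].
Proof.
have h1 : `|grad1 v| <= `|v|.
  by rewrite -[`|grad1 v|]normr_id -sqrtr_sqr ler_sqrt ?lerDl ?addr_ge0 ?sqr_ge0.
have h2 : `|grad2 v| <= `|v|.
  by rewrite -[`|grad2 v|]normr_id -sqrtr_sqr ler_sqrt ?lerDr ?addr_ge0 ?sqr_ge0.
by split => //; apply: le_trans h1; exact: poincare.
Qed.

Lemma H10_norm_le (v : H10 R) : `|v| <= `|grad1 v| + `|grad2 v|.
Proof.
rewrite -(@ler_pXn2r _ 2) ?nnegrE ?addr_ge0 // [X in X ^+ 2 <= _]/Num.Def.normr /=.
rewrite sqr_sqrtr ?addr_ge0 ?sqr_ge0 // sqrrD addrAC lerDl mulrn_wge0 // mulr_ge0 //.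
Qed.

(** The norm sees only gradients; Poincare's inequality makes the functions Cauchy too, and the
    limit triple stays in the closure. *)
Lemma H10_complete : seq_complete (H10 R).
Proof.
move=> v cv; have c2 := L2_complete (lebD_fin R).
have cauchy (F : H10 R -> L2D) : (forall u w, F (u - w) = F u - F w) ->
    (forall u, `|F u| <= `|u|) ->
    exists l, forall e, 0 < e -> exists N, forall n, (N <= n)%N -> `|F (v n) - l| < e.
  move=> FB Fle; apply: (c2 (F \o v)) => e /cv[N NP]; exists N => m n Nm Nn.
  by rewrite /= -FB; exact: le_lt_trans (Fle _) (NP _ _ Nm Nn).
have [x0 h0] := cauchy (@H10_fun R) (fun _ _ => erefl) (fun u => let: And3 h _ _ := H10_norm_ge u in h).
have [x1 h1] := cauchy (@grad1 R) (fun _ _ => erefl) (fun u => let: And3 _ h _ := H10_norm_ge u in h).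
have [x2 h2] := cauchy (@grad2 R) (fun _ _ => erefl) (fun u => let: And3 _ _ h := H10_norm_ge u in h).
have tP : (x0, x1, x2) \in @H10_pred R.
  rewrite inE; apply/closureP => r r0.
  have r20 : 0 < r / 2 by rewrite divr_gt0.
  have [N0 P0] := h0 _ r20; have [N1 P1] := h1 _ r20; have [N2 P2] := h2 _ r20.
  pose n := maxn N0 (maxn N1 N2).
  have a0 : `|H10_fun (v n) - x0| < r / 2 by apply: P0; rewrite leq_maxl.
  have a1 : `|grad1 (v n) - x1| < r / 2 by apply: P1; rewrite leq_max leq_maxl orbT.
  have a2 : `|grad2 (v n) - x2| < r / 2 by apply: P2; rewrite leq_max leq_maxr orbT.
  have near : `|(x0, x1, x2) - H10val (v n)| < r / 2.
    by apply: norm_triple_lt; rewrite distrC.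
  have [s sg sn] := (closureP _ _).1 (@H10_closure (v n)) _ r20.
  exists s => //; rewrite -[_ - s](subrKA (H10val (v n))).
  by apply: le_lt_trans (ler_normD _ _) _; rewrite [ltRHS]splitr ltrD.
exists (MkH10 tP) => e e0; have e20 : 0 < e / 2 by rewrite divr_gt0.
have [N1 P1] := h1 _ e20; have [N2 P2] := h2 _ e20.
exists (maxn N1 N2) => n; rewrite geq_max => /andP[n1 n2].
apply: le_lt_trans (H10_norm_le _) _; rewrite [ltRHS]splitr ltrD //.
  exact: P1.
exact: P2.
Qed.

(** By density and contractivity, only the images of test functions have to be examined. *)
Lemma H10_lift (F : {linear triple -> triple}) : (forall t, `|F t| <= `|t|) ->
  (forall t, test_graph t -> closure (@test_graph R) (F t)) ->
  exists F' : {linear H10 R -> H10 R}, forall v, H10val (F' v) = F (H10val v).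
Proof.
move=> Fle FT.
have FP (v : H10 R) : F (H10val v) \in @H10_pred R.
  rewrite inE; apply/closureP => r r0; have r20 : 0 < r / 2 by rewrite divr_gt0.
  have [s sg sn] := (closureP _ _).1 (@H10_closure v) _ r20.
  have [s' sg' sn'] := (closureP _ _).1 (FT s sg) _ r20.
  exists s' => //; rewrite -[_ - s'](subrKA (F s)).
  apply: le_lt_trans (ler_normD _ _) _; rewrite [ltRHS]splitr ltrD //.
  by rewrite -linearB; exact: le_lt_trans (Fle _) sn.
pose F0 v : H10 R := MkH10 (FP v).
have lin : linear F0.
  by move=> k u v; apply: val_inj; rewrite /= linearP.
pose F' : {linear H10 R -> H10 R} := HB.pack F0 (GRing.isLinear.Build _ _ _ _ F0 lin).
by exists F'.
Qed.

Lemma L2_flip e : exists Q : {linear L2D -> L2D},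
  (forall x : L2D, {ae lebD R, forall p, (Q x : L2D) p = x (@flip R e p)}) /\
  (forall x, `|Q x| = `|x|).
Proof.
have [Q [QE Qn]] := L2_wcomp (measurable_refl (flip_sign1 R e) (flip_sign2 R e))
  (fun A mA => lebD_refl (flip_sign1_sqr R e) (flip_sign2_sqr R e) mA)
  (measurable_cst (1 : R)) (fun _ => expr1n R 2).
exists Q; split => // x; apply: filterS (QE x) => p ->.
by rewrite mul1r.
Qed.

Lemma L2_sg e : exists M : {linear L2D -> L2D},
  (forall x : L2D, {ae lebD R, forall p, (M x : L2D) p = sg (crd e p) * x p}) /\
  (forall x, `|M x| = `|x|).
Proof.
have [M [ME Mn]] := @L2_wcomp _ _ R (lebD R) id (@measurable_id _ _ _)
  (fun A _ => erefl) (fun p => sg (crd e p)) (@sg_measurable R e) (fun p => sg_sqr (crd e p)).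
by exists M.
Qed.

Lemma triple_map (Q0 Q1 Q2 : {linear L2D -> L2D}) : exists F : {linear triple -> triple},
  forall t, F t = (Q0 t.1.1, Q1 t.1.2, Q2 t.2).
Proof.
pose F0 (t : triple) : triple := (Q0 t.1.1, Q1 t.1.2, Q2 t.2).
have lin : linear F0 by move=> k u v; rewrite /F0 /= !linearP.
pose F : {linear triple -> triple} := HB.pack F0 (GRing.isLinear.Build _ _ _ _ F0 lin).
by exists F.
Qed.

End H10_theory.

(** * Reflections of the energy space *)

Section H10_symmetry.
Variable R : realType.
Local Notation L2D := (L2 (lebD R)).
Local Notation triple := (L2D * L2D * L2D)%type.
Local Notation flip := (@flip R).

Lemma ae_flip e (P : R * R -> Prop) :
  {ae lebD R, forall p, P p} -> {ae lebD R, forall p, P (flip e p)}.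
Proof.
exact: (ae_comp (measurable_refl (flip_sign1 R e) (flip_sign2 R e))
  (fun A mA => lebD_refl (flip_sign1_sqr R e) (flip_sign2_sqr R e) mA)).
Qed.

Lemma flipK e : involutive (flip e).
Proof. exact: refl_involutive (flip_sign1_sqr R e) (flip_sign2_sqr R e). Qed.

Definition is_flip e (S : {linear H10 R -> H10 R}) := forall v, [/\
  {ae lebD R, forall p, H10_fun (S v) p = H10_fun v (flip e p)},
  {ae lebD R, forall p, grad1 (S v) p = flip_sign1 R e * grad1 v (flip e p)} &
  {ae lebD R, forall p, grad2 (S v) p = flip_sign2 R e * grad2 v (flip e p)}].

Lemma L2_scaleE a (x : L2D) : {ae lebD R, forall p, (a *: x : L2D) p = a * x p}.
Proof.
have z : {ae lebD R, forall p, (0 : L2D) p = 0}.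
  by have := L2_subE (0 : L2D) 0; rewrite subrr; apply: filterS => p ->; rewrite subrr.
have := L2ae_lin a x 0; rewrite addr0; apply: filterS2 z => p -> ->.
by rewrite addr0.
Qed.

Lemma H10_flip_exists e : exists S : {linear H10 R -> H10 R}, is_flip e S /\
  forall v, S v = - v -> exists v' : H10 R,
    {ae lebD R, forall p, grad1 v' p = sg (crd e p) * grad1 v p} /\
    {ae lebD R, forall p, grad2 v' p = sg (crd e p) * grad2 v p}.
Proof.
have [Q [QE Qn]] := L2_flip R e; have [M [ME Mn]] := L2_sg R e.
have /choice[Z ZE] : forall a : R, exists Z : {linear L2D -> L2D}, forall x, Z x = a *: Q x.
  move=> a; pose Z0 x := a *: Q x.
  have lin : linear Z0 by move=> k u v; rewrite /Z0 linearP scalerDr !scalerA mulrC.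
  pose Z : {linear L2D -> L2D} := HB.pack Z0 (GRing.isLinear.Build _ _ _ _ Z0 lin).
  by exists Z.
have [F FE] := triple_map Q (Z (flip_sign1 R e)) (Z (flip_sign2 R e)).
have [G GE] := triple_map M M M.
have nle (t t' : triple) : `|t'.1.1| <= `|t.1.1| -> `|t'.1.2| <= `|t.1.2| ->
    `|t'.2| <= `|t.2| -> `|t'| <= `|t|.
  move=> h1 h2 h3; apply/ler_addgt0Pr => r r0; apply: ltW.
  have [g1 g2 g3] := norm_triple_ge t.
  apply: norm_triple_lt; apply: le_lt_trans (_ : `|t| < _); rewrite ?ltrDl //.
  - exact: le_trans h1 g1.
  - exact: le_trans h2 g2.
  - exact: le_trans h3 g3.
have Fn t : `|F t| <= `|t|.
  apply: nle; rewrite FE /= ?ZE ?normrZ ?Qn //.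
    by case: (e); rewrite /flip_sign1 ?normrN normr1 mul1r.
  by case: (e); rewrite /flip_sign2 ?normrN normr1 mul1r.
have Gn t : `|G t| <= `|t| by apply: nle; rewrite GE /= Mn.
have Fae (t : triple) (phi psi chi : R * R -> R) :
    {ae lebD R, forall p, t.1.1 p = phi p} -> {ae lebD R, forall p, t.1.2 p = psi p} ->
    {ae lebD R, forall p, t.2 p = chi p} ->
    [/\ {ae lebD R, forall p, ((F t).1.1 : L2D) p = phi (flip e p)},
        {ae lebD R, forall p, ((F t).1.2 : L2D) p = flip_sign1 R e * psi (flip e p)} &
        {ae lebD R, forall p, ((F t).2 : L2D) p = flip_sign2 R e * chi (flip e p)}].
  move=> h1 h2 h3; rewrite FE /= !ZE; split.
  - by apply: filterS2 (QE t.1.1) (ae_flip e h1) => p -> ->.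
  - apply: filterS3 (L2_scaleE (flip_sign1 R e) (Q t.1.2)) (QE t.1.2) (ae_flip e h2).
    by move=> p -> -> ->.
  - apply: filterS3 (L2_scaleE (flip_sign2 R e) (Q t.2)) (QE t.2) (ae_flip e h3).
    by move=> p -> -> ->.
have dphi (phi : R * R -> R) : test_function phi ->
    (forall p, pd1 (phi \o flip e) p = flip_sign1 R e * pd1 phi (flip e p)) /\
    (forall p, pd2 (phi \o flip e) p = flip_sign2 R e * pd2 phi (flip e p)).
  move=> [/(_ 1%N) [_ [d1 d2 _ _]] _]; split=> p.
    by case: (@pd1_refl R (flip_sign1 R e) (flip_sign2 R e) phi p (d1 (flip e p))).
  by case: (@pd2_refl R (flip_sign1 R e) (flip_sign2 R e) phi p (d2 (flip e p))).
have tphi (phi : R * R -> R) : test_function phi -> test_function (phi \o flip e).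
  exact: test_refl (flip_sign1_sqr R e) (flip_sign2_sqr R e).
have FT t : test_graph t -> test_graph (F t).
  move=> [phi [tp h1 h2 h3]]; have [f1 f2 f3] := Fae _ _ _ _ h1 h2 h3.
  have [p1 p2] := dphi _ tp.
  exists (phi \o flip e); split => //; first exact: tphi.
    by apply: filterS f2 => p ->; rewrite p1.
  by apply: filterS f3 => p ->; rewrite p2.
have [S SE] := H10_lift Fn (fun t tt => subset_closure (FT t tt)).
(* Multiplication by the sign preserves V only on odd elements. Composed with the projection onto
   the odd part it is defined on all triples and can be lifted; on odd elements it is the plain
   multiplication. *)
pose H0 (t : triple) : triple := G (2^-1 *: (t - F t)).
have Hlin : linear H0.
  move=> k u v; rewrite /H0 -linearP; congr (G _).
  rewrite linearP scalerA mulrC -scalerA -scalerDr; congr (_ *: _).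
  by rewrite opprD scalerBr addrACA.
pose H : {linear triple -> triple} := HB.pack H0 (GRing.isLinear.Build _ _ _ _ H0 Hlin).
have Hn t : `|H t| <= `|t|.
  apply: le_trans (Gn _) _; rewrite normrZ gtr0_norm ?invr_gt0 // ler_pdivrMl //.
  apply: le_trans (ler_normB _ _) _; have := Fn t; rewrite mulr_natl mulr2n; lra.
have HT t : test_graph t -> closure (@test_graph R) (H t).
  move=> [phi [tp h1 h2 h3]]; have [f1 f2 f3] := Fae _ _ _ _ h1 h2 h3.
  have [p1 p2] := dphi _ tp; have tf := tphi _ tp.
  have [_ [d1 d2 _ _]] := tp.1 1%N; have [_ [e1 e2 _ _]] := tf.1 1%N.
  (* Twice the odd part of [phi]; the factor [2^-1] is restored at the end by stability under
     scaling. *)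
  pose psi := -1 \*: (phi \o flip e) \+ phi.
  have tpsi : test_function psi by exact: test_lin.
  have psi1 p : pd1 psi p = pd1 phi p - flip_sign1 R e * pd1 phi (flip e p).
    by rewrite /psi (pd1_lin _ e1 d1) /= p1 scaleN1r addrC.
  have psi2 p : pd2 psi p = pd2 phi p - flip_sign2 R e * pd2 phi (flip e p).
    by rewrite /psi (pd2_lin _ e2 d2) /= p2 scaleN1r addrC.
  have psi0 p : psi p = phi p - phi (flip e p) by rewrite /psi /= scaleN1r addrC.
  rewrite (_ : H t = 2^-1 *: G (t - F t)); last by rewrite /= /H0 linearZ.
  have cl : closure (@test_graph R) (G (t - F t)).
    apply: (signed_graph_closure (e := e) tpsi).
    - by move=> p; rewrite !psi0 flipK opprB.
    - rewrite GE /=; apply: filterS2 (ME (t.1.1 - (F t).1.1)) (filterI (L2_subE t.1.1 (F t).1.1) (filterI h1 f1)).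
      by move=> p -> [-> [-> ->]]; rewrite psi0.
    - rewrite GE /=; apply: filterS2 (ME (t.1.2 - (F t).1.2)) (filterI (L2_subE t.1.2 (F t).1.2) (filterI h2 f2)).
      by move=> p -> [-> [-> ->]]; rewrite psi1.
    - rewrite GE /=; apply: filterS2 (ME (t.2 - (F t).2)) (filterI (L2_subE t.2 (F t).2) (filterI h3 f3)).
      by move=> p -> [-> [-> ->]]; rewrite psi2.
  have := @rpredZ _ _ (@H10_pred R) 2^-1 (G (t - F t)); rewrite !inE; exact.
have [J JE] := H10_lift Hn HT.
exists S; split.
  move=> v; rewrite /H10_fun /grad1 /grad2 SE.
  by apply: (Fae _ (H10_fun v) (grad1 v) (grad2 v)); apply: filterS (ae_off_axes R) => p _.
move=> v Sv; exists (J v).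
have Fv : F (H10val v) = - H10val v by rewrite -SE Sv.
have JvE : H10val (J v) = G (H10val v).
  rewrite JE /= /H0 Fv opprK; congr (G _).
  by rewrite scalerDr -scalerDl (_ : 2^-1 + 2^-1 = 1 :> R) ?scale1r //; lra.
by rewrite /grad1 /grad2 JvE GE /=; split; exact: ME.
Qed.

Lemma H10_ext (u v : H10 R) : {ae lebD R, forall p, H10_fun u p = H10_fun v p} ->
  {ae lebD R, forall p, grad1 u p = grad1 v p} ->
  {ae lebD R, forall p, grad2 u p = grad2 v p} -> u = v.
Proof.
move=> /L2_ext h1 /L2_ext h2 /L2_ext h3; apply: val_inj; move: h1 h2 h3.
rewrite /H10_fun /grad1 /grad2 /=.
by case: (H10val u) (H10val v) => -[? ?] ? [[? ?] ?] /= -> -> ->.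
Qed.

Lemma is_flip_involutive e S : is_flip e S -> forall v, S (S v) = v.
Proof.
move=> SP v; have [a1 a2 a3] := SP v; have [b1 b2 b3] := SP (S v).
apply: H10_ext.
- by apply: filterS2 b1 (ae_flip e a1) => p -> ->; rewrite flipK.
- apply: filterS2 b2 (ae_flip e a2) => p -> ->; rewrite flipK mulrA -expr2.
  by rewrite flip_sign1_sqr mul1r.
- apply: filterS2 b3 (ae_flip e a3) => p -> ->; rewrite flipK mulrA -expr2.
  by rewrite flip_sign2_sqr mul1r.
Qed.

Lemma is_flip_comm e e' S S' : is_flip e S -> is_flip e' S' ->
  forall v, S (S' v) = S' (S v).
Proof.
move=> SP SP' v; have [a1 a2 a3] := SP v; have [b1 b2 b3] := SP' v.
have [c1 c2 c3] := SP (S' v); have [d1 d2 d3] := SP' (S v).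
have fC p : flip e (flip e' p) = flip e' (flip e p).
  by rewrite /flip /refl /= !mulrA (mulrC (flip_sign1 R e)) (mulrC (flip_sign2 R e)).
apply: H10_ext.
- apply: filterS2 (filterI c1 (ae_flip e b1)) (filterI d1 (ae_flip e' a1)).
  by move=> p [-> ->] [-> ->]; rewrite fC.
- apply: filterS2 (filterI c2 (ae_flip e b2)) (filterI d2 (ae_flip e' a2)).
  by move=> p [-> ->] [-> ->]; rewrite fC !mulrA (mulrC (flip_sign1 R e)).
- apply: filterS2 (filterI c3 (ae_flip e b3)) (filterI d3 (ae_flip e' a3)).
  by move=> p [-> ->] [-> ->]; rewrite fC !mulrA (mulrC (flip_sign2 R e)).
Qed.

End H10_symmetry.

(** * The energy forms of the quadrants *)

Section quadrant_forms.
Variable R : realType.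
Local Notation L2D := (L2 (lebD R)).
Local Notation Q := (@quadrant R).
Local Notation flip := (@flip R).

Lemma measurable_quadrant i : measurable (Q i).
Proof. by apply: measurableX; rewrite /side; case: ifP => _; exact: measurable_itv. Qed.

Lemma side_sub b (x : R) : side b x -> - 2^-1 < x < 2^-1.
Proof.
by rewrite /side; case: b; rewrite /= in_itv /= => /andP[? ?]; apply/andP; split; lra.
Qed.

Lemma quadrant_D i : Q i `<=` @D R.
Proof. by move=> [x y] [/= /side_sub hx /side_sub hy]; split; rewrite /= in_itv. Qed.

Lemma side_sg b (x : R) : side b x -> sg x = if b then 1 else -1.
Proof.
rewrite /side /sg; case: b; rewrite /= in_itv /= => /andP[h1 h2]; first by rewrite ltW.
by rewrite leNgt h2.
Qed.

Lemma quadrant_sg e i p : Q i p -> sg (crd e p) = if e then sign2 R i else sign1 R i.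
Proof.
by case: p => x y [/= /side_sg hx /side_sg hy]; case: e; rewrite /crd /sign1 /sign2 /= ?hx ?hy.
Qed.

Lemma side_opp b (x : R) : side b (- x) = side (~~ b) x :> Prop.
Proof.
apply/propext; rewrite /side; case: b; rewrite /= !in_itv /=;
  by split=> /andP[? ?]; apply/andP; split; lra.
Qed.

Lemma flip_quadrant e i :
  flip e @^-1` Q i = Q (if e then flip2 i else flip1 i).
Proof.
have odd1 : odd (flip1 i) = ~~ odd i.
  by case: (i) => [[|[|[|[|m]]]] hm] //; rewrite /flip1 /= inordK.
have le1 : (2 <= flip1 i)%N = (2 <= i)%N.
  by case: (i) => [[|[|[|[|m]]]] hm] //; rewrite /flip1 /= inordK.
have odd2 : odd (flip2 i) = odd i.
  by case: (i) => [[|[|[|[|m]]]] hm] //; rewrite /flip2 /= inordK.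
have le2 : (2 <= flip2 i)%N = ~~ (2 <= i)%N.
  by case: (i) => [[|[|[|[|m]]]] hm] //; rewrite /flip2 /= inordK.
apply/seteqP; rewrite /quadrant /flip /refl /flip_sign1 /flip_sign2.
case: e; rewrite ?odd1 ?odd2 ?le1 ?le2; split=> -[x y] [/=];
  by rewrite mul1r mulN1r side_opp.
Qed.

(** [grad_form] integrates against [leb2], the L^2 theory against [lebD]; the two measures agree
    inside a quadrant. *)
Lemma grad_formE i (u v : H10 R) : grad_form (Q i) u v =
  L2form (Q i) (grad1 u) (grad1 v) + L2form (Q i) (grad2 u) (grad2 v).
Proof.
have mQ := measurable_quadrant i.
rewrite /L2form -(RintegralD mQ (L2_mul_integrable (grad1 u) (grad1 v) mQ)
  (L2_mul_integrable (grad2 u) (grad2 v) mQ)).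
have E : forall A, measurable A -> A `<=` Q i -> leb2 R A = lebD R A.
  move=> A mA AQ; rewrite /lebD /= /mrestr setIidl //.
  exact: subset_trans AQ (@quadrant_D i).
exact: (congr1 fine (eq_measure_integral _ E)).
Qed.

Lemma L2form_ae (A : set (plane R)) (x y x' y' : L2D) (k : R) : measurable A ->
  {ae lebD R, forall p, A p -> x p * y p = k * (x' p * y' p)} ->
  L2form A x y = k * L2form A x' y'.
Proof.
move=> mA h; rewrite /L2form -RintegralZl //; last exact: L2_mul_integrable.
rewrite /Rintegral; congr fine; apply: ae_eq_integral => //.
- by apply: measurable_int (L2_mul_integrable _ _ mA).
- apply/measurable_EFinP; apply: measurable_funM => //.
  by apply/measurable_EFinP; apply: measurable_int (L2_mul_integrable _ _ mA).
- by apply: filterS h => p h Ap; rewrite h.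
Qed.

Lemma L2form_flip e (A : set (plane R)) (x y x' y' : L2D) : measurable A ->
  {ae lebD R, forall p, x' p = x (flip e p)} -> {ae lebD R, forall p, y' p = y (flip e p)} ->
  L2form A x' y' = L2form (flip e @^-1` A : set (plane R)) x y.
Proof.
move=> mA hx hy.
have mf : measurable_fun setT (flip e : plane R -> plane R) by exact: measurable_refl.
have inv B : measurable B -> lebD R (flip e @^-1` B) = lebD R B.
  by move=> mB; exact: (lebD_refl (flip_sign1_sqr R e) (flip_sign2_sqr R e) mB).
have mA' : measurable (flip e @^-1` A : set (plane R)).
  by rewrite -[X in measurable X]setTI; exact: mf.
have AA : flip e @^-1` (flip e @^-1` A) = A.
  by apply/seteqP; split=> p; rewrite /preimage /= flipK.
have mxy : measurable_fun setT (fun p : plane R => (x p * y p)%:E).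
  by apply/measurable_EFinP; apply: measurable_funM; exact: L2fun_measurable.
have ae : {ae lebD R, forall p, A p -> (x' p * y' p)%:E = (x (flip e p) * y (flip e p))%:E}.
  by apply: filterS2 hx hy => p -> -> _.
have mxyf : measurable_fun setT (fun p : plane R => (x (flip e p) * y (flip e p))%:E).
  exact: (measurableT_comp mxy mf).
have intf : (lebD R).-integrable (flip e @^-1` (flip e @^-1` A) : set (plane R))
    ((fun p : plane R => (x p * y p)%:E) \o flip e).
  rewrite AA; have /integrableP[m1 m2] := L2_mul_integrable x' y' mA.
  apply/integrableP; split; first exact: measurable_funTS.
  apply: le_lt_trans m2; rewrite le_eqVlt; apply/orP; left; apply/eqP.
  apply: ae_eq_integral => //.
  - by apply: measurableT_comp => //; exact: measurable_funTS.
  - exact: measurableT_comp.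
  - by apply: filterS ae => p h /h [E] /=; rewrite E.
rewrite /L2form /Rintegral -(integral_comp_invariant mf inv mA' mxy intf) AA.
congr fine; apply: ae_eq_integral => //.
- by apply: measurable_int (L2_mul_integrable _ _ mA).
- exact: measurable_funTS.
Qed.

(** Off the axes, a null set, each point of [D] lies in exactly one quadrant, selected by the signs
    of its coordinates. *)
Lemma L2form_quadrants (x : L2D) : \sum_(i < 4) L2form (Q i) x x = `|x| ^+ 2.
Proof.
have mx (A : set (plane R)) : measurable_fun A (fun p => (x p * x p)%:E).
  by apply/measurable_EFinP; apply: measurable_funTS; apply: measurable_funM;
    exact: L2fun_measurable.
have m1 i : measurable_fun setT (fun p : plane R => (x p * x p * \1_(Q i) p)%:E).
  apply/measurable_EFinP; apply: measurable_funM; first by apply/measurable_EFinP.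
  by apply: measurable_indic; exact: measurable_quadrant.
have E i : ((L2form (Q i) x x)%:E = \int[lebD R]_p (x p * x p * \1_(Q i) p)%:E)%E.
  rewrite /L2form /Rintegral fineK; last first.
    by apply: integrable_fin_num => //; [exact: measurable_quadrant|
      apply: L2_mul_integrable; exact: measurable_quadrant].
  rewrite integral_mkcond; apply: eq_integral => p _; rewrite patchE indicE.
  by case: ifP => _; rewrite ?mulr1 ?mulr0.
apply: EFin_inj; rewrite -sumEFin (eq_bigr _ (fun i _ => E i)) -ge0_integral_sum //; last first.
  by move=> i p _; rewrite lee_fin mulr_ge0 // -?expr2 ?sqr_ge0 // indicE; case: (_ \in _).
rewrite -L2_sqr_integral; apply: ae_eq_integral => //.
  by apply: emeasurable_sum => i; exact: m1.
apply: filterS (ae_off_axes R) => -[a b] [/= [/= aD bD] a0 b0] _.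
rewrite sumEFin -mulr_sumr expr2; congr (_%:E); rewrite -[RHS]mulr1; congr (_ * _).
move: aD bD; rewrite !in_itv /= => /andP[a1 a2] /andP[b1 b2].
have qE (i : 'I_4) : \1_(Q i) (a, b) = ((odd i == (0 < a)) && ((2 <= i)%N == (0 < b)))%:R :> R.
  rewrite indicE; congr (_%:R); congr (nat_of_bool _); apply/idP/idP.
    rewrite inE => -[/= h1 h2]; apply/andP; split.
      by move: h1; rewrite /side; case: (odd i); rewrite /= in_itv /= => /andP[? ?]; [|rewrite eq_sym eqbF_neg -leNgt]; [apply/eqP/esym|exact: ltW].
    by move: h2; rewrite /side; case: (2 <= i)%N; rewrite /= in_itv /= => /andP[? ?]; [|rewrite eq_sym eqbF_neg -leNgt]; [apply/eqP/esym|exact: ltW].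
  move=> /andP[/eqP o1 /eqP o2]; rewrite inE; split=> /=.
    rewrite o1 /side; case: (ltgtP 0 a) a0 => [h _|h _|<-]; rewrite /= ?in_itv /= ?eqxx //; apply/andP; split; lra.
  rewrite o2 /side; case: (ltgtP 0 b) b0 => [h _|h _|<-]; rewrite /= ?in_itv /= ?eqxx //; apply/andP; split; lra.
rewrite !big_ord_recr big_ord0 /= !qE /=.
by case: (0 < a); case: (0 < b); rewrite /= ?addr0 ?add0r.
Qed.

Definition quadrant_form (i : 'I_4) (u v : H10 R) : R := grad_form (Q i) u v.

Lemma quadrant_form_sym i : sym_bilinear (quadrant_form i).
Proof.
have h := L2form_sym (lebD R) (measurable_quadrant i).
split=> [u v|k u u' v]; rewrite /quadrant_form !grad_formE.
  by congr (_ + _); exact: h.1.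
apply: etrans (congr2 +%R (h.2 k (grad1 u) (grad1 u') (grad1 v)) (h.2 k (grad2 u) (grad2 u') (grad2 v))) _.
by rewrite mulrDr addrACA.
Qed.

Lemma quadrant_form_ge0 i v : 0 <= quadrant_form i v v.
Proof. by rewrite /quadrant_form grad_formE addr_ge0 // L2form_ge0. Qed.

Lemma quadrant_form_norm v : \sum_i quadrant_form i v v = `|v| ^+ 2.
Proof.
under eq_bigr do rewrite /quadrant_form grad_formE.
by rewrite big_split !L2form_quadrants [in RHS]/Num.Def.normr /= sqr_sqrtr.
Qed.

Lemma quadrant_form_flip e S : is_flip e S -> forall i v w,
  quadrant_form i (S v) (S w) = quadrant_form (if e then flip2 i else flip1 i) v w.
Proof.
move=> SP i v w; have [_ a1 a2] := SP v; have [_ b1 b2] := SP w.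
have mQ := measurable_quadrant i.
have [q [qE _]] := L2_flip R e.
rewrite /quadrant_form !grad_formE -!flip_quadrant; congr (_ + _).
  rewrite -(L2form_flip mQ (qE (grad1 v)) (qE (grad1 w))) -[RHS]mul1r.
  apply: L2form_ae => //.
  apply: filterS2 (filterI a1 b1) (filterI (qE (grad1 v)) (qE (grad1 w))) => p [-> ->] [-> ->] _.
  by rewrite mulrACA -expr2 flip_sign1_sqr.
rewrite -(L2form_flip mQ (qE (grad2 v)) (qE (grad2 w))) -[RHS]mul1r.
apply: L2form_ae => //.
apply: filterS2 (filterI a2 b2) (filterI (qE (grad2 v)) (qE (grad2 w))) => p [-> ->] [-> ->] _.
by rewrite mulrACA -expr2 flip_sign2_sqr.
Qed.

(** The sign is constant on each quadrant and leaves the integral. *)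
Lemma quadrant_form_sg e (v v' : H10 R) :
  {ae lebD R, forall p, grad1 v' p = sg (crd e p) * grad1 v p} ->
  {ae lebD R, forall p, grad2 v' p = sg (crd e p) * grad2 v p} ->
  forall i w, quadrant_form i v' w = (if e then sign2 R i else sign1 R i) * quadrant_form i v w.
Proof.
move=> h1 h2 i w; have mQ := measurable_quadrant i.
rewrite /quadrant_form !grad_formE mulrDr; congr (_ + _); apply: L2form_ae => //.
  by apply: filterS h1 => p -> /(quadrant_sg e) ->; rewrite mulrA.
by apply: filterS h2 => p -> /(quadrant_sg e) ->; rewrite mulrA.
Qed.

End quadrant_forms.

(** * The parameter cube and the conclusion *)

Lemma measurable_paramU (R : realType) : measurable (@paramU R : set (borel4 R)).
Proof.
have cU : closed (@paramU R).
  have -> : @paramU R = \bigcap_(i in [set: 'I_4])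
      ((fun y : 'rV[R]_4 => y 0 i) @^-1` `[-1, 1]%classic).
    apply/seteqP; split=> y; first by move=> h i _; rewrite /= in_itv /=; exact: h.
    by move=> h i; have := h i I; rewrite /= in_itv.
  apply: closed_bigI => i _; apply: (closed_comp (f := fun y : 'rV[R]_4 => y 0 i)); last exact: itv_closed.
  by move=> y _; exact: coord_continuous.
rewrite -[X in measurable X]setCK; apply: measurableC.
by apply: sub_sigma_algebra; exact: closed_openC.
Qed.

Theorem theorem4p1 (R : realType) (theta : R) (htheta : 0 < theta < 1)
  (f : {linear H10 R -> R^o}) (hf : continuous f)
  (u : 'rV[R]_4 -> H10 R)
  (hu : forall y, paramU y -> is_weak_solution theta f y (u y))
  (k : nat) (hk : (1 <= k)%N) :
  (exists (v : 'I_(8 * k + 5) -> H10 R)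
          (phi : 'I_(8 * k + 5) -> mpoly.mpoly 4 R),
     (forall l, (mpoly.msize (phi l) <= k.+1)%N) /\
     (forall y, paramU y ->
        taylor_trunc u k y =
        \sum_(l < 8 * k + 5) mpoly.meval (y 0) (phi l) *: v l)) /\
  (forall mu : probability (borel4 R) R, mu (@paramU R) = 1%E ->
     (rank mu (@paramU R) (taylor_trunc u k) <= ((8 * k + 5)%:R)%:E)%E).
Proof.
have U0 : @paramU R 0 by move=> i; rewrite mxE lerN10 ler01.
have uP y : paramU y -> forall v,
    wform (@quadrant_form R) (coef theta y) (u y) v = ip (@quadrant_form R) (u 0) v.
  (* At the origin the form is the inner product, so [u 0] is the Riesz representative of [f]. *)
  move=> yU v; have -> : ip (@quadrant_form R) (u 0) v = f v.
    rewrite -(hu 0 U0 v); apply: eq_bigr => i _.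
    by rewrite mxE mulr0 subr0.
  exact: (hu y yU v).
have [S1 [S1P J1]] := H10_flip_exists R false.
have [S2 [S2P J2]] := H10_flip_exists R true.
have G_J1 v : S1 v = - v -> exists v', forall i w, quadrant_form i v' w = sign1 R i * quadrant_form i v w.
  by move=> /J1[v' [h1 h2]]; exists v'; exact: (quadrant_form_sg h1 h2).
have G_J2 v : S2 v = - v -> exists v', forall i w, quadrant_form i v' w = sign2 R i * quadrant_form i v w.
  by move=> /J2[v' [h1 h2]]; exists v'; exact: (quadrant_form_sg h1 h2).
have [s [ss sp]] := taylor_spanned (@H10_complete R) (@quadrant_form_sym R) (@quadrant_form_ge0 R) (@quadrant_form_norm R)
  (is_flip_involutive S1P) (is_flip_involutive S2P) (is_flip_comm S1P S2P)
  (quadrant_form_flip S1P) (quadrant_form_flip S2P) G_J1 G_J2 htheta uP hk.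
have [v [phi [deg E]]] := taylor_trunc_poly ss sp.
split; first by exists v, phi; split => // y _; exact: E.
move=> mu _; exact: (@rank_le _ (borel4 R) R (H10 R) mu (@paramU R) (@measurable_paramU R)
  (ip (@quadrant_form R)) (ip_form (@quadrant_form_sym R)) (ip_norm (@quadrant_form_norm R)) _ (taylor_trunc u k) v
  (fun y l => mpoly.meval ((y : 'rV[R]_4) 0) (phi l)) (fun y _ => E y)).
Qed.
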